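(* Let $A\in\mathrm{GL}_n(\mathbb{Z})$ be hyperbolic and semisimple, with characteristic polynomial $\chi(A)=\mu_1^{n_1}\cdots\mu_m^{n_m}$, where $\mu_1,\ldots,\mu_m$ are the distinct irreducible factors over $\mathbb{Q}$ and $n_i\ge 1$, and for each $i$ let $\lambda_i$ be a root of $\mu_i$. Assume that all of the eigenvalues of $A$ are real. Then the following are equivalent. (i) The group $\mathbb{Z}^n\rtimes_A\mathbb{Z}$ is arithmetic. (ii) After replacing $A$ by $A^k$ for some $k\ge 1$ (so that the $\lambda_i$ are replaced by $\lambda_i^k$), the $\lambda_i$ are all powers of a single unit $\epsilon\in\mathcal{O}_L^\times$ in a real quadratic extension $L/\mathbb{Q}$; that is, there exist $k\ge1$, a real quadratic field $L$, and a unit $\epsilon\in\mathcal{O}_L^\times$ such that each $\lambda_i^k$ ($1\le i\le m$) is an integer power of $\epsilon$.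
   Context: A matrix $A\in\mathrm{GL}_n(\mathbb{Z})$ is hyperbolic if it has no (complex) eigenvalues on the unit circle, and semisimple if it is diagonalizable over $\mathbb{C}$. The group $\mathbb{Z}^n\rtimes_A\mathbb{Z}$ is the set $\mathbb{Z}^n\times\mathbb{Z}$ with multiplication $(x,i)(y,j)=(x+A^iy,\,i+j)$. A group $\Gamma$ is arithmetic if it embeds in a (linear) algebraic group $G$ defined over $\mathbb{Q}$ with image commensurable to $G(\mathbb{Z})$ (image in $G(\mathbb{Q})$ whose intersection with $G(\mathbb{Z})$ has finite index in both). $\mathcal{O}_L$ denotes the ring of integers of $L$; number fields are regarded as subfields of $\mathbb{C}$. *)

(* Defs.v *)
From HB Require Import structures.
From mathcomp Require Import all_boot all_order all_algebra all_field.
From mathcomp Require Import mpoly.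

Set Implicit Arguments.
Unset Strict Implicit.
Unset Printing Implicit Defensive.

Import Order.TTheory GRing.Theory Num.Theory.
Local Open Scope ring_scope.

(* ['M[int]_n] is a [unitRingType] only when [n] is a successor, so the library
   power [exprz] is not available for arbitrary [n].  For [A \in unitmx] this
   is A^i; for singular [A] the negative powers are junk. *)
Definition mxexpz n (A : 'M[int]_n) (i : int) : 'M[int]_n :=
  match i with
  | Posz k => A ^+ k
  | Negz k => invmx (A ^+ k.+1)
  end.

Lemma mxexpzD n (A : 'M[int]_n) (i j : int) :
  A \in unitmx -> mxexpz A (i + j) = mxexpz A i *m mxexpz A j.
Proof.
case: n A => [|n] A uA; first by rewrite [LHS]flatmx0 [RHS]flatmx0.
exact: (@exprzDr 'M[int]_n.+1 A uA i j).
Qed.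

(* The group Z^n x|_A Z.  The invertibility proof is an argument so that the
   group structure can be inferred from the type. *)
Definition semidirect n (A : 'M[int]_n) (uA : A \in unitmx) : Type :=
  ('cV[int]_n * int)%type.

Section Semidirect.
Variables (n : nat) (A : 'M[int]_n) (uA : A \in unitmx).
Local Notation T := (semidirect uA).

HB.instance Definition _ := Choice.copy T ('cV[int]_n * int)%type.

Definition sd_one : T := (0, 0).
Definition sd_mul (g h : T) : T := (g.1 + mxexpz A g.2 *m h.1, g.2 + h.2).
Definition sd_inv (g : T) : T := (- (mxexpz A (- g.2) *m g.1), - g.2).

Fact sd_mulA : associative sd_mul.
Proof.
by move=> f g h; rewrite /sd_mul /= mxexpzD // mulmxDr -mulmxA !addrA.
Qed.

Fact sd_mul1 : left_id sd_one sd_mul.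
Proof.
case=> x i; rewrite /sd_mul /sd_one /=.
by congr pair; rewrite add0r ?mul1mx.
Qed.

Fact sd_mulr1 : right_id sd_one sd_mul.
Proof. by case=> x i; rewrite /sd_mul /sd_one /= mulmx0 !addr0. Qed.

Fact sd_mulV : left_inverse sd_one sd_inv sd_mul.
Proof. by case=> x i; rewrite /sd_mul /sd_inv /sd_one /= !addNr. Qed.

Fact sd_mulVr : right_inverse sd_one sd_inv sd_mul.
Proof.
case=> x i; rewrite /sd_mul /sd_inv /sd_one /= mulmxN mulmxA -mxexpzD //.
by congr pair; rewrite subrr // mul1mx subrr.
Qed.

HB.instance Definition _ :=
  isGroup.Build T sd_mulA sd_mul1 sd_mulr1 sd_mulV sd_mulVr.

End Semidirect.

Section AlgebraicGroups.
Variable N : nat.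

(* The K-points of the closed subset of GL_N cut out by finitely many
   polynomials over Q in the N^2 matrix entries.  Since det is invertible on
   GL_N, allowing 1/det in the equations gives no further closed subsets. *)
Definition points (G : seq {mpoly rat[N * N]}) (K : numFieldType)
    (g : 'M[K]_N) : Prop :=
  g \in unitmx /\
  forall p, p \in G ->
    (map_mpoly (ratr : rat -> K) p).@[fun k => mxvec g 0 k] = 0.

Definition mx_subgroup (K : fieldType) (H : 'M[K]_N -> Prop) : Prop :=
  [/\ H 1%:M,
      forall g h, H g -> H h -> H (g *m h)
    & forall g, H g -> H (invmx g)].

(* A linear algebraic group over Q: a Q-closed subset of GL_N whose points over
   the algebraically closed field [algC] form a group.  Closed sets defined
   over Q are determined by their [algC]-points, so nothing changes if [algC]
   is enlarged to the field of all complex numbers. *)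
Definition alg_group (G : seq {mpoly rat[N * N]}) : Prop :=
  mx_subgroup (points G (K := algC)).

Definition integral_points (G : seq {mpoly rat[N * N]}) (g : 'M[rat]_N) : Prop :=
  points G g /\ exists2 h : 'M[int]_N, h \in unitmx & g = map_mx intr h.

Definition finite_index (K H : 'M[rat]_N -> Prop) : Prop :=
  (forall g, K g -> H g) /\
  exists s : seq 'M[rat]_N,
    (forall g, g \in s -> H g) /\
    forall h, H h -> exists2 g, g \in s & K (invmx g *m h).

Definition commensurable (H1 H2 : 'M[rat]_N -> Prop) : Prop :=
  finite_index (fun g => H1 g /\ H2 g) H1 /\
  finite_index (fun g => H1 g /\ H2 g) H2.

End AlgebraicGroups.

Definition arithmetic (Gamma : groupType) : Prop :=
  exists (N : nat) (G : seq {mpoly rat[N * N]}) (phi : Gamma -> 'M[rat]_N),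
    [/\ alg_group G,
        injective phi,
        forall x y : Gamma, phi (x * y)%g = phi x *m phi y,
        forall x, points G (phi x)
      & commensurable (fun g => exists x, g = phi x) (integral_points G)].

Definition hyperbolic n (A : 'M[int]_n) : Prop :=
  forall z : algC, eigenvalue (map_mx intr A) z -> `|z| != 1.

Definition semisimple n (A : 'M[int]_n) : Prop :=
  diagonalizable (map_mx intr A : 'M[algC]_n).

Definition real_eigenvalues n (A : 'M[int]_n) : Prop :=
  forall z : algC, eigenvalue (map_mx intr A) z -> z \is Num.real.

(* A real quadratic field, given with an embedding into the complex numbers;
   as it is Galois over Q, one real embedding makes it totally real. *)
Definition real_quadratic (L : fieldExtType rat) (iota : {rmorphism L -> algC}) :
    Prop :=
  \dim {:L} = 2 /\ forall x : L, iota x \is Num.real.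

(* [e] is a unit of the ring of integers of [L]. *)
Definition integer_unit (L : fieldExtType rat) (e : L) : Prop :=
  [/\ e != 0,
      integralOver (intr : int -> L) e
    & integralOver (intr : int -> L) e^-1].

(* Main.v *)
Require Import Defs.
From HB Require Import structures.
From mathcomp Require Import all_boot all_order all_fingroup all_algebra all_field.
From mathcomp Require Import mpoly ring lra zify.
From Stdlib Require Import Classical.

Set Implicit Arguments.
Unset Strict Implicit.
Unset Printing Implicit Defensive.

Import Order.TTheory GRing.Theory Num.Theory.
Local Open Scope ring_scope.

(** Write [phi] for an embedding of the group in the points of an algebraic group
    [G], and call the images of [Z^n] translations.

    Suppose that the group is arithmetic, and let [g] be the image of the generator
    of the factor [Z].  Since no power of [A] has the eigenvalue 1, the translations
    by a multiple of some integer are unipotent ([trans_unipotent]); their logarithms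
    span a copy of [Q^n] on which conjugation by [g] acts as [A].  So every
    eigenvalue [l] of [A] has an eigenvector [ell] in the matrix algebra, with
    [g ell = l ell g] ([log_eigenvector]).
    Now let [e] be a function on the eigenvalues of [g] and [A] that respects all
    multiplicative relations among them.  The matrix equal to [e v] on each
    generalized eigenspace of [g] satisfies every equation satisfied by the powers
    of [g] ([spectral_specialize]), so it is a point of [G].  Apply this to
    [e v = \prod_s (s u) ^ gam (s^-1 v)], where [s] runs over a Galois group, [gam]
    is an integer valued homomorphism on the group generated by the eigenvalues
    and [u] is a unit congruent to 1 modulo a large integer ([twist]).  Galois
    equivariance makes the matrix rational, and the congruence makes it integral.
    The finite index hypothesis then puts one of its powers in the image of [phi],
    and comparing the actions on all the [ell] gives [e l ^ r = l ^ j], with the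
    same [r] and [j] for all eigenvalues [l] of [A] ([twist_power]).
    A unit [u] with a single dominant conjugate, found by the box principle
    ([dominant_unit]), makes [e l] different from 1 unless [gam l = 0] ([twist_eq1]).
    Hence any two [gam] are proportional on the eigenvalues of [A], which generate
    a group of rank one modulo torsion ([pairwise_dependent]).  As this group is
    real and stable under the Galois group, the square [x] of an eigenvalue has no
    conjugates except [x] and [x^-1]: it is a unit in a real quadratic field, and
    the other eigenvalues depend multiplicatively on it ([dependent_quadratic]).

    Conversely let [x] be the square of the given unit, so that [x^2 = t x - 1]
    with [3 <= t].  The norm one elements [a + b x] form a torus whose integral
    points are the [+- x ^ j] ([torus_cyclic]).  Let [G] consist of the matrices
    with blocks [B v 0 1] and [S], where [S] is in this torus, [B] is in the double
    centralizer of [A], and a fixed power of [B] is tied to [S] by the relation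
    that ties the same power of [A] to [x] ([group_elt]).  The group embeds by
    [(v, i) |-> (A ^ i, v, x ^ i)] in the integral points of [G].  An integral
    point of [G] becomes, after division by such an element, a matrix with
    [v = 0], [S = +- 1] and [B] of bounded finite order ([integral_split]); there
    are finitely many of these, as the double centralizer of a semisimple matrix is
    diagonalizable ([torsion_part_finite]). *)

(** * Exponential polynomials *)

Section ExpPoly.
Variable F : fieldType.
Hypothesis charF : [pchar F] =i pred0.

Lemma natr_inj0 : injective (fun i : nat => i%:R : F).
Proof.
suff H m n : (m <= n)%N -> m%:R = n%:R :> F -> m = n.
  by move=> m n /= E; case/orP: (leq_total m n) => h; [|symmetry]; apply: H.
move=> le_mn /eqP; rewrite eq_sym -subr_eq0 -natrB //.
by rewrite (pcharf0P _).1 // subn_eq0 => le_nm; apply/eqP; rewrite eqn_leq le_mn.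
Qed.

Lemma poly_nat_eq0 (p : {poly F}) : (forall i : nat, p.[i%:R] = 0) -> p = 0.
Proof.
move=> p0; apply/eqP; apply/negPn/negP => nz_p.
pose rs := [seq i%:R | i <- iota 0 (size p)] : seq F.
have: (size rs < size p)%N; last by rewrite size_map size_iota ltnn.
apply: max_poly_roots nz_p _ _.
  by apply/allP => _ /mapP[i _ ->]; apply/rootP.
by rewrite map_inj_uniq ?iota_uniq //; apply: natr_inj0.
Qed.

(** Functions [i |-> w ^ i * q i] with distinct bases [w] are linearly independent.
    The operator [f i |-> f (i + 1) - w1 * f i] lowers the degree of the coefficient
    of [w1] and keeps the degrees of the others, which gives an induction on the
    total size of the coefficients. *)
Lemma exppoly_eq0 (r : seq F) (q : F -> {poly F}) : uniq r -> 0 \notin r ->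
  (forall i : nat, \sum_(w <- r) w ^+ i * (q w).[i%:R] = 0) ->
  {in r, forall w, q w = 0}.
Proof.
move=> Ur r0; have [k] := ubnP (\sum_(w <- r) size (q w))%N.
elim: k q => // k IHk q le_k sum0.
have [/allP H|] := boolP (all (fun w => q w == 0) r).
  by move=> w /H/eqP.
rewrite -has_predC => /hasP[w1 rw1 /= nz1]; exfalso.
have nzw1 : w1 != 0 by apply: contraNneq r0 => <-.
have sX : size ('X + 1 : {poly F}) = 2 by rewrite -[1]/(1%:P) size_XaddC.
have lX : lead_coef ('X + 1 : {poly F}) = 1 by rewrite -[1]/(1%:P) lead_coefXaddC.
pose q' w := w *: (q w \Po ('X + 1)) - w1 *: q w.
have szcomp w : size (q w \Po ('X + 1)) = size (q w) by rewrite size_comp_poly2.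
have lc w : (q w \Po ('X + 1))`_(size (q w)).-1 = lead_coef (q w).
  by rewrite -{1}szcomp -/(lead_coef _) lead_coef_comp ?sX // lX expr1n mulr1.
have le_sz w : (size (q' w) <= size (q w))%N.
  rewrite (leq_trans (size_polyD _ _)) // size_polyN geq_max.
  by rewrite !(leq_trans (size_scale_leq _ _)) ?szcomp.
have lt_sz : (size (q' w1) < size (q w1))%N.
  have sz_gt0 : (0 < size (q w1))%N by rewrite size_poly_gt0.
  rewrite -(ltn_predK sz_gt0) ltnS; apply/leq_sizeP => j.
  rewrite leq_eqVlt => /predU1P[<- | lt_j].
    by rewrite !(coefB, coefZ) lc /lead_coef subrr.
  have le_j : (size (q w1) <= j)%N by rewrite -(ltn_predK sz_gt0).
  by rewrite (leq_sizeP _ _ (le_sz w1)).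
have q'0 : {in r, forall w, q' w = 0}.
  apply: IHk => [|i].
    apply: (@leq_trans (\sum_(w <- r) size (q w))%N); last by rewrite -ltnS.
    rewrite (perm_big _ (perm_to_rem rw1)) /=.
    rewrite [in leqRHS](perm_big _ (perm_to_rem rw1)) /= !big_cons.
    by rewrite -addSn leq_add // leq_sum.
  have E : \sum_(w <- r) w ^+ i.+1 * (q w).[i.+1%:R] -
             w1 * \sum_(w <- r) w ^+ i * (q w).[i%:R] = 0.
    by rewrite !sum0 mulr0 subr0.
  rewrite -[RHS]E mulr_sumr -sumrB.
  apply: eq_bigr => w _; rewrite !hornerE horner_comp !hornerE.
  by rewrite exprS -natr1 /=; ring.
(* the coefficient of [w <> w1] is multiplied by [w - w1] in top degree *)
have q0 w : w \in r -> w != w1 -> q w = 0.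
  move=> rw nw; apply/eqP; rewrite -lead_coef_eq0.
  have /(congr1 (fun p : {poly F} => p`_(size (q w)).-1)) := q'0 w rw.
  rewrite /= coefB !coefZ lc -/(lead_coef _) -mulrBl coef0 => /eqP.
  by rewrite mulf_eq0 subr_eq0 (negPf nw).
case/negP: nz1; apply/eqP/poly_nat_eq0 => i.
have := sum0 i; rewrite (bigD1_seq w1) //= big_seq_cond big1 => [|w /andP[rw nw]].
  by rewrite addr0 => /eqP; rewrite mulf_eq0 expf_eq0 (negPf nzw1) andbF => /eqP.
by rewrite q0 // horner0 mulr0.
Qed.

(** Both evaluations of [R] factor through sums indexed by monomials, grouped by the
    value of the monomial at [v]; the hypothesis says that each group vanishes as a
    polynomial in [i].  When [e] respects the multiplicative relations among the
    [v a], it is constant on each group, so that replacing [v] by [e] and [i] by 0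
    still gives zero. *)
Lemma exppoly_specialize s (v e : 'I_s -> F) (R : {mpoly {poly F}[s]}) :
  (forall a, v a != 0) ->
  (forall m1 m2 : 'X_{1..s}, mmap1 v m1 = mmap1 v m2 -> mmap1 e m1 = mmap1 e m2) ->
  (forall i : nat, mmap (horner_eval i%:R) (fun a => v a ^+ i) R = 0) ->
  mmap (horner_eval 0) e R = 0.
Proof.
move=> nz_v rel_e R0; pose ms := msupp R.
pose r := undup [seq mmap1 v m | m <- ms].
pose q w := \sum_(m <- ms | mmap1 v m == w) R@_m.
have part (G : 'X_{1..s} -> F) :
    \sum_(m <- ms) G m = \sum_(w <- r) \sum_(m <- ms | mmap1 v m == w) G m.
  rewrite (exchange_big_dep xpredT) //= big_seq [RHS]big_seq.
  apply: eq_bigr => m ms_m; rewrite -big_filter.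
  have rm : mmap1 v m \in r by rewrite mem_undup map_f.
  rewrite (eq_filter (a2 := pred1 (mmap1 v m))); last by move=> w /=; rewrite eq_sym.
  by rewrite filter_pred1_uniq ?undup_uniq // big_seq1.
have q0 : {in r, forall w, q w = 0}.
  apply: exppoly_eq0 => [||i]; first exact: undup_uniq.
    rewrite mem_undup; apply/mapP => -[m _ /esym/eqP].
    by rewrite prodf_seq_eq0 => /hasP[a _ /=]; rewrite expf_eq0 (negPf (nz_v a)) andbF.
  rewrite -[RHS](R0 i) /mmap -/ms part; apply: eq_bigr => w _.
  rewrite horner_sum mulr_sumr; apply: eq_bigr => m /eqP <-.
  rewrite mulrC; congr (_ * _); rewrite /mmap1 -prodrXl.
  by apply: eq_bigr => a _; rewrite exprAC.
rewrite /mmap -/ms part big_seq big1 // => w rw.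
have:= rw; rewrite mem_undup => /mapP[m0 _ Dw].
have := congr1 (horner_eval 0) (q0 w rw); rewrite /q raddf_sum raddf0 => q00.
transitivity (\sum_(m <- ms | mmap1 v m == w) (horner_eval 0 R@_m) * mmap1 e m0).
  by apply: eq_bigr => m /eqP; rewrite Dw => /rel_e ->.
by rewrite -mulr_suml q00 mul0r.
Qed.

Lemma meval_map_mmap n (R S : comNzRingType) (f : {rmorphism R -> S})
    (v : 'I_n -> S) (p : {mpoly R[n]}) : injective f ->
  (map_mpoly f p).@[v] = mmap f v p.
Proof.
move=> f_inj; rewrite mevalE (perm_big _ (msupp_map_mpoly p f_inj)) /=.
by apply: eq_bigr => m _; rewrite mcoeff_map_mpoly.
Qed.

Lemma rmorph_mmap n (R S T : comNzRingType) (phi : {rmorphism S -> T})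
    (f : {rmorphism R -> S}) (h : 'I_n -> S) (p : {mpoly R[n]}) :
  phi (mmap f h p) = mmap (phi \o f) (phi \o h) p.
Proof.
rewrite rmorph_sum; apply: eq_bigr => m _; rewrite rmorphM; congr (_ * _).
by rewrite rmorph_prod; apply: eq_bigr => a _; rewrite rmorphXn.
Qed.

End ExpPoly.

(** * Logarithms of unipotent matrices *)

Section Log.
Variables (F : fieldType) (n : nat).
Hypothesis charF : [pchar F] =i pred0.
Implicit Types (U V X Y g : 'M[F]_n) (P Q : 'M[{poly F}]_n).

Definition mx_eval (c : F) P : 'M[F]_n := map_mx (horner_eval c) P.

(** The powers of a unipotent matrix are the values at the integers of a unique
    matrix of polynomials; working with it avoids the truncated series of the
    exponential and the logarithm. *)
Definition interpolates P U := forall i : nat, mx_eval i%:R P = U ^+ i.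

(** The logarithm is the derivative at 0 of [t |-> U ^ t]. *)
Definition is_log U X := exists2 P, interpolates P U & X = map_mx (coefp 1) P.

Lemma mx_eval_inj P Q :
  (forall i : nat, mx_eval i%:R P = mx_eval i%:R Q) -> P = Q.
Proof.
move=> eqPQ; apply/matrixP => a b; apply/eqP; rewrite -subr_eq0; apply/eqP.
apply: (poly_nat_eq0 charF) => i; move/matrixP/(_ a b): (eqPQ i).
by rewrite !mxE /horner_eval !hornerE => ->; rewrite subrr.
Qed.

Lemma mx_evalM c P Q : mx_eval c (P *m Q) = mx_eval c P *m mx_eval c Q.
Proof. exact: map_mxM. Qed.

Lemma mx_evalC c X : mx_eval c (map_mx polyC X) = X.
Proof. by apply/matrixP => a b; rewrite !mxE /horner_eval hornerC. Qed.

Lemma mx_eval0 P : mx_eval 0 P = map_mx (coefp 0) P.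
Proof. by apply/matrixP => a b; rewrite !mxE /horner_eval horner_coef0. Qed.

Lemma interpolates0 P U : interpolates P U -> map_mx (coefp 0) P = 1%:M.
Proof. by move=> /(_ 0%N); rewrite mx_eval0 => ->; rewrite expr0. Qed.

Lemma coef1_mulmx P Q : map_mx (coefp 1) (P *m Q) =
  map_mx (coefp 0) P *m map_mx (coefp 1) Q + map_mx (coefp 1) P *m map_mx (coefp 0) Q.
Proof.
apply/matrixP => a b; rewrite !mxE /coefp coef_sum -big_split /=.
by apply: eq_bigr => k _; rewrite coefM !big_ord_recl big_ord0 addr0 !mxE.
Qed.

(** The binomial coefficient [X choose l]. *)
Definition bin_poly l : {poly F} := (l`!%:R)^-1 *: \prod_(j < l) ('X - j%:R%:P).

Lemma bin_polyE l i : (bin_poly l).[i%:R] = 'C(i, l)%:R.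
Proof.
have nz_l : l`!%:R != 0 :> F by rewrite (pcharf0P _).1 // -lt0n fact_gt0.
apply: (mulfI nz_l); rewrite hornerZ mulrA mulfV // mul1r -natrM mulnC bin_ffact horner_prod.
have [le_li|lt_il] := leqP l i.
  rewrite ffact_prod natr_prod; apply: eq_bigr => j _; rewrite !hornerE natrB //.
  by rewrite (leq_trans _ le_li) // ltnW.
rewrite ffact_small //; apply/eqP/prodf_eq0; exists (Ordinal lt_il) => //.
by rewrite !hornerE subrr.
Qed.

(** The binomial expansion of [(1 + (U - 1)) ^ i] stops at [l < N]. *)
Lemma interpolates_unipotent N U : (U - 1) ^+ N = 0 -> exists P, interpolates P U.
Proof.
move=> nilU; exists (\sum_(l < N) bin_poly l *: map_mx polyC ((U - 1) ^+ l)) => i.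
rewrite -[in RHS](subrK 1 U) exprD1n /mx_eval raddf_sum.
have -> : \sum_(l < N) map_mx (horner_eval i%:R) (bin_poly l *: map_mx polyC ((U - 1) ^+ l))
        = \sum_(l < N) (U - 1) ^+ l *+ 'C(i, l).
  apply: eq_bigr => l _; apply/matrixP => a b; rewrite !mxE /horner_eval hornerM hornerC.
  by rewrite bin_polyE mulrC mulr_natr; elim: ('C(i, l)) => [|k IHk]; rewrite ?mxE // !mulrS mxE IHk.
pose f l := (U - 1) ^+ l *+ 'C(i, l).
rewrite -!(big_mkord xpredT f).
have f0 l : (N <= l)%N || (i < l)%N -> f l = 0.
  case/orP => [leNl|lt_il]; last by rewrite /f bin_small.
  by rewrite /f -(subnKC leNl) exprD nilU mul0r mul0rn.
(* both truncations of the binomial sum agree with the longer common one *)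
have tail K M : (N <= K)%N || (i < K)%N -> \sum_(K <= l < M) f l = 0.
  move=> hK; rewrite big_nat_cond big1 // => l /andP[/andP[h _] _]; apply: f0.
  by case/orP: hK => h'; rewrite (leq_trans h') ?orbT.
have trunc K : (N <= K)%N || (i < K)%N -> \sum_(0 <= l < N + i.+1) f l = \sum_(0 <= l < K) f l.
  move=> hK; have [le|lt] := leqP K (N + i.+1).
    by rewrite (big_cat_nat (n := K)) //= (tail K) // addr0.
  rewrite [RHS](big_cat_nat (leq0n (N + i.+1)) (ltnW lt)) /= (tail (N + i.+1)%N) ?addr0 //.
  by rewrite leq_addr.
by rewrite -(trunc N) ?leqnn // -(trunc i.+1) ?ltnSn ?orbT.
Qed.

Lemma is_log_exists N U : (U - 1) ^+ N = 0 -> exists X, is_log U X.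
Proof.
move=> /interpolates_unipotent[P intP].
by exists (map_mx (coefp 1) P); exists P.
Qed.

Lemma is_logM U V X Y : U *m V = V *m U -> is_log U X -> is_log V Y ->
  is_log (U *m V) (X + Y).
Proof.
move=> cUV [P iP ->] [Q iQ ->]; exists (P *m Q).
  by move=> i; rewrite mx_evalM iP iQ [RHS]exprMn_comm.
by rewrite coef1_mulmx (interpolates0 iP) (interpolates0 iQ) mul1mx mulmx1 addrC.
Qed.

(** Conjugate matrices have conjugate powers, hence conjugate interpolating
    polynomials. *)
Lemma is_log_conj g U V X Y : g *m U = V *m g -> is_log U X -> is_log V Y ->
  g *m X = Y *m g.
Proof.
move=> gU [P iP ->] [Q iQ ->]; pose G := map_mx polyC g.
have c0 : map_mx (coefp 0) G = g by rewrite -mx_eval0 mx_evalC.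
have c1 : map_mx (coefp 1) G = 0.
  by apply/matrixP => a b; rewrite !mxE /coefp coefC.
have eqPQ : G *m P = Q *m G.
  apply: mx_eval_inj => i; rewrite !mx_evalM mx_evalC iP iQ.
  elim: i => [|i IHi]; first by rewrite !expr0 mulmx1 mul1mx.
  by rewrite !exprSr -[U ^+ i * U]/(_ *m _) -[V ^+ i * V]/(_ *m _) mulmxA IHi -!mulmxA gU.
have := congr1 (map_mx (coefp 1)) eqPQ.
by rewrite !coef1_mulmx c0 c1 mul0mx mulmx0 addr0 add0r.
Qed.

Lemma is_log_uniq U X Y : is_log U X -> is_log U Y -> X = Y.
Proof.
by move=> lX lY; have := is_log_conj (g := 1%:M) _ lX lY; rewrite !mul1mx !mulmx1; apply.
Qed.

(** The interpolating polynomial satisfies [P (t + i) = U ^ i P t], so that its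
    derivative at every integer is [U ^ i] times its derivative at 0. *)
Lemma is_log_inj U : is_log U 0 -> U = 1%:M.
Proof.
case=> P iP P1.
have dP0 a b : (P a b)^`() = 0.
  apply: (poly_nat_eq0 charF) => i.
  pose T := map_mx (fun p : {poly F} => p \Po ('X + i%:R%:P)) P.
  have ET : T = map_mx polyC (U ^+ i) *m P.
    apply: mx_eval_inj => j; rewrite mx_evalM mx_evalC iP -[_ *m _]/(U ^+ i * U ^+ j) -exprD -iP.
    apply/matrixP => c d; rewrite !mxE /horner_eval horner_comp !hornerE.
    by rewrite natrD addrC.
  have : map_mx (coefp 1) T a b = 0.
    rewrite ET coef1_mulmx -P1 mulmx0 add0r.
    by rewrite (_ : map_mx _ _ = 0) ?mul0mx ?mxE //; apply/matrixP=> c d; rewrite !mxE /coefp coefC.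
  rewrite !mxE /coefp -[X in X = 0 -> _]mulr1n -coef_deriv -horner_coef0.
  by rewrite deriv_comp !hornerE horner_comp !hornerE derivD derivX derivC !hornerE.
have cP a b c : (P a b).[c] = (P a b)`_0.
  suff {1}-> : P a b = ((P a b)`_0)%:P by rewrite hornerC.
  apply/polyP => -[|k]; rewrite coefC //=.
  have /(congr1 (fun p : {poly F} => p`_k)) := dP0 a b.
  by rewrite coef_deriv coef0 -mulr_natr => /eqP; rewrite mulf_eq0 (pcharf0P _).1 ?orbF // => /eqP.
have := iP 1%N; rewrite expr1 => <-; have := iP 0%N; rewrite expr0 => /matrixP E.
by apply/matrixP => a b; rewrite -E !mxE /horner_eval !cP.
Qed.

End Log.

(** * Spectral projections *)

Section IdemPoly.
Variable F : fieldType.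
Implicit Types (vs : seq F) (v w : F).

Definition lagrange vs v : {poly F} :=
  \prod_(w <- vs | w != v) ((v - w)^-1 *: ('X - w%:P)).

(** The idempotent of the eigenvalue [v] is a polynomial in the matrix: this one is
    0 to order [N] at the other eigenvalues and 1 to order [N] at [v], without
    solving a system of congruences. *)
Definition idem_poly N vs v : {poly F} := 1 - (1 - lagrange vs v ^+ N) ^+ N.

Lemma dvdp_subX1 (y : {poly F}) N : y %| 1 - (1 - y) ^+ N.
Proof. by rewrite -{1}(expr1n _ N) subrXX subKr dvdp_mulr. Qed.

Lemma idem_poly_neq N vs v w : w \in vs -> w != v -> ('X - w%:P) ^+ N %| idem_poly N vs v.
Proof.
move=> vs_w neq_wv; apply: dvdp_trans (dvdp_subX1 _ _); apply: dvdp_exp2r.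
rewrite /lagrange (big_rem w) //= neq_wv dvdp_mulr //.
by rewrite dvdpZr // invr_eq0 subr_eq0 eq_sym.
Qed.

Lemma idem_poly_eq N vs v : (0 < N)%N -> ('X - v%:P) ^+ N %| 1 - idem_poly N vs v.
Proof.
move=> N_gt0; rewrite /idem_poly subKr; apply: dvdp_exp2r.
rewrite dvdp_XsubCl /root !hornerE horner_prod big1 ?expr1n ?subrr //.
by move=> w neq_wv; rewrite !hornerE mulVf // subr_eq0 eq_sym.
Qed.

Lemma horner_idem_poly N vs v w : (0 < N)%N -> w \in vs ->
  (idem_poly N vs v).[w] = (w == v)%:R.
Proof.
move=> N_gt0 vs_w; have XwN : 'X - w%:P %| ('X - w%:P) ^+ N.
  by rewrite -{1}(expr1 ('X - _)) dvdp_exp2l.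
have [<-|neq_wv] := eqVneq.
  have := dvdp_trans XwN (idem_poly_eq vs w N_gt0).
  by rewrite dvdp_XsubCl /root hornerD hornerN hornerC subr_eq0 => /eqP <-.
have := dvdp_trans XwN (idem_poly_neq N vs_w neq_wv).
by rewrite dvdp_XsubCl => /rootP ->.
Qed.

Lemma dvdp_prod_XsubC_exp N vs (f : {poly F}) : uniq vs ->
  {in vs, forall v, ('X - v%:P) ^+ N %| f} -> \prod_(v <- vs) ('X - v%:P) ^+ N %| f.
Proof.
elim: vs => [|v vs IHvs] /= => [_ _|/andP[v_vs Uvs] dvd_f]; first by rewrite big_nil dvd1p.
rewrite big_cons Gauss_dvdp ?dvd_f ?mem_head // ?IHvs // => [w vs_w|].
  by rewrite dvd_f // in_cons vs_w orbT.
rewrite big_seq; apply: (big_ind (coprimep _)) => [|p q|w vs_w].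
- exact: coprimep1.
- by rewrite coprimepMr => -> ->.
rewrite coprimep_expl // coprimep_expr // coprimep_XsubC2 //.
by rewrite subr_eq0; apply: contraNneq v_vs => <-.
Qed.

End IdemPoly.

(** For automorphisms this shows that sums of idempotents with equivariant
    coefficients are rational; for field extensions it transfers denominators. *)
Lemma map_idem_poly (F F' : fieldType) (f : {rmorphism F -> F'}) N vs vs' v :
  perm_eq (map f vs) vs' ->
  map_poly f (idem_poly N vs v) = idem_poly N vs' (f v).
Proof.
move=> f_vs; rewrite /idem_poly !(rmorphB, rmorphXn, rmorph1) /=.
congr (1 - (1 - _ ^+ _) ^+ _); rewrite /lagrange rmorph_prod -[RHS](perm_big _ f_vs) big_map.
apply: eq_big => [w|w _]; first by rewrite /= (inj_eq (fmorph_inj f)).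
by rewrite /= map_polyZ fmorphV rmorphB map_polyXsubC.
Qed.

Section Spectral.
Variables (F : fieldType) (N' : nat).
Hypothesis charF : [pchar F] =i pred0.
Local Notation N := N'.+1.
Variables (g : 'M[F]_N) (vs rs : seq F).
Hypotheses (Uvs : uniq vs) (nz_vs : 0 \notin vs) (sub_rs : {subset rs <= vs}).
Hypothesis char_g : char_poly g = \prod_(z <- rs) ('X - z%:P).

(** By Cayley-Hamilton, as the characteristic polynomial has roots in [vs] with
    multiplicity at most [N]. *)
Lemma horner_mx_eq0 (f : {poly F}) :
  {in vs, forall v, ('X - v%:P) ^+ N %| f} -> horner_mx g f = 0.
Proof.
move=> dvd_f; suff /dvdpP[q ->]: char_poly g %| f.
  by rewrite rmorphM /= Cayley_Hamilton mulr0.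
rewrite char_g -prodr_undup_exp_count.
apply: dvdp_trans (dvdp_prod_XsubC_exp (undup_uniq rs) _); last first.
  by move=> v; rewrite mem_undup => /sub_rs/dvd_f; apply.
elim: undup => [|v s IHs]; rewrite ?big_nil ?dvd1p // !big_cons.
apply: dvdp_mul IHs; apply: dvdp_exp2l; rewrite (leq_trans (count_size _ _)) //.
by have := size_char_poly g; rewrite char_g size_prod_XsubC => -[->].
Qed.

Lemma horner_mx_eq (f h : {poly F}) :
  {in vs, forall v, ('X - v%:P) ^+ N %| f - h} -> horner_mx g f = horner_mx g h.
Proof. by move=> /horner_mx_eq0; rewrite rmorphB => /eqP; rewrite subr_eq0 => /eqP. Qed.

Definition spectral_proj v := horner_mx g (idem_poly N vs v).

(* The value at [g] of the function [e] on the spectrum of [g], extended to be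
   locally constant: nilpotent parts are dropped. *)
Definition spectral_fun (e : F -> F) := \sum_(v <- vs) e v *: spectral_proj v.

Lemma spectral_proj_mul : {in vs &, forall v w,
  spectral_proj v * spectral_proj w = (v == w)%:R *: spectral_proj v}.
Proof.
move=> v w vs_v vs_w; rewrite /spectral_proj -rmorphM -[RHS]linearZ /=.
apply: horner_mx_eq => u vs_u; have [<-|neq_vw] := eqVneq.
  rewrite scale1r -{3}[idem_poly _ _ _]mulr1 -mulrBr.
  have [<-|neq_uv] := eqVneq u v; last by rewrite dvdp_mulr // idem_poly_neq.
  by rewrite dvdp_mull // -dvdpNr opprB idem_poly_eq.
rewrite scale0r subr0; have [->|neq_uv] := eqVneq u v; last by rewrite dvdp_mulr // idem_poly_neq.
by rewrite dvdp_mull // idem_poly_neq.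
Qed.

Lemma spectral_proj_sum : \sum_(v <- vs) spectral_proj v = 1.
Proof.
rewrite /spectral_proj -rmorph_sum -[1](rmorph1 (horner_mx g)).
apply: horner_mx_eq => u vs_u; rewrite (bigD1_seq u) //= addrAC dvdp_addr.
  rewrite big_seq_cond; apply: (big_ind (fun p => _ %| p)) => [|p q|w /andP[_ neq_wu]].
  - exact: dvdp0.
  - exact: dvdp_add.
  - by rewrite idem_poly_neq // eq_sym.
by rewrite -dvdpNr opprB idem_poly_eq.
Qed.

Lemma spectral_funM e1 e2 :
  spectral_fun e1 * spectral_fun e2 = spectral_fun (fun v => e1 v * e2 v).
Proof.
rewrite /spectral_fun mulr_suml big_seq [RHS]big_seq; apply: eq_bigr => v vs_v.
rewrite mulr_sumr (bigD1_seq v) //= big_seq_cond big1 => [|w /andP[vs_w neq_wv]].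
  by rewrite addr0 -scalerAl -scalerAr spectral_proj_mul // eqxx scale1r scalerA.
by rewrite -scalerAl -scalerAr spectral_proj_mul // eq_sym (negPf neq_wv) !scale0r !scaler0.
Qed.

Lemma spectral_fun1 : spectral_fun (fun=> 1) = 1.
Proof.
by rewrite -spectral_proj_sum; apply: eq_bigr => v _; rewrite scale1r.
Qed.

Lemma eq_spectral_fun e1 e2 : {in vs, e1 =1 e2} -> spectral_fun e1 = spectral_fun e2.
Proof.
by move=> e12; rewrite /spectral_fun big_seq [RHS]big_seq; apply: eq_bigr => v /e12 ->.
Qed.

Lemma spectral_funX e i : spectral_fun e ^+ i = spectral_fun (fun v => e v ^+ i).
Proof.
elim: i => [|i IHi]; first by rewrite expr0 -spectral_fun1.
by rewrite exprS IHi spectral_funM; apply: eq_bigr => v _; rewrite exprS.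
Qed.

Lemma spectral_fun_horner e :
  spectral_fun e = horner_mx g (\sum_(v <- vs) e v *: idem_poly N vs v).
Proof. by rewrite linear_sum; apply: eq_bigr => v _; rewrite linearZ. Qed.

Lemma comm_spectral_fun e : GRing.comm (spectral_fun e) g.
Proof. by rewrite spectral_fun_horner -{2}[g]horner_mx_X; apply: comm_horner_mx2. Qed.

(** The multiplicative Jordan decomposition of [g], in the form used for all powers
    of [g] at once. *)
Lemma spectral_unipotent :
  exists2 U, (U - 1) ^+ N = 0 & forall i : nat, g ^+ i = spectral_fun (fun v => v ^+ i) * U ^+ i.
Proof.
pose U := spectral_fun (fun v => v^-1) * g; exists U => [|i].
  rewrite /U spectral_fun_horner -{2}[g]horner_mx_X -rmorphM -[1](rmorph1 (horner_mx g)).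
  rewrite -rmorphB -rmorphXn; apply: horner_mx_eq0 => w vs_w; apply: dvdp_exp2r.
  rewrite dvdp_XsubCl /root !hornerE horner_sum (bigD1_seq w) //=.
  rewrite big1 => [|v neq_vw].
    rewrite hornerZ horner_idem_poly // eqxx mulr1 addr0 mulVf ?subrr //.
    by apply: contraNneq nz_vs => <-.
  by rewrite hornerZ horner_idem_poly // eq_sym (negPf neq_vw) mulr0.
rewrite /U (exprMn_comm _ (comm_spectral_fun _)) !spectral_funX mulrA spectral_funM.
rewrite (eq_spectral_fun (e2 := fun=> 1)) ?spectral_fun1 ?mul1r // => v vs_v.
rewrite exprVn mulfV // expf_eq0 negb_and; apply/orP; right.
by apply: contraNneq nz_vs => <-.
Qed.

(** The entries of [g ^ i] are exponential polynomials in [i], with the eigenvalues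
    of [g] as bases; [spectral_fun e] is obtained from them by sending each base
    [v] to [e v] and the polynomial variable to 0, which kills the unipotent part.
    So [exppoly_specialize] applies to every equation satisfied by the powers. *)
Lemma spectral_specialize (R : comNzRingType) (f : {rmorphism R -> F}) (e : F -> F)
    (p : {mpoly R[N * N]}) : injective f ->
    (forall m1 m2 : 'X_{1..size vs},
       mmap1 (fun a => vs`_a) m1 = mmap1 (fun a => vs`_a) m2 ->
       mmap1 (fun a => e vs`_a) m1 = mmap1 (fun a => e vs`_a) m2) ->
    (forall i : nat, (map_mpoly f p).@[fun k => mxvec (g ^+ i) 0 k] = 0) ->
  (map_mpoly f p).@[fun k => mxvec (spectral_fun e) 0 k] = 0.
Proof.
move=> inj_f rel_e p0; have [U nilU Dg] := spectral_unipotent.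
have [P intP] := interpolates_unipotent charF nilU; set s := size vs in rel_e.
pose A a := map_mx polyC (spectral_proj vs`_a) *m P.
(* [Q] has the entries of [g ^ i] at [X_a = v_a ^ i], with coefficients in [i] *)
pose Q k : {mpoly {poly F}[s]} := \sum_(a < s) (mxvec (A a) 0 k) *: 'X_a.
have evQ c h k : mmap (horner_eval c) h (Q k) =
    mxvec (\sum_(a < s) h a *: (spectral_proj vs`_a *m mx_eval c P)) 0 k.
  rewrite raddf_sum linear_sum summxE; apply: eq_bigr => a _.
  rewrite -[LHS]/(mmap (horner_eval c) h _) mmapZ /= mmapX mmap1U linearZ mxE mulrC; congr (_ * _).
  by case/mxvec_indexP: k => i j; rewrite !mxvecE -[spectral_proj _](mx_evalC c) -mx_evalM [RHS]mxE.
pose R1 := mmap (@mpolyC s _ \o polyC \o f) Q p.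
have mapR c h : mmap (horner_eval c) h R1 =
    (map_mpoly f p).@[fun k => mxvec (\sum_(a < s) h a *: (spectral_proj vs`_a *m mx_eval c P)) 0 k].
  rewrite meval_map_mmap //.
  have := rmorph_mmap (mmap (horner_eval c) h) (@mpolyC s _ \o polyC \o f) Q p.
  move=> ->; rewrite /mmap; apply: eq_bigr => m _; congr (_ * _).
    by rewrite /= mmapC; apply: hornerC.
  by apply: eq_bigr => k _; rewrite /= evQ.
have sumE h c : \sum_(a < s) h vs`_a *: (spectral_proj vs`_a *m mx_eval c P)
    = spectral_fun h *m mx_eval c P.
  rewrite /spectral_fun (big_nth 0) big_mkord mulmx_suml.
  by apply: eq_bigr => a _; rewrite scalemxAl.
have := @exppoly_specialize F charF s (fun a => vs`_a) (fun a => e vs`_a) R1 _ rel_e _.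
rewrite mapR sumE (intP 0%N) expr0 mulmx1; apply => [a|i].
  by apply: contraNneq nz_vs => <-; rewrite mem_nth.
rewrite mapR (sumE (fun v => v ^+ i)) intP -[RHS](p0 i) Dg.
by apply: meval_eq.
Qed.

End Spectral.

Lemma map_spectral_proj (F F' : fieldType) (f : {rmorphism F -> F'}) N'
    (g : 'M[F]_N'.+1) vs vs' v : perm_eq (map f vs) vs' ->
  map_mx f (spectral_proj g vs v) = spectral_proj (map_mx f g) vs' (f v).
Proof. by move=> f_vs; rewrite map_horner_mx (map_idem_poly _ _ f_vs). Qed.

(** * Number fields inside the algebraic numbers *)

Lemma splitting_num_field (p : {poly rat}) (rs : seq algC) :
  map_poly ratr p = \prod_(z <- rs) ('X - z%:P) ->
  {K : splittingFieldType rat & galois 1 {:K} &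
  {iota : {rmorphism K -> algC} &
  {s : seq K | map iota s = rs & <<1 & s>>%VS = fullv}}}.
Proof.
move=> Dp; have [K0 [iota [s Ds genK]]] := num_field_exists rs.
pose pK := map_poly (in_alg K0) p.
have DpK : pK = \prod_(y <- s) ('X - y%:P).
  apply: (map_poly_inj iota); rewrite -map_poly_comp rmorph_prod.
  have -> : map_poly (iota \o in_alg K0) p = map_poly ratr p.
    by apply: eq_map_poly => a; rewrite /= alg_num_field fmorph_rat.
  by rewrite Dp -Ds big_map; apply: eq_bigr => y _; rewrite /= map_polyXsubC.
have K_ax : FieldExt_isSplittingField _ K0.
  constructor; exists pK; first exact: alg_polyOver.
  by exists s => //; rewrite DpK eqpxx.
pose K : splittingFieldType rat := HB.pack_for (splittingFieldType rat) K0 K_ax.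
exists K; last by exists iota, s.
rewrite /galois subvf normalFieldf andbT /=.
apply/separableP => x _; apply: pcharf0_separable => q.
by rewrite (pchar_lalg K0); apply: pchar_num.
Qed.

Section NumberField.
Variables (K : splittingFieldType rat) (iota : {rmorphism K -> algC}).
Hypothesis galK : galois 1 {:K}.
Local Notation G := 'Gal({:K} / 1)%g.

Lemma gal_rat_fixed (x : K) : (forall s, s \in G -> s x = x) -> exists a : rat, x = ratr a.
Proof.
move=> fix_x; suff /vlineP[a ->]: x \in 1%VS by exists a; rewrite alg_num_field.
have /galois_fixedField <- := galK; apply/fixedFieldP => //; exact: memvf.
Qed.

Lemma aut_restrict (nu : {rmorphism algC -> algC}) :
  exists2 s, s \in G & forall x, nu (iota x) = iota (s x).
Proof.
have [nu0 Dnu] := restrict_aut_to_normal_num_field iota nu.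
have [|s Gs Ds] := @kAut_to_gal _ _ 1%AS {:K}%AS (linfun nu0).
  rewrite kAutfE; apply/kHomP; split=> [x y _ _|x]; first by rewrite !lfunE /= rmorphM.
  by case/vlineP=> a ->; rewrite lfunE /= rmorph_alg.
by exists s => // x; rewrite -Dnu -Ds ?memvf // lfunE.
Qed.

Lemma aut_extend s : s \in G -> exists nu : {rmorphism algC -> algC},
  forall x, nu (iota x) = iota (s x).
Proof.
by move=> _; have [nu Dnu] := extend_algC_subfield_aut iota s; exists nu => x; rewrite Dnu.
Qed.

(** The fixed field of [s] contains the generators. *)
Lemma gal_gen (s : gal_of {:K}) (rs : seq K) : s \in G -> <<1 & rs>>%VS = fullv ->
  {in rs, forall x, s x = x} -> forall x, s x = x.
Proof.
move=> Gs genK fix_rs x; have : x \in fixedField [set s].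
  have: (<<1 & rs>> <= fixedField [set s])%VS.
    apply/Fadjoin_seqP; split; first exact: sub1v.
    by move=> y /fix_rs fix_y; apply/fixedFieldP => [|_ /set1P->//]; exact: memvf.
  by rewrite genK => /subvP; apply; exact: memvf.
by case/mem_fixedFieldP => _ -> //; rewrite inE.
Qed.

(** Complex conjugation restricts to an automorphism fixing the generators. *)
Lemma real_gen (rs : seq K) : <<1 & rs>>%VS = fullv ->
  {in rs, forall x, iota x \is Num.real} -> forall x, iota x \is Num.real.
Proof.
move=> genK real_rs x; have [s Gs Ds] := aut_restrict Num.conj.
rewrite CrealE Ds (gal_gen Gs genK) // => y rs_y.
by apply: (fmorph_inj iota); rewrite -Ds; apply/CrealP/real_rs.
Qed.

Lemma galNorm_int (x : K) : iota x \in Aint ->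
  exists a : int, \prod_(s in G) iota (s x) = a%:~R.
Proof.
move=> Ax; apply/intrP/Cint_rat_Aint; last first.
  by apply: rpred_prod => s /aut_extend[nu <-]; rewrite Aint_aut.
rewrite -rmorph_prod -/(galNorm 1 {:K} x).
by have /vlineP[a ->] := mem_galNorm galK (memvf x); rewrite alg_num_field fmorph_rat Crat_rat.
Qed.

End NumberField.

(** * A unit with a single large conjugate *)

Lemma int_unit_square (a b : int) : a * b = 1 -> a * a = 1.
Proof.
move=> ab; have : (`|a| * `|b|)%N == 1%N by rewrite -abszM ab.
by rewrite muln_eq1 => /andP[/eqP a1 _]; clear -a1; nia.
Qed.

(** The leading coefficient of an integral polynomial vanishing at [x] will do:
    substituting [X / a] and clearing denominators gives a monic polynomial. *)
Lemma Aint_scale (x : algC) : exists2 d : nat, (0 < d)%N & d%:R * x \in Aint.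
Proof.
have [p [_ mon_p] /(_ p)] := minCpolyP x; rewrite dvdpp => /rootP px0.
have [q [a nz_a Dp]] := rat_poly_scale p.
have nz_aC : a%:~R != 0 :> algC by rewrite intr_eq0.
have sz_q : size q = size p.
  by rewrite Dp size_scale ?invr_eq0 ?intr_eq0 // size_map_inj_poly ?rmorph0 //; apply: intr_inj.
have lc_q : lead_coef q = a.
  move/monicP: mon_p; rewrite Dp lead_coefZ lead_coef_map_inj ?rmorph0 //; last exact: intr_inj.
  move=> E; apply: (@intr_inj rat); apply: (@mulfI _ (a%:~R)^-1).
    by rewrite invr_eq0 intr_eq0.
  by rewrite E mulVf ?intr_eq0.
pose qC := map_poly (intr : int -> algC) q.
have qx0 : qC.[x] = 0.
  have := px0; rewrite Dp map_polyZ hornerZ -map_poly_comp /=.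
  rewrite (eq_map_poly (g := intr)); last by move=> z; rewrite /= ratr_int.
  by move/eqP; rewrite mulf_eq0 fmorph_eq0 invr_eq0 intr_eq0 (negPf nz_a) => /eqP.
have sz_qC : size qC = size p by rewrite size_map_inj_poly ?rmorph0 //; apply: intr_inj.
have [n Dn] : exists n, size p = n.+2.
  case Dsz: (size p) => [|[|n]]; last by exists n.
    by move/eqP: Dsz; rewrite size_poly_eq0 => /eqP p0; have := monic_neq0 mon_p; rewrite p0 eqxx.
  have /size_poly1P[c nz_c Dc] : size p == 1%N by rewrite Dsz.
  by move/eqP: px0; rewrite Dc map_polyC hornerC fmorph_eq0 (negPf nz_c).
pose P : {poly int} := \poly_(i < n.+2) (if i == n.+1 then 1 else q`_i * a ^+ (n - i)).
have PC : root (map_poly intr P) (a%:~R * x).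
  apply/rootP; rewrite (@horner_coef_wide _ n.+2); last first.
    by rewrite (leq_trans (size_poly _ _)) ?size_poly.
  transitivity (a%:~R ^+ n * qC.[x]); last by rewrite qx0 mulr0.
  rewrite horner_coef sz_qC Dn mulr_sumr; apply: eq_bigr => i _.
  rewrite !coef_map /= coef_poly ltn_ord; have [->|ne_i] := eqVneq.
    have -> : q`_n.+1 = a by rewrite -lc_q lead_coefE sz_q Dn.
    by rewrite exprMn exprS mul1r; ring.
  have le_in : (i <= n)%N by have := ltn_ord i; rewrite ltnS leq_eqVlt (negPf ne_i).
  have -> : a%:~R ^+ n = a%:~R ^+ (n - i) * a%:~R ^+ i :> algC by rewrite -exprD subnK.
  by rewrite intrM rmorphXn exprMn /=; ring.
have monP : map_poly (intr : int -> algC) P \is monic.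
  apply/monicP; rewrite lead_coef_map_inj ?rmorph0 //; last exact: intr_inj.
  by rewrite lead_coefE size_poly_eq ?eqxx ?oner_eq0 // coef_poly ltnSn eqxx.
have Aax : a%:~R * x \in Aint.
  apply: root_monic_Aint PC monP _; apply/polyOverP => i.
  by rewrite coef_map intr_int.
exists `|a|%N; first by rewrite absz_gt0.
by rewrite natr_absz; case: (ger0P a) => _ //; rewrite rmorphN mulNr rpredN.
Qed.

Section Minkowski.
Variables (K : splittingFieldType rat) (iota : {rmorphism K -> algC}).
Hypothesis galK : galois 1 {:K}.
Hypothesis realK : forall x, iota x \is Num.real.
Local Notation G := 'Gal({:K} / 1)%g.
Local Notation r := (\dim {:K}).

Lemma card_galK : #|G| = r.
Proof. by rewrite -(galois_dim galK) dimv1 divn1. Qed.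

Lemma galT : G = [set: gal_of {:K}].
Proof.
by apply/setP => s; rewrite inE gal_kAut ?sub1v // kAut1E limg_gal subvv.
Qed.

Lemma integral_basis : exists w : 'I_r -> K,
  (forall j, iota (w j) \in Aint) /\
  (forall c : 'I_r -> int, \sum_j w j *~ c j = 0 -> forall j, c j = 0).
Proof.
pose b := vbasis {:K}.
have scal j : exists d : nat, (0 < d)%N && (iota (b`_j *+ d) \in Aint).
  have [d d_gt0 Ad] := Aint_scale (iota b`_j).
  by exists d; rewrite d_gt0 rmorphMn -mulr_natl.
pose d j := xchoose (scal j).
exists (fun j => b`_j *+ d j); split=> [j|c sum0 j].
  by have /andP[] := xchooseP (scal j).
have /andP[d_gt0 _] := xchooseP (scal j).
have /freeP/(_ (fun j => (c j * (d j : int))%:~R)) := basis_free (vbasisP {:K}).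
move=> /(_ _ j) /eqP; rewrite intr_eq0 mulf_eq0 eqz_nat (gtn_eqF d_gt0) orbF => H.
apply/eqP/H; rewrite -[RHS]sum0; apply: eq_bigr => i _.
by rewrite scaler_int [c i * _]mulrC mulrzA.
Qed.

Section Box.
Variable w : 'I_r -> K.
Hypothesis free_w : forall c : 'I_r -> int, \sum_j w j *~ c j = 0 -> forall j, c j = 0.
Variable C : nat.
Hypothesis C_bound : forall s : gal_of {:K}, \sum_j `|iota (s (w j))| < C%:R.

Definition zcomb (c : {ffun 'I_r -> int}) : K := \sum_j w j *~ c j.

Lemma conj_zcomb_bound (c : {ffun 'I_r -> int}) (Q : nat) (s : gal_of {:K}) :
  (0 < Q)%N -> (forall j, `|c j| <= Q)%R -> `|iota (s (zcomb c))| < Q%:R * C%:R.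
Proof.
move=> Q_gt0 le_cQ; rewrite /zcomb !rmorph_sum /=.
apply: le_lt_trans (ler_norm_sum _ _ _) _.
apply: (@le_lt_trans _ _ (Q%:R * \sum_j `|iota (s (w j))|)).
  rewrite mulr_sumr ler_sum // => j _; rewrite !rmorphMz -mulrzl normrM.
  by rewrite ler_wpM2r // -intr_norm -[Q%:R]/(Q%:~R) ler_int le_cQ.
by rewrite ltr_pM2l ?ltr0n.
Qed.

(** The coefficients range over a box of side about [h ^ (r - 1)].  All conjugates
    except the one given by the identity are sorted into [h ^ r] intervals each;
    there are more elements than boxes, and the difference of two elements in the
    same box has small conjugates.  The remaining conjugate is bounded by the size
    of the box, which keeps the norm bounded independently of [h]. *)
Lemma box_principle (h : nat) : (0 < h)%N ->
  exists c : {ffun 'I_r -> int},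
  [/\ zcomb c != 0,
      forall s : gal_of {:K}, s != 1%g -> `|iota (s (zcomb c))| * h%:R < 2%:R * C%:R
    & `|iota (zcomb c)| <= C%:R * h%:R ^+ r.-1].
Proof.
move=> h_gt0; have r_gt0 : (0 < r)%N by rewrite -card_galK cardG_gt0.
pose Q := (h ^ r.-1)%N; have Q_gt0 : (0 < Q)%N by rewrite expn_gt0 h_gt0.
pose H' := (h ^ r).-1; have DH : H'.+1 = (h ^ r)%N by rewrite prednK // expn_gt0 h_gt0.
have C_gt0 : (0 : algC) < C%:R.
  by apply: le_lt_trans (C_bound 1%g); apply: sumr_ge0 => j _; apply: normr_ge0.
pose cf (f : {ffun 'I_r -> 'I_Q.+1}) : {ffun 'I_r -> int} := [ffun j => (f j : nat) : int].
pose B : algC := Q%:R * C%:R; have B_gt0 : 0 < B by rewrite mulr_gt0 // ltr0n.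
have B2_gt0 : 0 < 2%:R * B by rewrite mulr_gt0.
(* rescaled conjugate, with values in the interval from 0 to [h ^ r] *)
pose t (s : gal_of {:K}) f := (iota (s (zcomb (cf f))) + B) * H'.+1%:R / (2%:R * B).
have t_itv s f : 0 <= t s f < H'.+1%:R.
  have := @conj_zcomb_bound (cf f) Q s Q_gt0.
  rewrite real_ltr_norml ?realK // -/B => bnd; have /andP[lo hi] : - B < iota (s (zcomb (cf f))) < B.
    by apply: bnd => j; rewrite ffunE ger0_norm // lez_nat -ltnS.
  rewrite /t ler_pdivlMr //  ltr_pdivrMr //.
  rewrite mul0r mulr_ge0 //=; last by rewrite -lerBlDr sub0r ltW.
  by rewrite mulrC ltr_pM2l ?ltr0n // [2%:R]mulr2n mulrDl mul1r ltrD2r.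
pose A := [set s : gal_of {:K} | s != 1%g].
(* the identity of the Galois group gets a constant color, so that it
   does not count in the number of boxes *)
pose col (f : {ffun 'I_r -> 'I_Q.+1}) : {ffun gal_of {:K} -> 'I_H'.+1} :=
  [ffun s => if s \in A then inord (Num.truncn (t s f)) else ord0].
have /injectivePn[f1 [f2 ne_f eq_col]] : ~~ injectiveb col.
  apply/negP => /injectiveP inj_col.
  have : (#|image col predT| <= #|pffun_on ord0 (mem A) (mem [set: 'I_H'.+1])|)%N.
    apply: subset_leq_card; apply/subsetP => _ /imageP[f _ ->].
    apply/pffun_onP; split; last by move=> y _; rewrite inE.
    by apply/subsetP => s; rewrite inE /= ffunE; case: ifP; rewrite ?eqxx.
  rewrite card_image // card_pffun_on cardsT card_ord cardT -cardT card_ffun !card_ord leqNgt => /negP; apply.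
  have -> : #|A| = r.-1.
    rewrite (_ : A = [set~ 1%g]); last by apply/setP => s; rewrite !inE.
    by rewrite cardsC1 -cardsT -galT card_galK.
  by rewrite DH -expnM mulnC expnM ltn_exp2r.
pose c : {ffun 'I_r -> int} := [ffun j => cf f1 j - cf f2 j].
have Dz : zcomb c = zcomb (cf f1) - zcomb (cf f2).
  by rewrite /zcomb -sumrB; apply: eq_bigr => j _; rewrite ffunE mulrzBr.
have le_cQ j : `|c j| <= Q.
  have absle (a b q : nat) : (a < q.+1)%N -> (b < q.+1)%N -> `|a%:Z - b%:Z| <= q%:Z by lia.
  by rewrite !ffunE; apply: absle.
exists c; split.
- apply: contraNneq ne_f => /free_w c0; apply/eqP/ffunP => j; apply/val_inj.
  by have := c0 j; rewrite !ffunE => /eqP; rewrite subr_eq0 => /eqP[].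
- move=> s ne_s1; have /ffunP/(_ s) := eq_col; rewrite !ffunE inE ne_s1 => /(congr1 (@nat_of_ord _)) /=.
  have /andP[lo1 hi1] := t_itv s f1; have /andP[lo2 hi2] := t_itv s f2.
  rewrite !inordK ?truncn_lt_nat // => eq_tr.
  have /andP[l1 u1] := truncn_itv lo1; have /andP[l2 u2] := truncn_itv lo2.
  have lt1 : `|t s f1 - t s f2| < 1.
    rewrite eq_tr in l1 u1.
    have Rt f : t s f \is Num.real by apply: ger0_real; case/andP: (t_itv s f).
    rewrite real_ltr_norml ?realB // ltrBrDr ltrBlDr addrC.
    apply/andP; split.
      by rewrite ltrBlDr (lt_le_trans u2) // -natr1 lerD2r.
    by rewrite (lt_le_trans u1) // -natr1 addrC lerD2l.
  have Dt : t s f1 - t s f2 = iota (s (zcomb c)) * H'.+1%:R / (2%:R * B).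
    by rewrite Dz !rmorphB /t; ring.
  rewrite Dt normrM normfV (ger0_norm (ltW B2_gt0)) // in lt1.
  rewrite ltr_pdivrMr // mul1r normrM normr_nat in lt1.
  have : Q%:R * (`|iota (s (zcomb c))| * h%:R) < Q%:R * (2%:R * C%:R).
    rewrite mulrCA [X in _ < X]mulrCA -/B; apply: le_lt_trans lt1.
    by rewrite -natrM DH -expnSr prednK.
  by rewrite ltr_pM2l ?ltr0n.
- have := @conj_zcomb_bound c Q 1%g Q_gt0 le_cQ.
  by rewrite gal_id mulrC natrX => /ltW.
Qed.

(** The bound does not depend on the box, so that one factorial is a multiple of all
    good elements ([dvd_norm_fact]). *)
Definition good (c : {ffun 'I_r -> int}) :=
  zcomb c != 0 /\ `|\prod_(s in G) iota (s (zcomb c))| <= ((2 * C) ^ r)%:R.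

Definition dominated (c c' : {ffun 'I_r -> int}) :=
  [forall s : gal_of {:K}, (s != 1%g) ==> (`|iota (s (zcomb c))| < `|iota (s (zcomb c'))|)].

(** Taking [h] large in [box_principle] makes all conjugates but one smaller than
    those of the finitely many given elements. *)
Lemma good_small (cs : seq {ffun 'I_r -> int}) : {in cs, forall c, zcomb c != 0} ->
  exists2 c, good c & all (dominated c) cs.
Proof.
move=> nz_cs; have r_gt0 : (0 < r)%N by rewrite -card_galK cardG_gt0.
pose b c (s : gal_of {:K}) := Num.bound (2%:R * C%:R / `|iota (s (zcomb c))|).
pose h := (\max_(c <- cs) \max_s b c s).+1.
have [//|c [nz_c lt_c le_c]] := @box_principle h _; exists c.
  split=> //; have h_gt0 : (0 : algC) < h%:R by rewrite ltr0n.
  rewrite normr_prod (bigD1 1%g) ?group1 //= gal_id.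
  apply: (@le_trans _ _ ((C%:R * h%:R ^+ r.-1) * (2%:R * C%:R / h%:R) ^+ r.-1)).
    rewrite ler_pM ?prodr_ge0 // (_ : r.-1 = #|G :\ 1%g|); last first.
      by rewrite -card_galK (cardsD1 1%g G) group1.
    rewrite -prodr_const [leRHS](eq_bigl (fun s => (s \in G) && (s != 1%g))); last first.
      by move=> s; rewrite !inE andbC.
    apply: ler_prod => s /andP[_ /lt_c lt_s]; rewrite normr_ge0 /=.
    by rewrite ler_pdivlMr // ltW.
  have nz_h : (h%:R : algC) ^+ r.-1 != 0 by rewrite expf_neq0 ?gt_eqF.
  rewrite expr_div_n mulrACA mulfV // mulr1.
  rewrite -[in X in _ <= X](prednK r_gt0) -natrM -natrX -natrM ler_nat expnS.
  by rewrite leq_mul2r leq_pmull ?orbT.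
apply/allP => c' cs_c'; apply/forallP => s; apply/implyP => ne_s1.
have z_gt0 : 0 < `|iota (s (zcomb c'))| by rewrite normr_gt0 !fmorph_eq0 nz_cs.
have h_gt0 : (0 : algC) < h%:R by rewrite ltr0n.
rewrite -(ltr_pM2r h_gt0); apply: lt_trans (lt_c s ne_s1) _.
rewrite [ltRHS]mulrC -ltr_pdivrMr //.
have /archi_boundP lt_b : 0 <= 2%:R * C%:R / `|iota (s (zcomb c'))|.
  by rewrite mulr_ge0 ?invr_ge0 // ?mulr_ge0 ?ler0n.
apply: lt_le_trans lt_b _; rewrite ler_nat -/(b c' s) ltnW // ltnS.
by rewrite (leq_trans (leq_bigmax s)) // (@leq_bigmax_seq _ _ _ (fun c => \max_s b c s)%N).
Qed.

Lemma good_chain m : exists cs : seq {ffun 'I_r -> int},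
  [/\ size cs = m, forall c, c \in cs -> good c & pairwise dominated cs].
Proof.
elim: m => [|m [cs [sz_cs good_cs dom_cs]]]; first by exists [::].
have [|c good_c dom_c] := @good_small cs; first by move=> c /good_cs[].
exists (c :: cs); split=> //=; first by rewrite sz_cs.
  by move=> c'; rewrite in_cons => /predU1P[->|/good_cs].
by rewrite dom_c.
Qed.

Hypothesis Aint_w : forall j, iota (w j) \in Aint.

Lemma Aint_zcomb c : iota (zcomb c) \in Aint.
Proof.
rewrite rmorph_sum; apply: rpred_sum => j _; rewrite rmorphMz /= -mulrzl.
by rewrite rpredM // Aint_int.
Qed.

Lemma Aint_gal (s : gal_of {:K}) x : iota x \in Aint -> iota (s x) \in Aint.
Proof.
have Gs : s \in G by rewrite galT inE.
by have [nu <-] := aut_extend iota Gs; rewrite Aint_aut.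
Qed.

(** An algebraic integer divides its norm, and a nonzero norm of absolute value at
    most [B] divides [B!]. *)
Lemma dvd_norm_fact c : good c ->
  iota ((((2 * C) ^ r)`!)%:R / zcomb c) \in Aint.
Proof.
case=> nz_c; have [N DN] := galNorm_int galK (Aint_zcomb c).
rewrite DN -intr_norm -natr_absz ler_nat => le_N.
have nz_N : N != 0.
  rewrite -(intr_eq0 algC) -DN; apply/prodf_neq0 => s _; rewrite !fmorph_eq0.
  exact: nz_c.
have /dvdnP[k Dk] : (`|N| %| ((2 * C) ^ r)`!)%N by rewrite dvdn_fact // absz_gt0 nz_N.
rewrite Dk natrM; have : iota (N%:~R / zcomb c) \in Aint.
  rewrite fmorph_div rmorph_int -DN (bigD1 1%g) ?group1 //= gal_id.
  rewrite mulrAC mulfV ?fmorph_eq0 // mul1r; apply: rpred_prod => s _.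
  exact/Aint_gal/Aint_zcomb.
have -> : `|N|%N%:R = (`|N| : int)%:~R :> K by rewrite -abszE.
move=> AN; rewrite -mulrA rmorphM rmorph_nat; apply: rpredM; first by rewrite Aint_Cnat.
by case: (ger0P N) AN => // _ AN; rewrite rmorphN mulNr rmorphN rpredN.
Qed.

(** In a long chain of elements of bounded norm, each dominated by the later ones
    away from the identity, two have congruent coordinates modulo [d B!].  As both
    divide [B!], each divides their difference, with a quotient divisible by [d]:
    their ratio is a unit congruent to 1 modulo [d], and it is small at all
    nontrivial conjugates. *)
Lemma box_unit (d : nat) : (0 < d)%N -> exists2 u : K, u != 0 &
  [/\ iota u \in Aint, iota u^-1 \in Aint, (iota u - 1) / d%:R \in Aint
    & forall s : gal_of {:K}, s != 1%g -> `|iota (s u)| < 1].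
Proof.
move=> d_gt0; pose f := (((2 * C) ^ r)`!)%N; pose D := (d * f)%N.
have D_gt0 : (0 < D)%N by rewrite muln_gt0 d_gt0 fact_gt0.
pose color (c : {ffun 'I_r -> int}) : {ffun 'I_r -> 'I_D.-1.+1} :=
  [ffun j => inord `|(c j %% D)%Z|%N].
have [cs [sz_cs good_cs dom_cs]] := good_chain #|{ffun 'I_r -> 'I_D.-1.+1}|.+1.
have /(uniqPn (color [ffun=> 0])) [i [j [lt_ij lt_j]]] : ~~ uniq (map color cs).
  apply/negP => /card_uniqP; rewrite size_map sz_cs => E.
  by have := max_card (mem (map color cs)); rewrite E ltnn.
rewrite size_map in lt_j; have lt_i := ltn_trans lt_ij lt_j.
rewrite !(nth_map [ffun=> 0]) // => eq_col.
set c1 := nth _ cs i in eq_col; set c2 := nth _ cs j in eq_col.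
have [good1 good2] : good c1 /\ good c2 by split; apply: good_cs; apply: mem_nth.
have [[nz1 _] [nz2 _]] := (good1, good2).
have dom12 : dominated c1 c2.
  by have /(pairwiseP [ffun=> 0]) := dom_cs; apply; rewrite ?inE.
have [y Ay Dy] : exists2 y, iota y \in Aint & zcomb c1 - zcomb c2 = y * D%:R.
  exists (zcomb [ffun k => ((c1 k - c2 k) %/ D)%Z]); first exact: Aint_zcomb.
  rewrite /zcomb -sumrB mulr_suml; apply: eq_bigr => k _; rewrite ffunE.
  have /eqP eq_mod : (c1 k == c2 k %[mod D])%Z.
    have nz_D : D%:Z != 0 by rewrite eqz_nat -lt0n.
    have modK (c0 : {ffun 'I_r -> int}) : ((c0 k %% D)%Z = (color c0 k : nat) :> int).
      rewrite ffunE inordK ?gez0_abs ?modz_ge0 // prednK // -ltz_nat gez0_abs ?modz_ge0 //.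
      by rewrite ltz_pmod // ltz_nat.
    by rewrite !modK eq_col.
  have dvD : (D %| c1 k - c2 k)%Z by rewrite -eqz_mod_dvd eq_mod.
  by rewrite -mulrzBr -{1}(divzK dvD) mulrzA mulr_natr.
have Af c : good c -> forall z, iota z \in Aint -> iota (z * D%:R / zcomb c / d%:R) \in Aint.
  move=> good_c z Az; have -> : z * D%:R / zcomb c / d%:R = z * (f%:R / zcomb c).
    have nz_d : d%:R != 0 :> K by rewrite -(fmorph_eq0 iota) rmorph_nat pnatr_eq0 -lt0n.
    have [nz_c _] := good_c; rewrite /D natrM; field.
    by rewrite ?nz_d ?nz_c.
  by rewrite rmorphM rpredM // dvd_norm_fact.
have Au1 : (iota (zcomb c1 / zcomb c2) - 1) / d%:R \in Aint.
  rewrite (_ : _ / _ = iota (y * D%:R / zcomb c2 / d%:R)) ?Af //.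
  by rewrite -Dy [in RHS]mulrBl mulfV // [RHS]fmorph_div rmorph_nat [in RHS]rmorphB rmorph1.
have Au2 : (iota (zcomb c2 / zcomb c1) - 1) / d%:R \in Aint.
  rewrite (_ : _ / _ = iota ((- y) * D%:R / zcomb c1 / d%:R)) ?Af ?rmorphN ?rpredN //.
  by rewrite mulNr -Dy opprB [in RHS]mulrBl mulfV // [RHS]fmorph_div rmorph_nat [in RHS]rmorphB rmorph1.
have Ad x : (x - 1) / d%:R \in Aint -> x \in Aint.
  move=> Ax; rewrite -[x](subrK 1) rpredD // -[x - 1](@divfK _ d%:R).
    by rewrite rpredM // Aint_Cnat.
  by rewrite pnatr_eq0 -lt0n.
exists (zcomb c1 / zcomb c2); first by rewrite mulf_neq0 ?invr_eq0.
split; rewrite ?invf_div ?(Ad _ Au1) ?(Ad _ Au2) //.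
move=> s ne_s1; have /forallP/(_ s)/implyP/(_ ne_s1) := dom12.
rewrite !rmorphM /= !fmorphV normrM normfV ltr_pdivrMr ?mul1r //.
by rewrite normr_gt0 !fmorph_eq0.
Qed.

End Box.

End Minkowski.

(** The unit of [box_unit] in the splitting field of [p], seen as an algebraic
    number: an automorphism fixing the roots of [p] restricts to the identity. *)
Lemma dominant_unit (p : {poly rat}) (rs : seq algC) (d : nat) :
    map_poly ratr p = \prod_(z <- rs) ('X - z%:P) ->
    {in rs, forall z, z \is Num.real} -> (0 < d)%N ->
  exists2 u : algC, u != 0 &
  [/\ u \in Aint, u^-1 \in Aint, (u - 1) / d%:R \in Aint
    & forall nu : {rmorphism algC -> algC}, {in rs, forall z, nu z = z} \/ `|nu u| < 1].
Proof.
move=> Dp real_rs d_gt0; have [K galK [iota [s Ds genK]]] := splitting_num_field Dp.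
have realK : forall x, iota x \is Num.real.
  by apply: (real_gen genK) => y s_y; apply: real_rs; rewrite -Ds map_f.
have [w [Aint_w free_w]] := integral_basis iota.
pose C := \max_(s : gal_of {:K}) Num.bound (\sum_j `|iota (s (w j))|).
have C_bound (t : gal_of {:K}) : \sum_j `|iota (t (w j))| < C%:R.
  apply: lt_le_trans (archi_boundP _) _; first by apply: sumr_ge0 => j _; apply: normr_ge0.
  by rewrite ler_nat leq_bigmax.
have [u nz_u [Au AVu Au1 lt_u]] := box_unit galK realK free_w C_bound Aint_w d_gt0.
exists (iota u); first by rewrite fmorph_eq0.
split=> //; first by rewrite -fmorphV.
move=> nu; have [t Gt Dt] := aut_restrict iota nu.
have [t1 | ne_t1] := eqVneq t 1%g; last by right; rewrite Dt lt_u.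
by left=> z; rewrite -Ds => /mapP[y _ ->]; rewrite Dt t1 gal_id.
Qed.

(** * Unipotence of the translations *)

Lemma map_mxX (R S : pzRingType) (f : {rmorphism R -> S}) n (M : 'M[R]_n) i :
  map_mx f (M ^+ i) = map_mx f M ^+ i.
Proof.
elim: i => [|i IHi]; first by rewrite !expr0 map_mx1.
by rewrite !exprS -[M * _]/(M *m _) map_mxM IHi.
Qed.

Lemma unitmxX (R : comUnitRingType) n (M : 'M[R]_n) i : M \in unitmx -> M ^+ i \in unitmx.
Proof.
move=> uM; elim: i => [|i IHi]; first by rewrite expr0 unitmx1.
by rewrite exprS -[M * _]/(M *m _) unitmx_mul uM.
Qed.

Lemma intr_unitmx (R : comUnitRingType) n (M : 'M[int]_n) :
  M \in unitmx -> map_mx intr M \in (unitmx : {pred 'M[R]_n}).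
Proof. by rewrite !unitmxE det_map_mx; apply: rmorph_unit. Qed.

Lemma ord_collision k (T : finType) (f : 'I_k -> T) : (#|T| < k)%N ->
  exists i1 i2 : 'I_k, (i1 < i2)%N /\ f i1 = f i2.
Proof.
move=> lt_k; have /injectivePn[i1 [i2 ne_i eq_f]] : ~~ injectiveb f.
  by apply/negP => /injectiveP/leq_card; rewrite card_ord leqNgt lt_k.
by case: (ltngtP i1 i2) => [lt|gt|/val_inj eq]; [exists i1, i2 | exists i2, i1 | rewrite eq eqxx in ne_i].
Qed.

(** [A ^+ p - 1] is the product of the [A - z] for the [p]-th roots of unity [z],
    which are not eigenvalues. *)
Lemma hyperbolic_det n (A : 'M[int]_n) p : hyperbolic A -> (0 < p)%N ->
  \det (A ^+ p - 1) != 0.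
Proof.
case: n A => [|n] A hypA p_gt0; first by rewrite det_mx00.
pose AC : 'M[algC]_n.+1 := map_mx intr A.
have [zs Dzs] := closed_field_poly_normal ('X^p - 1 : {poly algC}).
rewrite (monicP (monicXnsubC _ p_gt0)) scale1r in Dzs.
have DA : map_mx intr (A ^+ p - 1) = \prod_(z <- zs) (AC - z%:M).
  rewrite map_mxB map_mx1 map_mxX -/AC -[AC ^+ p - _]/(AC ^+ p - 1) -[in LHS](horner_mx_X AC).
  rewrite -(rmorphXn (horner_mx AC)) -[in LHS](rmorph1 (horner_mx AC)) -(rmorphB (horner_mx AC)) Dzs.
  rewrite (rmorph_prod (horner_mx AC)).
  apply: eq_bigr => z _; rewrite (rmorphB (horner_mx AC)). 
  by congr (_ - _); [exact: horner_mx_X | exact: horner_mx_C].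
rewrite -(intr_eq0 algC) -det_map_mx DA (big_morph _ (@det_mulmx _ _) (det1 _ _)).
rewrite prodf_seq_neq0; apply/allP => z zs_z; apply/implyP => _; apply/negP => det0.
have : eigenvalue AC z.
  have /det0P[v nz_v] := det0; rewrite mulmxBr mul_mx_scalar => /eqP.
  by rewrite subr_eq0 => /eqP vA; apply/eigenvalueP; exists v.
move/hypA/negP; apply; rewrite -(@pexpr_eq1 _ _ p) ?normr_ge0 // -normrX.
have : root ('X^p - 1) z by rewrite Dzs root_prod_XsubC.
by rewrite /root !hornerE subr_eq0 => /eqP ->; rewrite normr1.
Qed.

Section Unipotent.
Variables (n N' : nat) (A : 'M[int]_n).
Local Notation N := N'.+1.
Hypotheses (uA : A \in unitmx) (hypA : hyperbolic A).
Variables (U : 'cV[int]_n -> 'M[rat]_N) (g : 'M[rat]_N).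
Hypotheses (UD : forall x y, U (x + y) = U x *m U y) (Uunit : forall x, U x \in unitmx).
Hypotheses (gunit : g \in unitmx) (gU : forall x, g *m U x = U (A *m x) *m g).

Let V x : 'M[algC]_N := map_mx ratr (U x).

Lemma trans0 : U 0 = 1%:M.
Proof.
by rewrite -[LHS](mulKmx (Uunit 0)) -UD addr0 mulVmx.
Qed.

Let VD x y : V (x + y) = V x *m V y. Proof. by rewrite /V UD map_mxM. Qed.

Let V0 : V 0 = 1%:M. Proof. by rewrite /V trans0 map_mx1. Qed.

Lemma int_col_ind (P : 'cV[int]_n -> Prop) :
  P 0 -> (forall x y, P x -> P y -> P (x + y)) -> (forall x, P x -> P (- x)) ->
  (forall k, P (delta_mx k 0)) -> forall x, P x.
Proof.
move=> P0 PD PN Pe x; rewrite [x]matrix_sum_delta.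
apply: big_ind => // k _; rewrite big_ord1.
have Pn (m : nat) : P (delta_mx k 0 *+ m).
  by elim: m => [|m IHm]; rewrite ?mulr0n // mulrS; apply: PD.
rewrite -[x k 0]intz scaler_int; case: (x k 0) => m; first exact: Pn.
by rewrite NegzE mulrNz; apply/PN/Pn.
Qed.

Definition weight (w : 'rV[algC]_N) := w != 0 /\ forall x, exists c, w *m V x = c *: w.

Lemma weight_basis (w : 'rV_N) : w != 0 ->
  (forall k, exists c, w *m V (delta_mx k 0) = c *: w) -> weight w.
Proof.
move=> nz_w wV; split=> //; apply: int_col_ind => //.
- by exists 1; rewrite V0 mulmx1 scale1r.
- by move=> x y [a wx] [b wy]; exists (a * b); rewrite VD mulmxA wx -scalemxAl wy scalerA.
move=> x [a wx]; exists a^-1.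
have : w *m V x *m V (- x) = w by rewrite -mulmxA -VD subrr V0 mulmx1.
rewrite wx -scalemxAl => Ew; have nz_a : a != 0.
  by apply: contraNneq nz_w => a0; rewrite -Ew a0 scale0r.
by rewrite -[in RHS]Ew scalerA mulVf // scale1r.
Qed.

Lemma weight_scalar (w : 'rV_N) x a b : w != 0 -> w *m V x = a *: w -> w *m V x = b *: w -> a = b.
Proof.
move=> nz_w -> /eqP; rewrite -subr_eq0 -scalerBl scaler_eq0 (negPf nz_w) orbF subr_eq0.
by move/eqP.
Qed.

Lemma gU_exp i x : g ^+ i *m U x = U (A ^+ i *m x) *m g ^+ i.
Proof.
elim: i x => [|i IHi] x; first by rewrite !expr0 mul1mx mulmx1 mul1mx.
rewrite (exprSr g) -[g ^+ i * g]/(_ *m g) -mulmxA gU mulmxA IHi -mulmxA.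
by congr (U _ *m _); rewrite exprSr -[_ * A]/(_ *m A) mulmxA.
Qed.

(** Composing a weight with a power of [A] gives a weight, since [g] conjugates the
    translation by [x] to the translation by [A x].  On a generator the value of a
    weight is one of the [N] eigenvalues of a fixed matrix, so there are at most
    [N ^ n] weights; hence some [A ^+ p] fixes the given one, which is then trivial
    on the image of [A ^+ p - 1]. *)
Lemma weight_periodic (w : 'rV_N) : weight w -> exists2 p, (0 < p <= N ^ n)%N &
  forall x, w *m V (\det (A ^+ p - 1) *: x) = w.
Proof.
case=> nz_w wV; have spec k : {rs : seq algC | char_poly (V (delta_mx k 0)) = \prod_(z <- rs) ('X - z%:P)}.
  have [rs Drs] := closed_field_poly_normal (char_poly (V (delta_mx k 0))).
  by exists rs; rewrite [LHS]Drs (monicP (char_poly_monic _)) scale1r.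
pose rs k := sval (spec k).
have sz_rs k : size (rs k) = N.
  have := size_char_poly (V (delta_mx k 0)).
  by rewrite (svalP (spec k)) size_prod_XsubC => -[].
have chi x : {c | w *m V x = c *: w} by apply: sig_eqW; apply: wV.
pose X x := sval (chi x); have XP x : w *m V x = X x *: w := svalP (chi x).
have XD x y : X (x + y) = X x * X y.
  by apply: (weight_scalar nz_w (XP _)); rewrite VD mulmxA XP -scalemxAl XP scalerA.
have X0 : X 0 = 1.
  by apply: (weight_scalar nz_w (XP _)); rewrite V0 mulmx1 scale1r.
have nzX x : X x != 0.
  by apply/negP => /eqP X_x; have := XD x (- x); rewrite subrr X0 X_x mul0r => /eqP; rewrite oner_eq0.
have specX i k : X (A ^+ i *m delta_mx k 0) \in rs k.
  rewrite -root_prod_XsubC -(svalP (spec k)) -eigenvalue_root_char.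
  pose gC : 'M[algC]_N := map_mx ratr (g ^+ i).
  have gC_unit : gC \in unitmx by rewrite map_unitmx unitrX.
  apply/eigenvalueP; exists (w *m gC).
    rewrite -mulmxA -map_mxM gU_exp map_mxM mulmxA -/(V _) XP.
    by rewrite -scalemxAl.
  by apply: contraNneq nz_w => w0; rewrite -(mulmxK gC_unit w) w0 mul0mx.
pose f (i : 'I_(N ^ n).+1) : {ffun 'I_n -> 'I_N} :=
  [ffun k => inord (index (X (A ^+ i *m delta_mx k 0)) (rs k))].
have [|i1 [i2 [lt_i eq_f]]] := @ord_collision _ _ f; first by rewrite card_ffun !card_ord.
have eqX x : X (A ^+ i1 *m x) = X (A ^+ i2 *m x).
  elim/int_col_ind: x => [|x y Ex Ey|x Ex|k].
  - by rewrite !mulmx0.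
  - by rewrite !mulmxDr !XD Ex Ey.
  - apply: (mulfI (nzX (A ^+ i1 *m x))); rewrite {2}Ex -!XD !mulmxN !subrr.
    by [].
  have /ffunP/(_ k) := eq_f; rewrite !ffunE => /(congr1 (@nat_of_ord _)) /=.
  have lt_ind i : (index (X (A ^+ i *m delta_mx k 0%R)) (rs k) < N)%N by rewrite -(sz_rs k) index_mem.
  rewrite !inordK // => E; rewrite -(nth_index 0 (specX i1 k)) E nth_index //.
pose p := (i2 - i1)%N; exists p.
  by rewrite subn_gt0 lt_i (leq_trans (leq_subr _ _)) // -ltnS ltn_ord.
have uAi := unitmxX i1 uA.
have X1 x : X ((A ^+ p - 1) *m x) = 1.
  have := eqX (invmx (A ^+ i1) *m x); rewrite mulKVmx //.
  rewrite -(subnK (ltnW lt_i)) -/p exprD -[_ * _]/(A ^+ p *m _) -mulmxA mulKVmx // => E.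
  apply: (mulIf (nzX x)); rewrite -XD mul1r mulmxBl mul1mx subrK E.
  by [].
(* the adjugate matrix puts the multiples of the determinant in this image *)
move=> x; have := X1 (\adj (A ^+ p - 1) *m x); rewrite mulmxA mul_mx_adj mul_scalar_mx.
by rewrite XP => ->; rewrite scale1r.
Qed.

(** The translations commute, so they have a common eigenvector in every eigenspace
    of one of them. *)
Lemma weight_of_eigenvalue x z : eigenvalue (V x) z ->
  exists2 w, weight w & w *m V x = z *: w.
Proof.
move=> eig_z; pose E := eigenspace (V x) z; pose B := row_base E.
have rk_gt0 : (0 < \rank E)%N by rewrite lt0n mxrank_eq0.
have Vcomm y1 y2 : V y1 *m V y2 = V y2 *m V y1 by rewrite -!VD addrC.
have stabB y : (B *m V y <= B)%MS.
  rewrite eq_row_base (eqmxMr _ (eq_row_base E)); apply/eigenspaceP.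
  have /eigenspaceP EV : (E <= E)%MS by [].
  by rewrite -mulmxA Vcomm mulmxA EV scalemxAl.
pose R y := B *m V y *m pinvmx B.
have RE y : R y *m B = B *m V y by apply: mulmxKpV.
have freeB : row_free B by apply: row_base_free.
have Rcomm y1 y2 : R y1 *m R y2 = R y2 *m R y1.
  apply: (row_free_inj freeB); rewrite /= -[LHS]mulmxA RE [LHS]mulmxA RE -[LHS]mulmxA.
  by rewrite -[RHS]mulmxA RE [RHS]mulmxA RE -[RHS]mulmxA Vcomm.
have [|v nz_v /allP stab_v] := @common_eigenvector _ _ [seq R (delta_mx k 0) | k : 'I_n] rk_gt0.
  by move=> _ _ /imageP[k1 _ ->] /imageP[k2 _ ->]; apply: Rcomm.
have nz_vB : v *m B != 0.
  by rewrite mulmx_free_eq0.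
exists (v *m B).
  apply: weight_basis => // k; have /sub_rVP[c Dc] := stab_v _ (image_f (fun k => R (delta_mx k 0)) (isT : k \in predT)).
  by exists c; rewrite -mulmxA -RE mulmxA Dc scalemxAl.
by apply/eigenspaceP; rewrite (submx_trans (submxMl _ _)) // eq_row_base.
Qed.

(** Every eigenvalue of a translation is the value of a weight
    ([weight_of_eigenvalue]), and all weights are trivial on the multiples of [D],
    the product of the determinants in [weight_periodic]. *)
Lemma trans_unipotent : exists2 D : int, D != 0 & forall x, (U (D *: x) - 1) ^+ N = 0.
Proof.
pose D := \prod_(1 <= p < (N ^ n).+1) \det (A ^+ p - 1).
have nzD : D != 0.
  rewrite prodf_seq_neq0; apply/allP => p; rewrite mem_index_iota => /andP[p_gt0 _].
  exact: hyperbolic_det.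
exists D => // x; pose W := V (D *: x).
have [rs Drs] := closed_field_poly_normal (char_poly W).
rewrite (monicP (char_poly_monic _)) scale1r in Drs.
have rs1 z : z \in rs -> z = 1.
  rewrite -root_prod_XsubC -Drs -eigenvalue_root_char => /weight_of_eigenvalue[w ww wz].
  have [p /andP[p_gt0 le_p] wp] := weight_periodic ww; case: ww => nz_w _.
  apply: (weight_scalar nz_w wz); rewrite scale1r /D (bigD1_seq p) ?iota_uniq //=.
    by rewrite -scalerA wp.
  by rewrite mem_index_iota p_gt0.
have char1 : char_poly W = ('X - 1%:P) ^+ N.
  have sz_rs : size rs = N.
    by have := size_char_poly W; rewrite Drs size_prod_XsubC => -[].
  rewrite Drs big_seq (eq_bigr (fun=> 'X - 1%:P)) => [|z /rs1-> //].
  by rewrite -big_seq big_const_seq count_predT sz_rs iter_mulr_1.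
have := Cayley_Hamilton W; rewrite char1 rmorphXn rmorphB /= horner_mx_X horner_mx_C => E.
apply/eqP; rewrite -(map_mx_eq0 (ratr : {rmorphism rat -> algC})); apply/eqP.
by rewrite map_mxX map_mxB map_mx1 -[RHS]E.
Qed.

End Unipotent.

(** * The Lie algebra of the translations *)

Section LieAlgebra.
Variables (n N' : nat) (A : 'M[int]_n).
Local Notation N := N'.+1.
Hypotheses (uA : A \in unitmx) (hypA : hyperbolic A).
Variables (U : 'cV[int]_n -> 'M[rat]_N) (g : 'M[rat]_N).
Hypotheses (UD : forall x y, U (x + y) = U x *m U y) (Uunit : forall x, U x \in unitmx).
Hypotheses (gunit : g \in unitmx) (gU : forall x, g *m U x = U (A *m x) *m g).
Hypothesis Uinj : injective U.

Let charQ : [pchar rat] =i pred0. Proof. exact: pchar_num. Qed.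

(** The [L k] are the logarithms of the translations by [D] times the
    basis vectors.  Their linear independence follows from the injectivity of the embedding:
    a rational relation gives, after clearing denominators, a translation with
    logarithm 0. *)
Lemma log_family : exists L : 'I_n -> 'M[rat]_N,
  [/\ forall k, g *m L k = (\sum_j (A j k)%:~R *: L j) *m g,
      forall k y, U y *m L k = L k *m U y
    & row_free (\matrix_k mxvec (L k))].
Proof.
have [D nzD nilU] := trans_unipotent uA hypA UD Uunit gunit gU.
pose u x := U (D *: x).
have uD x y : u (x + y) = u x *m u y by rewrite /u scalerDr UD.
have ucomm x y : u x *m u y = u y *m u x by rewrite -!uD addrC.
have u0 : u 0 = 1%:M by rewrite /u scaler0 (trans0 UD Uunit).
have log1 : is_log (1%:M : 'M[rat]_N) 0.
  exists (map_mx polyC 1%:M) => [i|]; first by rewrite mx_evalC expr1n.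
  by apply/matrixP => a b; rewrite !mxE /coefp coefC.
have logu x : exists X, is_log (u x) X := is_log_exists charQ (nilU x).
have /fin_all_exists[L logL] k : exists X, is_log (u (delta_mx k 0)) X by [].
pose LL (x : 'cV[int]_n) := \sum_k (x k 0)%:~R *: L k.
have LLD x y : LL (x + y) = LL x + LL y.
  by rewrite -big_split; apply: eq_bigr => k _; rewrite mxE rmorphD scalerDl.
have LLN x : LL (- x) = - LL x.
  by rewrite -sumrN; apply: eq_bigr => k _; rewrite mxE rmorphN scaleNr.
have LLe k : LL (delta_mx k 0) = L k.
  rewrite /LL (bigD1 k) //= big1 => [|j neq_jk]; rewrite !mxE ?eqxx ?scale1r ?addr0 //.
  by rewrite (negPf neq_jk) scale0r.
have logLL x : is_log (u x) (LL x).
  elim/int_col_ind: x => [|x y lx ly|x lx|k]; last by rewrite LLe.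
  - by rewrite u0 /LL big1 // => k _; rewrite mxE scale0r.
  - by rewrite uD LLD; apply: is_logM.
  have [Y lY] := logu (- x); have := is_logM (ucomm x (- x)) lx lY.
  rewrite -uD subrr u0 => /(is_log_uniq charQ log1)/esym/eqP.
  by rewrite addrC addr_eq0 => /eqP DY; rewrite LLN -DY.
exists L; split=> [k|k y|].
- have -> : \sum_j (A j k)%:~R *: L j = LL (A *m delta_mx k 0).
    by apply: eq_bigr => j _; rewrite -colE mxE.
  rewrite -(LLe k); apply: (is_log_conj charQ _ (logLL _) (logLL _)).
  by rewrite /u gU -scalemxAr.
- rewrite -(LLe k); apply: (is_log_conj charQ _ (logLL _) (logLL _)).
  by rewrite /u -!UD addrC.
apply: inj_row_free => v vL0; have [q [a nz_a Dq]] := rat_poly_scale (rVpoly v).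
pose x : 'cV[int]_n := \col_k q`_k.
have Dv k : v 0 k = a%:~R^-1 * (x k 0)%:~R.
  by rewrite -coef_rVpoly_ord Dq coefZ coef_map mxE.
have LL0 : LL x = 0.
  have : \sum_k v 0 k *: L k = 0.
    apply: (can_inj mxvecK); rewrite linear_sum linear0 -[RHS]vL0 mulmx_sum_row.
    by apply: eq_bigr => k _; rewrite linearZ rowK.
  rewrite (eq_bigr (fun k => a%:~R^-1 *: ((x k 0)%:~R *: L k))) => [|k _]; last by rewrite scalerA Dv.
  rewrite -scaler_sumr => /eqP; rewrite scaler_eq0 invr_eq0 intr_eq0 (negPf nz_a) /=.
  by move/eqP.
have := logLL x; rewrite LL0 => /(is_log_inj charQ); rewrite -u0 => /Uinj/colP Dx.
apply/rowP => k; have := Dx k; rewrite scaler0 [LHS]mxE [RHS]mxE => /eqP.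
by rewrite mulf_eq0 (negPf nzD) /= Dv => /eqP ->; rewrite mxE mulr0.
Qed.

(** Conjugation by [g] acts on the span of the [L k] through [A]; an eigenvector of
    the transposed matrix gives the coefficients of [ell]. *)
Lemma eigen_log (F : fieldType) (f : {rmorphism rat -> F}) (l : F) :
    root (map_poly f (char_poly (map_mx intr A))) l ->
  exists ell : 'M[F]_N, [/\ ell != 0,
    map_mx f g *m ell = l *: (ell *m map_mx f g)
    & forall y, map_mx f (U y) *m ell = ell *m map_mx f (U y)].
Proof.
have [L [gL UL freeL]] := log_family.
pose AF : 'M[F]_n := map_mx f (map_mx intr A).
rewrite map_char_poly -/AF => rl.
have /eigenvalueP[w /rowP wA nz_w] : eigenvalue AF^T l.
  rewrite eigenvalue_root_char /char_poly /char_poly_mx.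
  rewrite -(map_trmx polyC) -(tr_scalar_mx _ 'X) -linearB det_tr.
  exact: rl.
pose LF k := map_mx f (L k).
exists (\sum_k w 0 k *: LF k); split=> [||y].
- apply: contraNneq nz_w => L0.
  have freeLF : row_free (map_mx f (\matrix_k mxvec (L k))) by rewrite row_free_map.
  rewrite -(mulmx_free_eq0 w freeLF) mulmx_sum_row; apply/eqP.
  rewrite -[RHS](linear0 mxvec) -L0 linear_sum; apply: eq_bigr => k _.
  by rewrite linearZ /= -map_row rowK map_mxvec.
- rewrite mulmx_sumr (eq_bigr (fun k => \sum_j (w 0 k * AF j k) *: (LF j *m map_mx f g))).
    rewrite exchange_big /= mulmx_suml scaler_sumr; apply: eq_bigr => j _.
    rewrite -scaler_suml -scalemxAl scalerA; congr (_ *: _).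
    by have := wA j; rewrite !mxE => <-; apply: eq_bigr => k _; rewrite !mxE.
  move=> k _; rewrite -scalemxAr -map_mxM gL map_mxM raddf_sum mulmx_suml scaler_sumr.
  apply: eq_bigr => j _; rewrite /= map_mxZ -scalemxAl scalerA; congr (_ *: _).
  by rewrite !mxE.
rewrite mulmx_sumr mulmx_suml; apply: eq_bigr => k _.
by rewrite -scalemxAr -scalemxAl -!map_mxM UL.
Qed.

End LieAlgebra.

Section SpectralWeight.
Variables (F : fieldType) (N' : nat).
Local Notation N := N'.+1.
Variables (g : 'M[F]_N) (vs rs : seq F).
Hypotheses (Uvs : uniq vs) (sub_rs : {subset rs <= vs}).
Hypothesis char_g : char_poly g = \prod_(z <- rs) ('X - z%:P).
Local Notation proj := (spectral_proj g vs).

Lemma spectral_proj_nil a : a \in vs -> (g - a%:M) ^+ N * proj a = 0.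
Proof.
move=> vs_a; rewrite /spectral_proj.
have -> : (g - a%:M) ^+ N = horner_mx g (('X - a%:P) ^+ N).
  by rewrite rmorphXn rmorphB /= horner_mx_X horner_mx_C.
rewrite -rmorphM; apply: (horner_mx_eq0 sub_rs char_g) => u vs_u.
have [->|neq_ua] := eqVneq u a; first by rewrite dvdp_mulr.
by rewrite dvdp_mull // idem_poly_neq.
Qed.

(** Some product [proj a * ell * proj b] is nonzero.  Multiplication by [g] on its left
    and on its right has the eigenvalues [a] and [b], which gives [a = l * b]; and
    [spectral_fun e] acts there by the scalars [e a] and [e b]. *)
Lemma spectral_weight (ell : 'M[F]_N) (l c : F) (e : F -> F) : ell != 0 ->
    g *m ell = l *: (ell *m g) ->
    spectral_fun g vs e *m ell = c *: (ell *m spectral_fun g vs e) ->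
  exists a b, [/\ a \in vs, b \in vs, a = l * b & e a = c * e b].
Proof.
move=> nz_ell g_ell E_ell.
have comm_proj a : GRing.comm (proj a) g.
  by rewrite /spectral_proj -{2}[g]horner_mx_X; apply: comm_horner_mx2.
have [a vs_a [b vs_b nz_ab]] : exists2 a, a \in vs & exists2 b, b \in vs & proj a * ell * proj b != 0.
  have [/hasP[a vs_a /hasP[b vs_b nz]]|] :=
      boolP (has (fun a => has (fun b => proj a * ell * proj b != 0) vs) vs).
    by exists a => //; exists b.
  move/hasPn => H; case/eqP: nz_ell.
  rewrite -[ell]mul1r -[ell]mulr1 -(spectral_proj_sum Uvs sub_rs char_g) mulr_suml big_seq big1 // => a vs_a.
  rewrite mulrA mulr_sumr big_seq big1 // => b vs_b.
  by have /hasPn/(_ b vs_b)/negPn/eqP := H a vs_a.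
exists a, b; set x := proj a * ell * proj b in nz_ab.
have gx : g * x = l *: (x * g).
  have -> : g * x = proj a * (g * ell) * proj b by rewrite /x !mulrA (comm_proj a).
  have -> : x * g = proj a * (ell * g) * proj b by rewrite /x -!mulrA (comm_proj b).
  by rewrite -[g * ell]/(g *m ell) g_ell -scalerAr -scalerAl.
have projE d : d \in vs -> spectral_fun g vs e * proj d = e d *: proj d.
  move=> vs_d; rewrite mulr_suml (bigD1_seq d) //= big_seq_cond big1 => [|v /andP[vs_v neq_vd]].
    by rewrite addr0 -scalerAl (spectral_proj_mul sub_rs char_g) // eqxx scale1r.
  by rewrite -scalerAl (spectral_proj_mul sub_rs char_g) // (negPf neq_vd) scale0r scaler0.
have projE' d : d \in vs -> proj d * spectral_fun g vs e = e d *: proj d.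
  move=> vs_d; rewrite -projE // spectral_fun_horner /spectral_proj.
  exact: comm_horner_mx2.
split=> //.
  apply/eqP; apply: contraNT nz_ab => neq_a; apply/eqP.
  have cop : coprimep (('X - (l * b)%:P) ^+ N) (('X - a%:P) ^+ N).
    by rewrite coprimep_expl // coprimep_expr // coprimep_XsubC2 // subr_eq0.
  have scal_mul (d : F) (M : 'M[F]_N) : d%:M * M = d *: M by rewrite -[_ * _]/(_ *m _) mul_scalar_mx.
  have mul_scal (d : F) (M : 'M[F]_N) : M * d%:M = d *: M by rewrite -[_ * _]/(_ *m _) mul_mx_scalar.
  have step1 : (g - (l * b)%:M) * x = l *: (x * (g - b%:M)).
    by rewrite mulrBl gx scal_mul mulrBr mul_scal scalerBr scalerA.
  (* [g - l b] is nilpotent on the left of [x], and so is [g - a]; hence [x = 0] unless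
     [a = l b] *)
  have step i : (g - (l * b)%:M) ^+ i * x = l ^+ i *: (x * (g - b%:M) ^+ i).
    elim: i => [|i IHi]; first by rewrite !expr0 mul1r mulr1 scale1r.
    by rewrite exprS -mulrA IHi -scalerAr mulrA step1 -scalerAl scalerA -exprSr -mulrA -exprS.
  have hornerX d : horner_mx g (('X - d%:P) ^+ N) = (g - d%:M) ^+ N.
    by rewrite rmorphXn rmorphB /= horner_mx_X horner_mx_C.
  have px : horner_mx g (('X - (l * b)%:P) ^+ N) * x = 0.
    rewrite hornerX step /x -!mulrA.
    suff -> : proj b * (g - b%:M) ^+ N = 0 by rewrite !mulr0 scaler0.
    by rewrite -(spectral_proj_nil vs_b) -hornerX; apply: comm_horner_mx2.
  have qx : horner_mx g (('X - a%:P) ^+ N) * x = 0.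
    by rewrite hornerX /x !mulrA spectral_proj_nil // !mul0r.
  have /Bezout_eq1_coprimepP[[u v] /= uv1] := cop.
  rewrite -[x]mul1r -(rmorph1 (horner_mx g)) -uv1 (rmorphD (horner_mx g)) /=.
  rewrite (rmorphM (horner_mx g) u) (rmorphM (horner_mx g) v) /= mulrDl.
  by rewrite -(mulrA (horner_mx g u)) -(mulrA (horner_mx g v)) px qx !mulr0 addr0.
apply/eqP; rewrite -subr_eq0; apply: contraNT nz_ab => nz.
have : proj a * (spectral_fun g vs e * ell) * proj b = c *: (proj a * (ell * spectral_fun g vs e) * proj b).
  by rewrite -[_ * ell]/(_ *m ell) E_ell -scalerAr -scalerAl.
rewrite !mulrA projE' // -!mulrA projE // -!scalerAr scalerA -scalerAl mulrA => /eqP.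
by rewrite -subr_eq0 -scalerBl scaler_eq0 (negPf nz).
Qed.

End SpectralWeight.

(** * Multiplicative relations *)

Section MultiplicativeRelations.
Variable F : fieldType.
Implicit Types (x : F) (vs bs : seq F).

Lemma expz_sum (I : Type) (r : seq I) (P : pred I) (c : I -> int) x : x != 0 ->
  x ^ (\sum_(i <- r | P i) c i) = \prod_(i <- r | P i) x ^ c i.
Proof.
by move=> nz_x; apply: (big_morph (fun n => x ^ n)) => [m n|]; rewrite ?expr0z // expfzDr.
Qed.

Lemma expz_prod (I : Type) (r : seq I) (P : pred I) (f : I -> F) (m : int) :
  (\prod_(i <- r | P i) f i) ^ m = \prod_(i <- r | P i) f i ^ m.
Proof. by apply: (big_morph (fun x => x ^ m)) => [x y|]; rewrite ?exp1rz // expfzMl. Qed.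

Definition mult_independent bs := forall c : nat -> int,
  \prod_(0 <= j < size bs) bs`_j ^ c j = 1 -> forall j, (j < size bs)%N -> c j = 0.

(** The group generated by [vs] embeds in [Z^r] up to torsion; [bs] is a maximal
    independent family, built greedily, and [M] clears the denominators of the
    exponents. *)
Lemma exponent_basis vs : 0 \notin vs ->
  exists bs (M : nat) (C : F -> nat -> int),
  [/\ (0 < M)%N, 0 \notin bs, mult_independent bs
    & {in vs, forall v, v ^ M = \prod_(0 <= j < size bs) bs`_j ^ C v j}].
Proof.
elim: vs => [_|v vs IHvs].
  by exists [::], 1%N, (fun _ _ => 0); split=> // c _ j; rewrite ltn0.
rewrite in_cons negb_or eq_sym => /andP[nz_v /IHvs[bs [M [C [M_gt0 nz_bs ind_bs powM]]]]].
have nz_b j : (j < size bs)%N -> bs`_j != 0.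
  by move=> lt_j; apply: contraNneq nz_bs => <-; rewrite mem_nth.
have [[m [c [nz_m Dm]]]|indep] := classic (exists m (c : nat -> int),
    m != 0 /\ v ^ m = \prod_(0 <= j < size bs) bs`_j ^ c j).
  (* [v] depends on the family: the exponents of the others are scaled by the order [m] *)
  exists bs, (M * `|m|)%N, (fun w j => if w == v then c j * (sgz m * M%:Z) else C w j * `|m|%N).
  split=> // [|w]; first by rewrite muln_gt0 M_gt0 absz_gt0.
  rewrite in_cons => vs_w; have [->|neq_wv] := eqVneq w v.
    rewrite PoszM abszEsg mulrA [_ * m]mulrC -exprz_exp Dm expz_prod.
    by apply: eq_bigr => j _; rewrite exprz_exp [_ * sgz m]mulrC.
  have {neq_wv} vs_w' : w \in vs by move: vs_w; rewrite (negPf neq_wv).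
  rewrite PoszM -exprz_exp powM // expz_prod; apply: eq_bigr => j _.
  by rewrite exprz_exp.
exists (v :: bs), M, (fun w j => if w == v then (if j is 0%N then M%:Z else 0)
                                else if j is j'.+1 then C w j' else 0).
split=> // [||w].
- by rewrite in_cons negb_or eq_sym nz_v.
- move=> c; rewrite /= big_nat_recl //= => E.
  have c0 : c 0%N = 0.
    apply/eqP; apply: contraT => nz_c; case: indep.
    exists (c 0%N), (fun j => - c j.+1); split=> //.
    rewrite (eq_bigr (fun j => (bs`_j ^ c j.+1)^-1)) => [|j _]; last by rewrite invr_expz.
    rewrite prodfV; set P := \prod_(_ <= _ < _) _ in E *.
    have nzP : P != 0 by apply: contra_eq_neq E => ->; rewrite mulr0 eq_sym oner_eq0.
    by apply: (mulIf nzP); rewrite E mulVf.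
  case=> [|j] //; rewrite ltnS => lt_j; apply: (ind_bs (fun j => c j.+1)) => //.
  by move: E; rewrite c0 expr0z mul1r.
rewrite /= big_nat_recl //= in_cons; have [->|neq_wv] /= := eqVneq w v.
  by move=> _; rewrite big1 ?mulr1 // => j _; rewrite expr0z.
by move=> vs_w; rewrite expr0z mul1r powM.
Qed.

(** The homomorphisms from the multiplicative group generated by [vs] to [Z], given
    by their values on the generators. *)
Definition relation_additive vs (gam : F -> int) := forall c : F -> int,
  \prod_(v <- vs) v ^ c v = 1 -> \sum_(v <- vs) c v * gam v = 0.

Lemma exponent_additive vs bs (M : nat) (C : F -> nat -> int) j :
  0 \notin bs -> mult_independent bs ->
  {in vs, forall v, v ^ M = \prod_(0 <= j < size bs) bs`_j ^ C v j} ->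
  (j < size bs)%N -> relation_additive vs (fun v => C v j).
Proof.
move=> nz_bs ind_bs powM lt_j c rel_c.
apply: (ind_bs (fun k => \sum_(v <- vs) c v * C v k)) => //.
transitivity (\prod_(v <- vs) (v ^ c v) ^ M); last by rewrite -expz_prod rel_c exp1rz.
rewrite [RHS]big_seq [RHS](eq_bigr (fun v => \prod_(0 <= k < size bs) bs`_k ^ (c v * C v k))); last first.
  move=> v vs_v; rewrite exprz_exp mulrC -exprz_exp powM // expz_prod.
  by apply: eq_bigr => k _; rewrite exprz_exp mulrC.
rewrite -[RHS]big_seq exchange_big /= big_nat [RHS]big_nat; apply: eq_bigr => k lt_k.
by rewrite expz_sum //; apply: contraNneq nz_bs => <-; rewrite mem_nth.
Qed.

Lemma relation_additive_comb vs g1 g2 (a b : int) :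
  relation_additive vs g1 -> relation_additive vs g2 ->
  relation_additive vs (fun v => a * g1 v + b * g2 v).
Proof.
move=> add1 add2 c rel_c; rewrite (eq_bigr (fun v => a * (c v * g1 v) + b * (c v * g2 v))).
  by rewrite big_split /= -!mulr_sumr add1 // add2 // !mulr0 addr0.
by move=> v _; ring.
Qed.

End MultiplicativeRelations.

Section Twist.
Variables (K : splittingFieldType rat) (vs : seq K) (u : K).
Local Notation G := 'Gal({:K} / 1)%g.
Hypotheses (Uvs : uniq vs) (nz_vs : 0 \notin vs) (nz_u : u != 0).
Hypothesis stab_vs : forall (s : gal_of {:K}) v, v \in vs -> s v \in vs.

Lemma gal_perm (s : gal_of {:K}) : perm_eq (map s vs) vs.
Proof.
have Us : uniq (map s vs) by rewrite map_inj_uniq //; apply: fmorph_inj.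
apply: uniq_perm => //; have [||_] // := @uniq_min_size _ (map s vs) vs Us.
  by move=> _ /mapP[v vs_v ->]; apply: stab_vs.
by rewrite size_map.
Qed.

Lemma relation_additive_gal (gam : K -> int) (s : gal_of {:K}) :
  relation_additive vs gam -> relation_additive vs (fun v => gam (s v)).
Proof.
move=> add_g c rel_c; pose t := (s^-1)%g.
have tK v : t (s v) = v by rewrite -galM ?memvf // mulgV gal_id.
rewrite -[RHS](add_g (fun w => c (t w))).
  rewrite -[RHS](perm_big _ (gal_perm s)) big_map.
  by apply: eq_bigr => v _; rewrite tK.
rewrite -(perm_big _ (gal_perm s)) big_map /=.
have := congr1 s rel_c; rewrite rmorph1 rmorph_prod => /(etrans _); apply.
by apply: eq_bigr => v _; rewrite tK /= fmorphXz.
Qed.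

(** The homomorphism attached to [gam] with values in the group of units generated by
    the conjugates of [u].  The inverse in the exponent makes it commute with the
    Galois group, so that the matrix with these values on the eigenvalues of a
    rational matrix is rational. *)
Definition twist (gam : K -> int) (v : K) : K :=
  \prod_(s : gal_of {:K}) s u ^ gam ((s^-1)%g v).

Lemma twist_neq0 gam v : twist gam v != 0.
Proof. by apply/prodf_neq0 => s _; rewrite expfz_neq0 // fmorph_eq0. Qed.

Lemma twist_gal gam (s : gal_of {:K}) v : s (twist gam v) = twist gam (s v).
Proof.
rewrite [RHS](reindex_inj (mulIg s)) rmorph_prod; apply: eq_bigr => t _.
rewrite /= fmorphXz galM ?memvf //; congr (_ ^ gam _).
by rewrite invMg galM ?memvf // -(galM s) ?memvf // mulgV gal_id.
Qed.

Lemma twist_relation gam (c : K -> int) : relation_additive vs gam ->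
  \prod_(v <- vs) v ^ c v = 1 -> \prod_(v <- vs) twist gam v ^ c v = 1.
Proof.
move=> add_g rel_c; under eq_bigr => v _ do rewrite expz_prod.
rewrite exchange_big big1 //= => s _.
under eq_bigr => v _ do rewrite exprz_exp mulrC.
by rewrite -expz_sum ?fmorph_eq0 // (relation_additive_gal _ add_g) // expr0z.
Qed.

Lemma twist_comb g1 g2 (a b : int) v :
  twist (fun v => a * g1 v + b * g2 v) v = twist g1 v ^ a * twist g2 v ^ b.
Proof.
rewrite /twist !expz_prod -big_split; apply: eq_bigr => s _ /=.
by rewrite !exprz_exp expfzDr ?fmorph_eq0 // [a * _]mulrC [b * _]mulrC.
Qed.

End Twist.

Lemma norm_expz (x : algC) (m : int) : `|x ^ m| = `|x| ^ m.
Proof. by case: m => m; rewrite ?NegzE -?invr_expz ?normfV -!exprnP normrX. Qed.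

Section Reindex.
Variables (F : fieldType) (vs : seq F) (I : finType) (f : I -> F) (a : I -> int).
Hypotheses (Uvs : uniq vs) (vs_f : forall i, f i \in vs).

Let c v : int := \sum_i (f i == v)%:R * a i.

(** This and the next two lemmas turn a relation indexed by a finite type, where a
    value may be repeated, into one indexed by the list [vs]. *)
Lemma prod_fibers (h : F -> F) : {in vs, forall v, h v != 0} ->
  \prod_(v <- vs) h v ^ c v = \prod_i h (f i) ^ a i.
Proof.
move=> nz_h; rewrite big_seq (eq_bigr (fun v => \prod_i h v ^ ((f i == v)%:R * a i))); last first.
  by move=> v vs_v; rewrite -expz_sum // nz_h.
rewrite -big_seq exchange_big /=; apply: eq_bigr => i _.
rewrite (bigD1_seq (f i)) //= eqxx mul1r big1 ?mulr1 // => v neq_v.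
by rewrite eq_sym (negPf neq_v) mul0r expr0z.
Qed.

Lemma sum_fibers (h : F -> int) : \sum_(v <- vs) c v * h v = \sum_i a i * h (f i).
Proof.
rewrite (eq_bigr (fun v => \sum_i (f i == v)%:R * a i * h v)); last by move=> v _; rewrite mulr_suml.
rewrite exchange_big /=; apply: eq_bigr => i _.
rewrite (bigD1_seq (f i)) //= eqxx mul1r big1 ?addr0 // => v neq_v.
by rewrite eq_sym (negPf neq_v) !mul0r.
Qed.

Hypothesis nz_vs : 0 \notin vs.
Hypothesis rel_f : \prod_i f i ^ a i = 1.

Lemma rel_fibers : \prod_(v <- vs) v ^ c v = 1.
Proof.
apply: etrans (prod_fibers (h := fun v => v) _) rel_f => v vs_v.
by apply: contraNneq nz_vs => <-.
Qed.

Lemma relation_additiveE gam : relation_additive vs gam -> \sum_i a i * gam (f i) = 0.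
Proof. by move=> add_g; rewrite -sum_fibers; apply/add_g/rel_fibers. Qed.

End Reindex.

Section TwistTrivial.
Variables (K : splittingFieldType rat) (iota : {rmorphism K -> algC}).
Variables (vs ls : seq K) (u : K).
Hypotheses (Uvs : uniq vs) (nz_vs : 0 \notin vs) (nz_u : u != 0).
Hypothesis stab_vs : forall (s : gal_of {:K}) v, v \in vs -> s v \in vs.
Hypothesis stab_ls : forall (s : gal_of {:K}) l, l \in ls -> s l \in ls.
Hypothesis sub_ls : {subset ls <= vs}.
Hypothesis norm_ls : {in ls, forall l, (\prod_(s : gal_of {:K}) s l) ^+ 2 = 1}.
Hypothesis norm_u : `|\prod_(s : gal_of {:K}) iota (s u)| = 1.
Hypothesis lt_u : forall s : gal_of {:K}, {in ls, forall l, s l = l} \/ `|iota (s u)| < 1.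

(** At a point where [gam] is maximal on the orbit, dividing a power of the norm of [u]
    by the twist gives a product of the conjugates [s u] with exponents
    [gam l - gam (s^-1 l) >= 0].  All conjugates that occur with a positive exponent
    are smaller than 1 in absolute value, so none occurs when the twist is 1. *)
Lemma twist_max gam l : l \in ls -> (forall s : gal_of {:K}, gam (s l) <= gam l) ->
  twist u gam l = 1 -> forall s : gal_of {:K}, gam (s l) = gam l.
Proof.
move=> ls_l max_l tw1 s1; apply/eqP; rewrite eq_le max_l leNgt; apply/negP => lt_s1.
have galVK (s : gal_of {:K}) : (s^-1)%g (s l) = l by rewrite -galM ?memvf // mulgV gal_id.
pose x (s : gal_of {:K}) := `|iota (s u)|.
have x_gt0 s : 0 < x s by rewrite normr_gt0 !fmorph_eq0.
pose k (s : gal_of {:K}) := `|gam l - gam ((s^-1)%g l)|%N.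
have Dk (s : gal_of {:K}) : (k s)%:Z = gam l - gam ((s^-1)%g l) by rewrite gez0_abs // subr_ge0 max_l.
have prod1 : \prod_s x s ^+ k s = 1.
  transitivity (`|\prod_(s : gal_of {:K}) iota (s u)| ^ gam l / `|iota (twist u gam l)|).
    rewrite rmorph_prod !normr_prod expz_prod -prodf_div; apply: eq_bigr => s _ /=.
    rewrite fmorphXz norm_expz invr_expz -expfzDr ?gt_eqF //; last exact: x_gt0.
    by rewrite exprnP Dk.
  by rewrite tw1 norm_u rmorph1 normr1 exp1rz divr1.
have lt1_or s : x s < 1 \/ k s = 0%N.
  have [fix_s|] := lt_u s; [right | by left].
  have Ds : (s^-1)%g l = l by rewrite -{1}(fix_s l ls_l) galVK.
  by rewrite /k Ds subrr.
have le1 s : x s ^+ k s <= 1.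
  have [lt1|->] := lt1_or s; last by rewrite expr0.
  by rewrite exprn_ile1 ?ltW.
have k1 : k (s1^-1)%g != 0%N.
  by rewrite -eqz_nat Dk invgK subr_eq0 gt_eqF.
have lt1 : x (s1^-1)%g ^+ k (s1^-1)%g < 1.
  have [lt1|/eqP] := lt1_or (s1^-1)%g; last by rewrite (negPf k1).
  by rewrite exprn_ilt1 ?ltW.
have : \prod_s x s ^+ k s < 1.
  rewrite (bigD1 (s1^-1)%g) //=; apply: (le_lt_trans _ lt1).
  rewrite -[leRHS]mulr1 ler_wpM2l ?exprn_ge0 ?(ltW (x_gt0 _)) //.
  by apply: prodr_ile1 => s _; rewrite le1 exprn_ge0 ?ltW.
by rewrite prod1 ltxx.
Qed.

(** The triviality of the twist is invariant under conjugation, so by [twist_max] at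
    a maximum [gam] is constant on the orbit of [l]; it vanishes there because the
    norm of [l] is torsion. *)
Lemma twist_eq1 gam l : relation_additive vs gam -> l \in ls ->
  twist u gam l = 1 -> gam l = 0.
Proof.
move=> add_g ls_l tw1.
pose s0 : gal_of {:K} := [arg max_(s > (1%g : gal_of {:K})) gam (s l)]%O.
have max_s0 (s : gal_of {:K}) : gam (s l) <= gam (s0 l).
  by rewrite /s0; case: Order.TotalTheory.arg_maxP => // t _ H; apply: H.
have tw0 : twist u gam (s0 l) = 1 by rewrite -twist_gal tw1 rmorph1.
have const (s : gal_of {:K}) : gam (s (s0 l)) = gam (s0 l).
  by apply: twist_max => // [|t]; [exact: stab_ls | rewrite -galM ?memvf].
have := @relation_additiveE _ vs (gal_of {:K}) (fun s => s (s0 l)) (fun=> 2) Uvs.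
have vs_s0 (s : gal_of {:K}) : s (s0 l) \in vs by rewrite sub_ls ?stab_ls.
move=> /(_ vs_s0 nz_vs) H; have {H} : \sum_(s : gal_of {:K}) 2 * gam (s (s0 l)) = 0.
  by apply: H => //; rewrite prodrXl norm_ls // stab_ls.
rewrite -mulr_sumr => /eqP; rewrite mulf_eq0 /= (eq_bigr _ (fun s _ => const s)).
rewrite sumr_const -mulr_natr mulf_eq0 pnatr_eq0 => /orP[/eqP g0|]; last first.
  by rewrite cardT eqn0Ngt -cardT => /negP[]; apply/card_gt0P; exists 1%g.
have := const (s0^-1)%g; rewrite g0 -galM ?memvf // mulgV gal_id; exact.
Qed.

End TwistTrivial.

(** * Real quadratic fields *)

(** The norm of [x] is 1, so that a rational value of [x] would be an integer dividing
    1, which is excluded by [x ^+ 2 != 1]. *)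
Lemma quadratic_field (t : int) (x : algC) : x \is Num.real -> x ^+ 2 = t%:~R * x - 1 ->
    x ^+ 2 != 1 ->
  exists (L : fieldExtType rat) (iota : {rmorphism L -> algC}) (eps : L),
    [/\ real_quadratic iota, integer_unit eps & iota eps = x].
Proof.
move=> real_x x2 x2_neq1; have [L [iota [[|e []] // [De] genL]]] := num_field_exists [:: x].
have e2 : e ^+ 2 = t%:~R * e - 1.
  by apply: (fmorph_inj iota); rewrite rmorphXn rmorphB rmorphM rmorph_int rmorph1 De.
have nz_e : e != 0.
  apply/negP => /eqP e0; have := e2; rewrite e0 expr0n mulr0 sub0r => /eqP.
  by rewrite eq_sym oppr_eq0 oner_eq0.
have e_inv : e^-1 = t%:~R - e.
  by apply: (mulfI nz_e); rewrite mulfV // mulrBr -expr2 e2; ring.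
pose p : {poly int} := 'X^2 - t *: 'X + 1.
have mon_p : p \is monic.
  rewrite /p -addrA monicE lead_coefDl ?lead_coefXn // size_polyXn ltnS.
  rewrite (leq_trans (size_polyD _ _)) // geq_max size_polyN size_poly1 andbT.
  by rewrite (leq_trans (size_scale_leq _ _)) ?size_polyX.
have int_e : integralOver (intr : int -> L) e.
  exists p => //; rewrite /p rmorphD rmorphB rmorph1 /= map_polyXn map_polyZ map_polyX.
  by rewrite /root !hornerE e2; apply/eqP; ring.
have int_eV : integralOver (intr : int -> L) e^-1.
  rewrite e_inv; apply: integral_sub => //; exists ('X - t%:P); rewrite ?monicXsubC //.
  by rewrite map_polyXsubC root_XsubC.
exists L, iota, e; split=> //; split; last first.
  move=> y; have /Fadjoin_polyP[q /polyOverP Qq ->] : y \in <<1%AS; e>>%VS.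
    by rewrite -adjoin_seq1 genL memvf.
  rewrite horner_coef rmorph_sum rpred_sum // => i _; rewrite rmorphM rmorphXn /= De.
  have /vlineP[a ->] := Qq i; rewrite alg_num_field fmorph_rat rpredM ?rpredX //.
  exact/Creal_Crat/Crat_rat.
have gen1 : <<1; e>>%VS = fullv by rewrite -adjoin_seq1.
have := dim_Fadjoin 1%AS e; rewrite gen1 dimv1 muln1 => dimL.
have le2 : (adjoin_degree 1%AS e <= 2)%N.
  pose q : {poly L} := 'X^2 - t%:~R *: 'X + 1.
  have sz_q : (size q <= 3)%N.
    rewrite /q -addrA (leq_trans (size_polyD _ _)) // geq_max size_polyXn /=.
    rewrite (leq_trans (size_polyD _ _)) // geq_max size_polyN size_poly1 andbT.
    by rewrite (leq_trans (size_scale_leq _ _)) ?size_polyX.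
  have nz_q : q != 0.
    apply/negP => /eqP/(congr1 (fun q : {poly L} => q`_2)).
    by rewrite !coefE /= mulr0 subr0 addr0 => /eqP; rewrite oner_eq0.
  have Qq : q \is a polyOver 1%AS.
    by rewrite rpredD ?rpredB ?rpredX ?polyOverX ?rpred1 // polyOverZ ?polyOverX // rpred_int.
  have qe : root q e by rewrite /root !hornerE e2; apply/eqP; ring.
  by rewrite -ltnS -size_minPoly (leq_trans (dvdp_leq nz_q (minPoly_dvdp Qq qe))).
suff neq1 : adjoin_degree 1%AS e != 1%N.
  have : (0 < \dim {:L})%N by rewrite adim_gt0.
  by rewrite dimL; move: le2 neq1; case: adjoin_degree => [|[|[|]]].
apply/negP; rewrite adjoin_deg_eq1 => /vlineP[a Da]; case/negP: x2_neq1.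
have Ax : x \in Aint.
  apply: (@root_monic_Aint (map_poly intr p)).
  - rewrite /p rmorphD rmorphB rmorph1 /= map_polyXn map_polyZ map_polyX.
    by rewrite /root !hornerE x2; apply/eqP; ring.
  - by rewrite monicE lead_coef_map_inj ?rmorph0 ?(monicP mon_p) //; apply: intr_inj.
  - by apply/polyOverP => i; rewrite coef_map intr_int.
have /intrP[m Dm] : x \in Num.int.
  by apply: Cint_rat_Aint => //; rewrite -De Da alg_num_field fmorph_rat Crat_rat.
have mtm : m * (t - m) = 1.
  by apply: (@intr_inj algC); rewrite rmorphM rmorphB /= -Dm mulrBr -expr2 x2; ring.
by rewrite Dm expr2 -rmorphM (int_unit_square mtm).
Qed.

Definition powers_of_quadratic_unit m (lambda : 'I_m -> algC) : Prop :=
  exists2 k : nat, (0 < k)%N &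
    exists (L : fieldExtType rat) (iota' : {rmorphism L -> algC}) (eps : L),
      [/\ real_quadratic iota', integer_unit eps
        & forall i, exists z : int, lambda i ^+ k = iota' eps ^ z].

Section Dependent.
Variables (K : splittingFieldType rat) (iota : {rmorphism K -> algC}).
Hypothesis galK : galois 1 {:K}.
Variable ls : seq K.
Hypothesis stab_ls : forall (s : gal_of {:K}) l, l \in ls -> s l \in ls.
Hypothesis real_ls : {in ls, forall l, iota l \is Num.real}.
Hypothesis norm_ls : {in ls, forall l, `|iota l| != 1}.
Hypothesis Aint_ls : {in ls, forall l, iota l \in Aint}.
Hypothesis AintV_ls : {in ls, forall l, iota l^-1 \in Aint}.
Hypothesis nz_ls : 0 \notin ls.
Hypothesis dep_ls : {in ls &, forall l l1,
  exists (p : nat) (q : int), (0 < p)%N /\ l ^ p = l1 ^ q}.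

Let nz l : l \in ls -> l != 0.
Proof. by move=> ls_l; apply: contraNneq nz_ls => <-. Qed.

(** The absolute value of [l] is not 1. *)
Lemma torsion_free l (m : int) : l \in ls -> l ^ m = 1 -> m = 0.
Proof.
move=> ls_l lm1; apply/eqP; have := norm_ls ls_l; apply: contraNT => nz_m.
have : `|iota l| ^ m == 1.
  by rewrite -norm_expz -fmorphXz lm1 rmorph1 normr1.
by rewrite pexprz_eq1 // (negPf nz_m).
Qed.

(** Iterating [s] up to its order [m] gives [l ^ (p ^ m) = l ^ (q ^ m)], and [l] is not
    a root of unity. *)
Lemma gal_dep l (s : gal_of {:K}) (p : nat) (q : int) : l \in ls -> (0 < p)%N ->
  s l ^ p = l ^ q -> (`|q| = p)%N.
Proof.
move=> ls_l p_gt0 Dq; pose m := #[s]%g.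
have iter_s i : iter i s l ^ (p ^ i)%N = l ^ (q ^+ i).
  elim: i => [|i IHi]; first by rewrite expr1z.
  rewrite iterS expnSr PoszM -exprz_exp -fmorphXz IHi fmorphXz exprz_exp mulrC -exprz_exp Dq.
  by rewrite exprz_exp -exprS.
have Ds i : iter i s l = (s ^+ i)%g l.
  elim: i => [|i IHi]; first by rewrite expg0 gal_id.
  by rewrite iterS IHi expgSr galM ?memvf.
have := iter_s m; rewrite Ds expg_order gal_id => /eqP.
rewrite -subr_eq0 => /eqP E; have E1 : l ^ ((p ^ m)%N%:Z - q ^+ m) = 1.
  rewrite expfzDr ?nz // -invr_expz; apply: (mulIf (expfz_neq0 (q ^+ m) (nz ls_l))).
  by rewrite mulfVK ?expfz_neq0 ?nz // mul1r; apply/eqP; rewrite -subr_eq0 E.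
have /eqP := torsion_free ls_l E1; rewrite subr_eq0 => /eqP/(congr1 absz).
by rewrite abszX /= => /eqP; rewrite eqn_exp2r ?order_gt0 // => /eqP.
Qed.

(** A conjugate of [l] has a power equal to that of [l] or of its inverse
    ([gal_dep]), hence the same absolute value; squares remove the sign. *)
Lemma gal_square l (s : gal_of {:K}) : l \in ls ->
  s (l ^+ 2) = l ^+ 2 \/ s (l ^+ 2) = (l ^+ 2)^-1.
Proof.
move=> ls_l; have ls_sl := stab_ls s ls_l.
have [p [q [p_gt0 Dq]]] := dep_ls ls_sl ls_l.
have eq_sq a b : iota a \is Num.real -> iota b \is Num.real -> a ^+ p = b ^+ p -> a ^+ 2 = b ^+ 2.
  move=> Ra Rb E; apply: (fmorph_inj iota); rewrite !rmorphXn /= -(real_normK Ra) -(real_normK Rb).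
  congr (_ ^+ 2); apply/eqP; rewrite -(eqrXn2 p_gt0) ?normr_ge0 // -!normrX -!rmorphXn E.
  by [].
have := gal_dep ls_l p_gt0 Dq.
rewrite rmorphXn /=; case: q Dq => q Dq /= Dp.
  by left; apply: (eq_sq _ _ (real_ls ls_sl) (real_ls ls_l)); rewrite [LHS]exprnP Dq -Dp.
right; rewrite -exprVn; apply: (eq_sq _ _ (real_ls ls_sl)).
  by rewrite fmorphV rpredV real_ls.
by rewrite [LHS]exprnP Dq NegzE Dp -invr_expz exprVn.
Qed.

(** By [gal_square] the sum of [x = l1 ^+ 2] and its inverse is fixed by the Galois
    group: it is a rational integer [t], and [x] is a root of [X^2 - t X + 1]. *)
Lemma dependent_quadratic l1 (m : nat) (lambda : 'I_m -> algC) : l1 \in ls ->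
    (forall i, exists2 l, l \in ls & lambda i = iota l) ->
  powers_of_quadratic_unit lambda.
Proof.
move=> ls_l1 lam_ls; pose x := l1 ^+ 2; have nz_x : x != 0 by rewrite expf_neq0 // nz.
have [a Da] : exists a : rat, x + x^-1 = ratr a.
  apply: (gal_rat_fixed galK) => s _; rewrite rmorphD fmorphV /=.
  by have := gal_square s ls_l1; rewrite -/x => -[->|->]; rewrite ?invrK // addrC.
have [t Dt] : exists t : int, iota (x + x^-1) = t%:~R.
  apply/intrP/Cint_rat_Aint; first by rewrite Da fmorph_rat Crat_rat.
  by rewrite /x rmorphD -exprVn !rmorphXn rpredD ?rpredX //; [exact: Aint_ls | exact: AintV_ls].
have [|||L [iota' [eps [quadL unitL Deps]]]] := @quadratic_field t (iota x).
- by rewrite rmorphXn rpredX // real_ls.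
- rewrite -Dt -rmorphXn -rmorphM -(rmorph1 iota) -rmorphB; congr (iota _).
  by rewrite mulrDl mulVf // addrK.
- apply/negP; rewrite -rmorphXn fmorph_eq1 -exprM => /eqP x1.
  by have := torsion_free (m := (2 * 2)%N) ls_l1 x1.
have pq i : exists pq : nat * int, (0 < pq.1)%N /\ lambda i ^ pq.1 = iota l1 ^ pq.2.
  have [l ls_l ->] := lam_ls i; have [p [q [p_gt0 E]]] := dep_ls ls_l ls_l1.
  by exists (p, q); split=> //=; rewrite -!fmorphXz E.
have [f Df] := fin_all_exists pq.
(* clears the denominators of the exponents of all the [lambda i] over [l1] *)
exists (2 * \prod_i (f i).1)%N.
  by rewrite muln_gt0 /= prodn_gt0 // => i; case: (Df i).
exists L, iota', eps; split=> // i; have [_ Dl] := Df i.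
exists ((f i).2 * (\prod_(j | j != i) (f j).1)%N); rewrite Deps.
rewrite (bigD1 i) //= mulnCA exprM [X in X ^+ _]exprnP Dl exprnP exprz_exp.
by rewrite /x rmorphXn exprnP exprz_exp PoszM; congr (_ ^ _); ring.
Qed.

End Dependent.

Section UnitModulo.
Variable d : nat.
Hypothesis d_gt0 : (0 < d)%N.

Definition one_mod (x : algC) := x \in Aint /\ (x - 1) / d%:R \in Aint.

Lemma one_mod1 : one_mod 1.
Proof. by split; rewrite ?subrr ?mul0r. Qed.

Lemma one_modM x y : one_mod x -> one_mod y -> one_mod (x * y).
Proof.
move=> [Ax Ax1] [Ay Ay1]; split; first by rewrite rpredM.
have -> : (x * y - 1) / d%:R = (x - 1) / d%:R * y + (y - 1) / d%:R by ring.
by rewrite rpredD // rpredM.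
Qed.

(** [x^-1 - 1 = - x^-1 (x - 1)] deals with the negative powers. *)
Lemma one_modXz x (m : int) : x != 0 -> one_mod x -> x^-1 \in Aint -> one_mod (x ^ m).
Proof.
move=> nz_x ox AVx; have oV : one_mod x^-1.
  split=> //; case: ox => Ax Ax1.
  have -> : (x^-1 - 1) / d%:R = - (x^-1 * ((x - 1) / d%:R)).
    by rewrite mulrA mulrBr mulVf //; ring.
  by rewrite rpredN rpredM.
have oX y k : one_mod y -> one_mod (y ^+ k).
  move=> oy; elim: k => [|k IHk]; first by rewrite expr0; apply: one_mod1.
  by rewrite exprS; apply: one_modM.
case: m => k; first exact: oX.
by rewrite NegzE -exprz_inv; apply: (oX _ k.+1).
Qed.

End UnitModulo.

(** * Points of the group coming from units *)

Section ArithmeticPoints.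
Variables (n : nat) (A : 'M[int]_n) (uA : A \in unitmx).
Hypothesis hypA : hyperbolic A.
Variables (N' : nat) (Gs : seq {mpoly rat[N'.+1 * N'.+1]}).
Local Notation N := N'.+1.
Variable phi : semidirect uA -> 'M[rat]_N.
Hypothesis phi_inj : injective phi.
Hypothesis phiM : forall x y : semidirect uA, phi (x * y)%g = phi x *m phi y.
Hypothesis phi_points : forall x, points Gs (phi x).
Hypothesis phi_index : finite_index
  (fun h => (exists x, h = phi x) /\ integral_points Gs h) (integral_points Gs).

Let U (x : 'cV[int]_n) : 'M[rat]_N := phi (x, 0).
Let T (j : int) : 'M[rat]_N := phi (0, j).
Let g := T 1.

Let phi_unit x : phi x \in unitmx.
Proof. by case: (phi_points x). Qed.

Lemma semidirectE (x y : 'cV[int]_n) (i j : int) :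
  (((x, i) : semidirect uA) * ((y, j) : semidirect uA))%g
    = (x + mxexpz A i *m y, i + j) :> semidirect uA.
Proof. by []. Qed.

Let UD x y : U (x + y) = U x *m U y.
Proof. by rewrite -phiM semidirectE addr0 [mxexpz A 0]expr0 mul1mx. Qed.

Let gU x : g *m U x = U (A *m x) *m g.
Proof.
rewrite -!phiM !semidirectE [mxexpz A 0]expr0 mul1mx add0r !addr0 add0r.
by rewrite [mxexpz A 1]expr1.
Qed.

Let Uinj : injective U.
Proof. by move=> x y /phi_inj[]. Qed.

Lemma phi_decomp x j : phi (x, j) = U x *m T j.
Proof. by rewrite -phiM semidirectE mulmx0 addr0 add0r. Qed.

Let TD i j : T (i + j) = T i *m T j.
Proof. by rewrite -phiM semidirectE mulmx0 addr0. Qed.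

Let T0 : T 0 = 1%:M.
Proof. exact: (trans0 UD (fun x => phi_unit (x, 0))). Qed.

Let TX (i : nat) : T i = g ^+ i.
Proof.
elim: i => [|i IHi]; first by rewrite T0 expr0.
by rewrite intS addrC TD IHi exprSr.
Qed.

Variables (K : splittingFieldType rat) (iota : {rmorphism K -> algC}).
Hypothesis galK : galois 1 {:K}.
Local Notation QK := (in_alg K).
Local Notation gK := (map_mx QK g).

(** [eigen_log] for [g], extended to the whole group: translations commute with
    [ell], and the other factor is generated by [g]. *)
Lemma log_eigenvector (l : K) : l != 0 ->
    root (map_poly QK (char_poly (map_mx intr A))) l ->
  exists ell : 'M[K]_N, [/\ ell != 0, gK *m ell = l *: (ell *m gK)
    & forall x j, map_mx QK (phi (x, j)) *m ell = l ^ j *: (ell *m map_mx QK (phi (x, j)))].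
Proof.
move=> nz_l root_l.
have [ell [nz_ell g_ell U_ell]] := eigen_log uA hypA UD (fun x => phi_unit _) (phi_unit _) gU Uinj root_l.
exists ell; split=> // x j; rewrite phi_decomp map_mxM -mulmxA.
suff -> : map_mx QK (T j) *m ell = l ^ j *: (ell *m map_mx QK (T j)).
  by rewrite -scalemxAr mulmxA U_ell mulmxA.
have TX_ell (i : nat) : map_mx QK (T i) *m ell = l ^+ i *: (ell *m map_mx QK (T i)).
  elim: i => [|i IHi]; first by rewrite T0 map_mx1 mul1mx mulmx1 expr0 scale1r.
  rewrite intS addrC TD map_mxM -mulmxA g_ell -scalemxAr mulmxA IHi.
  by rewrite -scalemxAl scalerA -mulmxA exprS.
case: j => i; first exact: TX_ell.
have uT : map_mx QK (T i.+1) \in unitmx by rewrite map_unitmx phi_unit.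
have TV : map_mx QK (T (Negz i)) = invmx (map_mx QK (T i.+1)).
  rewrite -[LHS](mulKmx uT) -map_mxM -TD NegzE subrr T0 map_mx1 mulmx1.
  by [].
rewrite TV NegzE -invr_expz; apply: (can_inj (mulKmx uT)).
rewrite mulKVmx // -scalemxAr mulmxA TX_ell -scalemxAl scalerA -mulmxA mulmxV // mulmx1.
by rewrite mulVf ?scale1r // expf_neq0.
Qed.

Section Point.
Variables (vs rs : seq K) (u : K) (d : nat).
Hypotheses (Uvs : uniq vs) (nz_vs : 0 \notin vs) (sub_rs : {subset rs <= vs}).
Hypothesis char_g : char_poly gK = \prod_(z <- rs) ('X - z%:P).
Hypothesis stab_vs : forall (s : gal_of {:K}) v, v \in vs -> s v \in vs.
Hypotheses (nz_u : u != 0) (Au : iota u \in Aint) (AVu : iota u^-1 \in Aint).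
Hypothesis Au1 : (iota u - 1) / d%:R \in Aint.
Hypothesis d_gt0 : (0 < d)%N.
Hypothesis int_proj : {in vs, forall v i j, d%:R * iota (spectral_proj gK vs v i j) \in Aint}.

Let charK : [pchar K] =i pred0.
Proof. by move=> p; rewrite (pchar_lalg K); apply: pchar_num. Qed.

Lemma twist_one_mod gam v : one_mod d (iota (twist u gam v)).
Proof.
rewrite rmorph_prod; apply: big_ind => [|x y|s _]; first exact: one_mod1.
  exact: one_modM.
have Gs_s : s \in 'Gal({:K} / 1)%g by rewrite (galT K) inE.
rewrite /= fmorphXz; have [nu Dnu] := aut_extend iota Gs_s.
apply: one_modXz; rewrite -?Dnu ?fmorph_eq0 // -?fmorphV ?Aint_aut //.
split; rewrite ?Aint_aut //.
have -> : (nu (iota u) - 1) / d%:R = nu ((iota u - 1) / d%:R).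
  by rewrite fmorph_div rmorphB rmorph1 rmorph_nat.
by rewrite Aint_aut.
Qed.

(** The Galois group permutes both the idempotents and the values of the twist, so it
    fixes the sum. *)
Lemma spectral_twist_rat gam :
  exists E : 'M[rat]_N, map_mx QK E = spectral_fun gK vs (twist u gam).
Proof.
set E := spectral_fun _ _ _.
have fixE (s : gal_of {:K}) : map_mx s E = E.
  rewrite /E raddf_sum -[RHS](perm_big _ (gal_perm Uvs stab_vs s)) big_map.
  apply: eq_bigr => v _; rewrite /= map_mxZ /= twist_gal; congr (_ *: _).
  rewrite (map_spectral_proj _ _ (gal_perm Uvs stab_vs s)); congr (spectral_proj _ _ _).
  by rewrite -map_mx_comp; apply: eq_map_mx => a /=; rewrite rmorph_alg.
have ratE i j : exists a : rat, E i j = ratr a.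
  by apply: (gal_rat_fixed galK) => s _; rewrite -[in RHS](fixE s) mxE.
have [f Df] := fin_all_exists (fun ij : 'I_N * 'I_N => ratE ij.1 ij.2).
exists (\matrix_(i, j) f (i, j)); apply/matrixP => i j.
by rewrite !mxE /= alg_num_field -(Df (i, j)).
Qed.

(** The matrix differs from the identity by the sum of the [(e v - 1) * proj v]; the
    factor [d] of [e v - 1] clears the denominators of the idempotents. *)
Lemma spectral_twist_int gam (E : 'M[rat]_N) :
  map_mx QK E = spectral_fun gK vs (twist u gam) -> exists H : 'M[int]_N, E = map_mx intr H.
Proof.
move=> DE; have intE i j : exists a : int, E i j = a%:~R.
  have AE : ratr (E i j) \in Aint.
    have -> : ratr (E i j) = iota (map_mx QK E i j) by rewrite mxE /= alg_num_field fmorph_rat.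
    have -> : map_mx QK E = 1%:M + \sum_(v <- vs) (twist u gam v - 1) *: spectral_proj gK vs v.
      rewrite DE -[1%:M](spectral_proj_sum Uvs sub_rs char_g) -big_split.
      by apply: eq_bigr => v _ /=; rewrite scalerBl scale1r addrC subrK.
    rewrite mxE rmorphD rpredD //; first by rewrite mxE rmorph_nat Aint_Cnat.
    rewrite summxE rmorph_sum big_seq rpred_sum // => v vs_v; rewrite mxE rmorphM rmorphB rmorph1 /=.
    have nz_d : d%:R != 0 :> algC by rewrite pnatr_eq0 -lt0n.
    set x := iota (twist u gam v) - 1; set y := iota _.
    have -> : x * y = x / d%:R * (d%:R * y) by rewrite mulrA divfK.
    by rewrite rpredM ?int_proj //; case: (twist_one_mod gam v).
  have /intrP[a Da] : (ratr (E i j) : algC) \in Num.int by rewrite Cint_rat_Aint ?Crat_rat.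
  by exists a; apply: (fmorph_inj (ratr : {rmorphism rat -> algC})); rewrite /= Da ratr_int.
have [f Df] := fin_all_exists (fun ij : 'I_N * 'I_N => intE ij.1 ij.2).
exists (\matrix_(i, j) f (i, j)); apply/matrixP => i j.
by rewrite !mxE -(Df (i, j)).
Qed.

Lemma twistN gam v : twist u (fun v => - gam v) v = (twist u gam v)^-1.
Proof.
by rewrite /twist -prodfV; apply: eq_bigr => s _; rewrite invr_expz.
Qed.

(** The twist by [- gam] is the inverse matrix, and it is integral as well. *)
Lemma twist_unit gam (E : 'M[rat]_N) :
    map_mx QK E = spectral_fun gK vs (twist u gam) ->
  exists2 H : 'M[int]_N, H \in unitmx & E = map_mx intr H.
Proof.
move=> DE; have [H DH] := spectral_twist_int DE.
have [E' DE'] := spectral_twist_rat (fun v => - gam v).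
have [H' DH'] := spectral_twist_int DE'.
exists H => //; suff /mulmx1_unit[] : H *m H' = 1%:M by [].
apply/matrixP => i j; apply: (@intr_inj rat); apply: (fmorph_inj QK).
have : map_mx QK (E *m E') = 1%:M.
  rewrite map_mxM DE DE' [_ *m _](spectral_funM Uvs sub_rs char_g) // -[RHS](spectral_fun1 Uvs sub_rs char_g).
  by apply: eq_spectral_fun => v _; rewrite twistN mulfV // twist_neq0.
by rewrite DH DH' -map_mxM => /matrixP/(_ i j); rewrite !mxE !rmorph_nat.
Qed.

Lemma meval_in_alg (p : {mpoly rat[N * N]}) (M : 'M[rat]_N) :
  (map_mpoly QK p).@[fun k => mxvec (map_mx QK M) 0 k]
    = QK (map_mpoly ratr p).@[fun k => mxvec M 0 k].
Proof.
rewrite !meval_map_mmap; [|exact: fmorph_inj|exact: fmorph_inj].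
rewrite rmorph_mmap; apply: eq_bigr => m _; congr (_ * _).
  by rewrite -[RHS]/(QK (ratr _)) fmorph_rat -alg_num_field.
by apply: eq_bigr => k _; rewrite /= -map_mxvec mxE.
Qed.

(** [spectral_specialize] needs only that the twist respects multiplicative relations
    among the [vs]; those coming from two monomials of equal value are turned into
    integer exponents. *)
Lemma twist_point gam (E : 'M[rat]_N) : relation_additive vs gam ->
    map_mx QK E = spectral_fun gK vs (twist u gam) ->
  integral_points Gs E.
Proof.
move=> add_g DE; have unitE := twist_unit DE; split=> //; split.
  by have [H uH ->] := unitE; apply: intr_unitmx.
move=> p Gp; apply: (fmorph_inj QK).
apply: (etrans (esym (meval_in_alg p E))); rewrite rmorph0 DE.
apply: (spectral_specialize charK Uvs nz_vs sub_rs char_g).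
- exact: fmorph_inj.
- move=> m1 m2 E12; pose f (a : 'I_(size vs)) := vs`_a; pose c a : int := (m1 a)%:Z - (m2 a)%:Z.
  have vs_f a : f a \in vs by rewrite mem_nth.
  have nz_h (h : K -> K) m : {in vs, forall v, h v != 0} -> mmap1 (fun a => h (f a)) m != 0.
    by move=> nzh; apply/prodf_neq0 => a _; rewrite expf_neq0 ?nzh.
  have quot (h : K -> K) : {in vs, forall v, h v != 0} ->
      \prod_a h (f a) ^ c a = mmap1 (fun a => h (f a)) m1 / mmap1 (fun a => h (f a)) m2.
    move=> nzh; rewrite /mmap1 -prodf_div; apply: eq_bigr => a _.
    by rewrite expfzDr ?nzh // -invr_expz.
  have nz_v : {in vs, forall v : K, v != 0} by move=> v vs_v; apply: contraNneq nz_vs => <-.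
  have nz_tw : {in vs, forall v : K, twist u gam v != 0} by move=> v _; apply: twist_neq0.
  have rel_f : \prod_a f a ^ c a = 1.
    by have := quot id nz_v => ->; rewrite -E12 mulfV // (nz_h id).
  have := twist_relation Uvs nz_u stab_vs add_g (rel_fibers Uvs vs_f nz_vs rel_f).
  rewrite (prod_fibers _ Uvs vs_f nz_tw) (quot _ nz_tw) => E1.
  by rewrite -[LHS](divfK (nz_h _ m2 nz_tw)) E1 mul1r.
move=> i; have := meval_in_alg p (g ^+ i); rewrite map_mxX => ->.
by have [_ /(_ p Gp) p0] := phi_points (0, i%:Z); rewrite -TX -/(T i) p0 rmorph0.
Qed.

(** Two powers of the matrix [E] lie in the same coset of the image of [phi], so that
    some [E ^+ r] is [phi (y, j)].  This element acts on the eigenvector [ell] of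
    [log_eigenvector] by [l ^ j], and as a function of [g] it acts by
    [e a ^ r / e b ^ r] with [a = l * b] ([spectral_weight]). *)
Lemma twist_power gam : relation_additive vs gam ->
  exists (r : nat) (j : int), (0 < r)%N /\
    forall l, l \in vs -> root (map_poly QK (char_poly (map_mx intr A))) l ->
    twist u gam l ^+ r = l ^ j.
Proof.
move=> add_g; have [E DE] := spectral_twist_rat gam.
have EX i : integral_points Gs (E ^+ i).
  apply: (@twist_point (fun v => i%:Z * gam v + 0 * gam v)).
    exact: relation_additive_comb.
  rewrite map_mxX DE (spectral_funX Uvs sub_rs char_g); apply: eq_spectral_fun => v _.
  by rewrite twist_comb // expr0z mulr1 exprnP.
have uE : E \in unitmx by have [[]] := EX 1%N.
have [_ [s [int_s cov_s]]] := phi_index.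
have cov (i : 'I_(size s).+1) : exists k : 'I_(size s), exists x, invmx s`_k *m E ^+ i = phi x.
  have [h s_h [[x Dx] _]] := cov_s _ (EX i).
  have lt_h : (index h s < size s)%N by rewrite index_mem.
  by exists (Ordinal lt_h), x; rewrite /= nth_index.
have [f Df] := fin_all_exists cov.
have [|i1 [i2 [lt_i eq_f]]] := @ord_collision _ _ f; first by rewrite card_ord.
have [x1 D1] := Df i1; have [x2 D2] := Df i2; rewrite -eq_f in D2.
have us : s`_(f i1) \in unitmx by have [[]] := int_s _ (mem_nth 0 (ltn_ord (f i1))).
have uE1 := unitmxX i1 uE.
have [x Dx] : exists x, E ^+ (i2 - i1) = phi x.
  exists (x1^-1 * x2)%g; rewrite phiM -D2.
  have -> : phi (x1^-1)%g = invmx (invmx s`_(f i1) *m E ^+ i1).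
    rewrite D1 -[LHS](mulmxK (phi_unit x1)) -phiM mulVg.
    by rewrite [phi 1%g]T0 mul1mx.
  have uM : invmx s`_(f i1) *m E ^+ i1 \in unitmx by rewrite unitmx_mul unitmx_inv us.
  apply: (can_inj (mulKmx uM)); rewrite mulKVmx // -mulmxA; congr (_ *m _).
  by rewrite -[RHS](congr1 (fun k => E ^+ k) (subnKC (ltnW lt_i))) exprD.
case: x Dx => y j Dx; exists (i2 - i1)%N, j; split; first by rewrite subn_gt0.
move=> l vs_l root_l; have nz_l : l != 0 by apply: contraNneq nz_vs => <-.
have [ell [nz_ell g_ell phi_ell]] := log_eigenvector nz_l root_l.
have := phi_ell y j; rewrite -Dx map_mxX DE (spectral_funX Uvs sub_rs char_g) => E_ell.
have [a [b [vs_a vs_b Da eab]]] := spectral_weight Uvs sub_rs char_g nz_ell g_ell E_ell.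
(* [e a = e l * e b], as [a = l * b] and [e] respects this relation *)
suff tw_a : twist u gam a = twist u gam l * twist u gam b.
  apply: (mulIf (expf_neq0 (i2 - i1) (twist_neq0 nz_u gam b))).
  by rewrite -exprMn -tw_a eab.
(* the relation [a * l^-1 * b^-1 = 1], indexed by a finite type *)
pose fI (i : 'I_3) := [:: a; l; b]`_i; pose c (i : 'I_3) : int := [:: 1; -1; -1]`_i.
have vs_f i : fI i \in vs by rewrite /fI; case: i => -[|[|[|]]].
have nz_b : b != 0 by apply: contraNneq nz_vs => <-.
have rel_f : \prod_i fI i ^ c i = 1.
  by rewrite !big_ord_recl big_ord0 /fI /c /= Da !exprN1 expr1z; field; rewrite nz_l nz_b.
have nz_tw : {in vs, forall v : K, twist u gam v != 0} by move=> v _; apply: twist_neq0.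
have := twist_relation Uvs nz_u stab_vs add_g (rel_fibers Uvs vs_f nz_vs rel_f).
rewrite (prod_fibers _ Uvs vs_f nz_tw) !big_ord_recl big_ord0 /fI /c /= !exprN1 expr1z mulr1.
move/(canRL (mulfK _)) => ->; last by rewrite mulf_neq0 ?invr_eq0 ?nz_tw.
by rewrite mul1r invfM !invrK.
Qed.

End Point.
End ArithmeticPoints.

(** * From arithmeticity to a single unit *)

Lemma Aint_scale_seq (xs : seq algC) :
  exists2 d : nat, (0 < d)%N & {in xs, forall x, d%:R * x \in Aint}.
Proof.
elim: xs => [|x xs [d d_gt0 Ad]]; first by exists 1%N.
have [e e_gt0 Ae] := Aint_scale x; exists (d * e)%N; first by rewrite muln_gt0 d_gt0.
move=> y; rewrite in_cons natrM => /predU1P[->|/Ad Ay].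
  by rewrite -mulrA rpredM // Aint_Cnat.
by rewrite mulrAC mulrC rpredM // Aint_Cnat.
Qed.

Lemma char_poly_root0 (F : fieldType) n (M : 'M[F]_n) : M \in unitmx -> ~~ root (char_poly M) 0.
Proof.
move=> uM; rewrite -eigenvalue_root_char; apply/negP => /eigenvalueP[v vM].
by rewrite scale0r in vM; rewrite -(mulmxK uM v) vM mul0mx eqxx.
Qed.

Section UnitNorm.
Variables (K : splittingFieldType rat) (iota : {rmorphism K -> algC}).
Hypothesis galK : galois 1 {:K}.

Lemma unit_norm (x : K) : x != 0 -> iota x \in Aint -> iota x^-1 \in Aint ->
  (\prod_(s : gal_of {:K}) iota (s x)) ^+ 2 = 1.
Proof.
move=> nz_x Ax AVx; have [a Da] := galNorm_int galK Ax; have [b Db] := galNorm_int galK AVx.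
have ab1 : a * b = 1.
  apply: (@intr_inj algC); rewrite rmorphM /= -Da -Db -big_split big1 // => s _.
  by rewrite /= -rmorphM -rmorphM mulfV // !rmorph1.
have -> : \prod_(s : gal_of {:K}) iota (s x) = a%:~R.
  by rewrite -Da (galT K); apply: eq_bigl => s; rewrite inE.
by rewrite expr2 -rmorphM (int_unit_square ab1).
Qed.

End UnitNorm.

Section Dependence.
Variables (K : splittingFieldType rat) (iota : {rmorphism K -> algC}).
Variables (vs ls : seq K) (u : K).
Hypotheses (Uvs : uniq vs) (nz_vs : 0 \notin vs) (nz_u : u != 0).
Hypothesis stab_vs : forall (s : gal_of {:K}) v, v \in vs -> s v \in vs.
Hypothesis stab_ls : forall (s : gal_of {:K}) l, l \in ls -> s l \in ls.
Hypothesis sub_ls : {subset ls <= vs}.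
Hypothesis norm_ls : {in ls, forall l, (\prod_(s : gal_of {:K}) s l) ^+ 2 = 1}.
Hypothesis norm_u : `|\prod_(s : gal_of {:K}) iota (s u)| = 1.
Hypothesis lt_u : forall s : gal_of {:K}, {in ls, forall l, s l = l} \/ `|iota (s u)| < 1.
Hypothesis torsion_free_ls : forall l (m : int), l \in ls -> l ^ m = 1 -> m = 0.
Hypothesis power : forall gam, relation_additive vs gam ->
  exists (r : nat) (j : int), (0 < r)%N /\ {in ls, forall l, twist u gam l ^+ r = l ^ j}.

Let tw_eq1 gam l : relation_additive vs gam -> l \in ls -> twist u gam l = 1 -> gam l = 0.
Proof. by apply: (@twist_eq1 K iota vs ls u). Qed.

(** The exponents of the eigenvalues over a multiplicatively independent family give
    homomorphisms [C^~ j], and a power of each of their twists maps all [l] in [ls] to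
    powers of [l] with a common exponent.  So a combination of two of them has
    trivial twist, hence vanishes on [ls]
    ([twist_eq1]): the exponent vectors of any two eigenvalues are proportional. *)
Lemma pairwise_dependent : {in ls &, forall l l1,
  exists (p : nat) (q : int), (0 < p)%N /\ l ^ p = l1 ^ q}.
Proof.
have [bs [M [C [M_gt0 nz_bs ind_bs powM]]]] := exponent_basis nz_vs.
have addC j : (j < size bs)%N -> relation_additive vs (C^~ j).
  exact: exponent_additive nz_bs ind_bs powM.
have nz l : l \in ls -> l != 0 by move=> /sub_ls vs_l; apply: contraNneq nz_vs => <-.
have nzC l : l \in ls -> ~ (forall j, (j < size bs)%N -> C l j = 0).
  move=> ls_l C0; suff : M%:Z = 0 by move=> [M0]; rewrite M0 in M_gt0.
  apply: (torsion_free_ls ls_l); rewrite powM ?sub_ls // big_nat big1 // => j lt_j.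
  by rewrite C0 ?expr0z //; case/andP: lt_j.
move=> l l1 ls_l ls_l1.
have [[j0 [r0 [z0 [lt_j0 [r0_gt0 [nz_z0 pow0]]]]]]|no_z] := classic (exists j0 (r0 : nat) (z0 : int),
    [/\ (j0 < size bs)%N, (0 < r0)%N & z0 != 0 /\ {in ls, forall l, twist u (C^~ j0) l ^+ r0 = l ^ z0}]).
- have rel j : (j < size bs)%N -> exists (r : nat) (z : int), (0 < r)%N /\
      {in ls, forall y, z0 * r%:Z * C y j = z * r0%:Z * C y j0}.
    move=> lt_j; have [r [z [r_gt0 powj]]] := power (addC j lt_j).
    exists r, z; split=> // y ls_y; apply/eqP; rewrite -subr_eq0 -mulNr; apply/eqP.
    apply: (tw_eq1 (relation_additive_comb (z0 * r%:Z) (- (z * r0%:Z)) (addC j lt_j) (addC j0 lt_j0))) => //.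
    rewrite twist_comb // [z0 * _]mulrC [z * _]mulrC -mulrN -!exprz_exp -!exprnP.
    by rewrite powj // pow0 // !exprz_exp -expfzDr ?nz // mulrN [z0 * _]mulrC subrr expr0z.
  have nz_zr (r : nat) : (0 < r)%N -> z0 * r%:Z != 0.
    by move=> r_gt0; rewrite mulf_neq0 // eqz_nat -lt0n.
  have prop j : (j < size bs)%N -> C l j * C l1 j0 = C l1 j * C l j0.
    move=> lt_j; have [r [z [r_gt0 relj]]] := rel j lt_j.
    apply: (mulfI (nz_zr r r_gt0)); rewrite mulrA relj // [RHS]mulrA relj // -!mulrA.
    by congr (_ * (_ * _)); rewrite mulrC.
  have nz0 y : y \in ls -> C y j0 != 0.
    move=> ls_y; apply/negP => /eqP C0; apply: (nzC y ls_y) => j lt_j.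
    have [r [z [r_gt0 relj]]] := rel j lt_j.
    by apply: (mulfI (nz_zr r r_gt0)); rewrite relj // C0 !mulr0.
  exists (M * `|C l1 j0|)%N, (M%:Z * (C l j0 * sgz (C l1 j0))).
  split; first by rewrite muln_gt0 M_gt0 absz_gt0 nz0.
  rewrite PoszM abszEsg -[l ^ _]exprz_exp -[RHS]exprz_exp !powM ?sub_ls // !expz_prod big_nat [RHS]big_nat.
  apply: eq_bigr => j lt_j; rewrite !exprz_exp; congr (_ ^ _).
  by rewrite mulrCA prop //; ring.
(* if all these powers are trivial, so are all exponents of [l] *)
case: (nzC l ls_l) => j lt_j; have [r [z [r_gt0 powj]]] := power (addC j lt_j).
have z_eq0 : z = 0.
  by apply/eqP; apply/negPn/negP => nz_z; case: no_z; exists j, r, z.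
have : r%:Z * C l j + 0 * C l j = 0.
  apply: (tw_eq1 (relation_additive_comb r%:Z 0 (addC j lt_j) (addC j lt_j))) => //.
  by rewrite twist_comb // expr0z mulr1 -exprnP powj // z_eq0 expr0z.
by rewrite mul0r addr0 => /eqP; rewrite mulf_eq0 eqz_nat gtn_eqF //= => /eqP.
Qed.

End Dependence.

Lemma monic_split (p : {poly algC}) : p \is monic ->
  exists rs, p = \prod_(z <- rs) ('X - z%:P).
Proof.
move=> mon_p; have [rs Dp] := closed_field_poly_normal p; exists rs.
by rewrite Dp (monicP mon_p) scale1r.
Qed.

Lemma lift_seq (K : eqType) (T : eqType) (f : K -> T) (s : seq K) (zs : seq T) :
  {subset zs <= map f s} -> exists ys, zs = map f ys.
Proof.
elim: zs => [|z zs IHzs] sub_zs; first by exists [::].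
have [ys ->] := IHzs (fun y zs_y => sub_zs y (mem_behead (s := z :: zs) zs_y)).
by have /mapP[y _ ->] := sub_zs z (mem_head _ _); exists (y :: ys).
Qed.

(** Everything takes place in a Galois number field [K] that contains the eigenvalues
    of [g] and of [A] and the unit [u].  The integer [d] is a common denominator of
    the idempotents of [g]; the unit depends on [d], and [K] on the unit, so [d] is
    found over the algebraic numbers and the data are then moved to [K]. *)
Lemma arithmetic_unit n (A : 'M[int]_n) (uA : A \in unitmx) (hypA : hyperbolic A)
    (realA : real_eigenvalues A) (m : nat) (lambda : 'I_m -> algC) :
    (forall i, eigenvalue (map_mx intr A) (lambda i)) -> (0 < m)%N ->
    arithmetic (semidirect uA : groupType) ->
  powers_of_quadratic_unit lambda.
Proof.
move=> eig_lambda m_gt0 [[|N'] [Gs [phi [_ phi_inj phiM phi_points [_ phi_index]]]]].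
  (* there is no embedding in matrices of size 0 *)
  have := phi_inj (0, 0) (0, 1) (etrans (flatmx0 _) (esym (flatmx0 _))).
  by move/(congr1 snd)/eqP; rewrite eq_sym oner_eq0.
pose AQ : 'M[rat]_n := map_mx intr A; pose AC : 'M[algC]_n := map_mx intr A.
pose g : 'M[rat]_N'.+1 := phi (0, 1); pose gC : 'M[algC]_N'.+1 := map_mx ratr g.
have DAC : map_mx ratr AQ = AC.
  by rewrite -map_mx_comp; apply: eq_map_mx => a /=; rewrite ratr_int.
have [rsA DrsA] := monic_split (char_poly_monic AC).
have [rsg Drsg] := monic_split (char_poly_monic gC).
have mem_rsA z : (z \in rsA) = eigenvalue AC z.
  by rewrite eigenvalue_root_char DrsA root_prod_XsubC.
pose vsC := undup (rsg ++ rsA).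
pose entries := flatten [seq [seq spectral_proj gC vsC v ij.1 ij.2 | ij : 'I_N'.+1 * 'I_N'.+1] | v <- vsC].
have [d d_gt0 int_entries] := Aint_scale_seq entries.
have real_rsA : {in rsA, forall z, z \is Num.real}.
  by move=> z; rewrite mem_rsA; apply: realA.
have [uC nz_uC [AuC AVuC AuC1 lt_uC]] : exists2 u : algC, u != 0 &
  [/\ u \in Aint, u^-1 \in Aint, (u - 1) / d%:R \in Aint
    & forall nu : {rmorphism algC -> algC}, {in rsA, forall z, nu z = z} \/ `|nu u| < 1].
  by apply: (@dominant_unit (char_poly AQ)) => //; rewrite map_char_poly DAC.
have [pu [Dpu mon_pu] _] := minCpolyP uC.
pose pF := char_poly g * char_poly AQ * pu.
have mon_pF : pF \is monic by rewrite !rpredM ?char_poly_monic.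
have mon_pFC : map_poly (ratr : rat -> algC) pF \is monic by rewrite map_monic.
have [rsF DrsF] := monic_split mon_pFC.
have [K galK [iota [s Ds _]]] := splitting_num_field DrsF.
have root_pF z : root (char_poly gC) z || root (char_poly AC) z || root (map_poly ratr pu) z ->
    z \in map iota s.
  rewrite Ds -root_prod_XsubC -DrsF !rmorphM !rootM /= map_char_poly -/gC map_char_poly DAC.
  by [].
have [ysg Dysg] : exists ys, rsg = map iota ys.
  apply: (@lift_seq _ _ _ s) => z; rewrite -root_prod_XsubC -Drsg => rz.
  by rewrite root_pF ?rz.
have [ysA DysA] : exists ys, rsA = map iota ys.
  apply: (@lift_seq _ _ _ s) => z; rewrite -root_prod_XsubC -DrsA => rz.
  by rewrite root_pF ?rz ?orbT.
have [u Du] : exists u, uC = iota u.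
  have /mapP[u _ Du] : uC \in map iota s; last by exists u.
  by rewrite root_pF // -Dpu root_minCpoly !orbT.
pose QK := in_alg K; pose gK := map_mx QK g.
have iota_QK (a : rat) : iota (QK a) = ratr a by rewrite /QK /= alg_num_field fmorph_rat.
have iota_gK : map_mx iota gK = gC.
  by apply/matrixP => i j; rewrite !mxE iota_QK.
have char_gK : char_poly gK = \prod_(z <- ysg) ('X - z%:P).
  apply: (map_poly_inj iota); rewrite map_char_poly iota_gK Drsg Dysg big_map rmorph_prod.
  by apply: eq_bigr => z _; rewrite /= map_polyXsubC.
have char_AK : map_poly QK (char_poly AQ) = \prod_(z <- ysA) ('X - z%:P).
  apply: (map_poly_inj iota); rewrite -map_poly_comp (eq_map_poly (g := ratr)) //.
  rewrite map_char_poly DAC DrsA DysA big_map rmorph_prod.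
  by apply: eq_bigr => z _; rewrite /= map_polyXsubC.
pose vs := undup (ysg ++ ysA).
have Uvs : uniq vs by apply: undup_uniq.
have map_vs : map iota vs = vsC.
  by rewrite /vs /vsC Dysg DysA -map_cat undup_map_inj //; apply: fmorph_inj.
have mem_ysg y : (y \in ysg) = root (char_poly gK) y by rewrite char_gK root_prod_XsubC.
have mem_ysA y : (y \in ysA) = root (map_poly QK (char_poly AQ)) y by rewrite char_AK root_prod_XsubC.
have gal_QK (t : gal_of {:K}) (a : rat) : t (QK a) = QK a by rewrite /QK /= rmorph_alg.
have stab_ysA (t : gal_of {:K}) y : y \in ysA -> t y \in ysA.
  rewrite !mem_ysA -(fmorph_root (t : {rmorphism K -> K})) -map_poly_comp.
  by rewrite (eq_map_poly (g := QK)) // => a; apply: gal_QK.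
have stab_ysg (t : gal_of {:K}) y : y \in ysg -> t y \in ysg.
  rewrite !mem_ysg -(fmorph_root (t : {rmorphism K -> K})) map_char_poly.
  rewrite (_ : map_mx _ gK = gK) //; apply/matrixP => i j; rewrite !mxE; exact: gal_QK.
have stab_vs (t : gal_of {:K}) v : v \in vs -> t v \in vs.
  rewrite !mem_undup !mem_cat => /orP[/stab_ysg->//|/stab_ysA->]; exact: orbT.
have sub_ysA : {subset ysA <= vs} by move=> y ys_y; rewrite mem_undup mem_cat ys_y orbT.
have sub_ysg : {subset ysg <= vs} by move=> y ys_y; rewrite mem_undup mem_cat ys_y.
have uAQ : AQ \in unitmx.
  exact: intr_unitmx.
have ug : g \in unitmx by case: (phi_points (0, 1)).
have nz_vs : 0 \notin vs.
  rewrite mem_undup mem_cat negb_or mem_ysg mem_ysA char_poly_root0 ?map_unitmx //=.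
  by rewrite map_char_poly char_poly_root0 ?map_unitmx.
have nz_ysA l : l \in ysA -> l != 0.
  by move/sub_ysA => vs_l; apply: contraNneq nz_vs => <-.
have Aint_eig (B : 'M[int]_n) z : eigenvalue (map_mx intr B) z -> z \in Aint.
  rewrite eigenvalue_root_char -map_char_poly => rz; apply: root_monic_Aint rz _ _.
    by rewrite monicE lead_coef_map_inj ?rmorph0 ?(monicP (char_poly_monic _)) //; apply: intr_inj.
  by apply/polyOverP => i; rewrite coef_map intr_int.
have eig_ysA l : l \in ysA -> eigenvalue AC (iota l).
  by move=> ys_l; rewrite -mem_rsA DysA map_f.
have Al : {in ysA, forall l, iota l \in Aint} by move=> l /eig_ysA; apply: Aint_eig.
have AVl : {in ysA, forall l, iota l^-1 \in Aint}.
  move=> l ys_l; apply: (@Aint_eig (invmx A)); have /eigenvalueP[v vA nz_v] := eig_ysA l ys_l.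
  have invA : AC *m map_mx intr (invmx A) = 1%:M by rewrite -map_mxM mulmxV // map_mx1.
  apply/eigenvalueP; exists v => //; rewrite fmorphV.
  have nz_l : iota l != 0 by rewrite fmorph_eq0 nz_ysA.
  apply: (scalerI nz_l); rewrite scalemxAl -vA -mulmxA invA mulmx1 scalerA mulfV //.
  by rewrite scale1r.
have norm_l l : l \in ysA -> `|iota l| != 1 by move=> /eig_ysA; apply: hypA.
have real_l : {in ysA, forall l, iota l \is Num.real} by move=> l /eig_ysA; apply: realA.
have nz_u : u != 0 by rewrite -(fmorph_eq0 iota) -Du.
have int_proj : {in vs, forall v i j, d%:R * iota (spectral_proj gK vs v i j) \in Aint}.
  move=> v vs_v i j; apply: int_entries; apply/flatten_mapP; exists (iota v).
    by rewrite -map_vs map_f.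
  apply/imageP; exists (i, j) => //=.
  have := map_spectral_proj gK v (_ : perm_eq (map iota vs) vsC); rewrite map_vs => /(_ (perm_refl _)).
  by rewrite iota_gK => <-; rewrite mxE.
have dep : {in ysA &, forall l l1, exists (p : nat) (q : int), (0 < p)%N /\ l ^ p = l1 ^ q}.
  apply: (@pairwise_dependent K iota vs ysA u) => //.
  - move=> l ys_l; apply: (fmorph_inj iota); rewrite rmorphXn rmorph_prod /= rmorph1.
    by apply: unit_norm => //; [apply: nz_ysA | apply: Al | apply: AVl].
  - have Nu : (\prod_(t : gal_of {:K}) iota (t u)) ^+ 2 = 1.
      by apply: unit_norm => //; rewrite ?fmorphV -Du.
    by apply/eqP; rewrite -(@pexpr_eq1 _ _ 2) // -normrX Nu normr1.
  - move=> t; have [|nu Dnu] := aut_extend iota (_ : t \in 'Gal({:K} / 1)%g); first by rewrite (galT K) inE.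
    have [fix_nu|lt1] := lt_uC nu; [left=> l ys_l | by right; rewrite -Dnu -Du].
    by apply: (fmorph_inj iota); rewrite -Dnu fix_nu // DysA map_f.
  - by move=> l k; apply: (@torsion_free K iota ysA).
  move=> gam add_g.
  have [r [j [r_gt0 pow]]] : exists (r : nat) (j : int), (0 < r)%N /\
      forall l, l \in vs -> root (map_poly QK (char_poly AQ)) l -> twist u gam l ^+ r = l ^ j.
    apply: (@twist_power n A uA hypA N' Gs phi phi_inj phiM phi_points phi_index
              K iota galK vs ysg u d) => //; rewrite ?fmorphV -?Du //.
  exists r, j; split=> // l ys_l; apply: pow; first exact: sub_ysA.
  by rewrite -mem_ysA.
have lam_ys i : exists2 l, l \in ysA & lambda i = iota l.
  have : lambda i \in map iota ysA by rewrite -DysA mem_rsA.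
  by case/mapP => l ys_l ->; exists l.
have [l1 ys_l1 _] := lam_ys (Ordinal m_gt0).
apply: (@dependent_quadratic K iota galK ysA) ys_l1 lam_ys => //.
by apply: contra nz_vs; apply: sub_ysA.
Qed.

(** * Conditions defined by polynomial equations *)

Section PolyMaps.
Variable N : nat.

Local Notation mxfun a b := (forall K : numFieldType, 'M[K]_N -> 'M[K]_(a, b)).

Definition peval (p : {mpoly rat[N * N]}) (K : numFieldType) (g : 'M[K]_N) : K :=
  (map_mpoly (ratr : rat -> K) p).@[fun k => mxvec g 0 k].

(** A function of a matrix given by one polynomial with rational coefficients over all
    fields, so that a condition can be shown to define the same closed set over the
    rationals and over the algebraic numbers. *)
Definition polymap (f : forall K : numFieldType, 'M[K]_N -> K) :=
  exists p, forall (K : numFieldType) (g : 'M[K]_N), peval p g = f K g.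

Definition polymx a b (F : mxfun a b) :=
  forall i j, polymap (fun K g => F K g i j).

Definition closed_cond (P : forall K : numFieldType, 'M[K]_N -> Prop) :=
  exists G : seq {mpoly rat[N * N]}, forall (K : numFieldType) (g : 'M[K]_N),
    (forall p, p \in G -> peval p g = 0) <-> P K g.

Lemma polymap_const (c : rat) : polymap (fun K _ => ratr c).
Proof. by exists c%:MP => K g; rewrite /peval map_mpolyC mevalC. Qed.

Lemma polymapD f1 f2 : polymap f1 -> polymap f2 -> polymap (fun K g => f1 K g + f2 K g).
Proof.
by move=> [p1 D1] [p2 D2]; exists (p1 + p2) => K g; rewrite -D1 -D2 /peval rmorphD mevalD.
Qed.

Lemma polymapN f : polymap f -> polymap (fun K g => - f K g).
Proof. by move=> [p D]; exists (- p) => K g; rewrite -D /peval rmorphN mevalN. Qed.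

Lemma polymapM f1 f2 : polymap f1 -> polymap f2 -> polymap (fun K g => f1 K g * f2 K g).
Proof.
by move=> [p1 D1] [p2 D2]; exists (p1 * p2) => K g; rewrite -D1 -D2 /peval rmorphM mevalM.
Qed.

Lemma eq_polymap f1 f2 : (forall (K : numFieldType) (g : 'M[K]_N), f1 K g = f2 K g) -> polymap f1 -> polymap f2.
Proof. by move=> E [p D]; exists p => K g; rewrite D. Qed.

Lemma polymap_sum (I : finType) (f : I -> forall K : numFieldType, 'M[K]_N -> K) :
  (forall i, polymap (f i)) -> polymap (fun K g => \sum_i f i K g).
Proof.
move=> Pf; elim: (index_enum I) => [|i r IHr].
  by apply: eq_polymap (polymap_const 0) => K g; rewrite big_nil rmorph0.
by apply: eq_polymap (polymapD (Pf i) IHr) => K g; rewrite big_cons.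
Qed.

Lemma polymx_id : polymx (fun K g => g).
Proof.
move=> i j; exists 'X_(mxvec_index i j) => K g.
by rewrite /peval map_mpolyX mevalXU mxvecE.
Qed.

Lemma polymx_const a b (C : 'M[rat]_(a, b)) : polymx (fun K _ => map_mx ratr C).
Proof.
by move=> i j; apply: eq_polymap (polymap_const (C i j)) => K g; rewrite mxE.
Qed.

Lemma polymxD a b (F1 F2 : mxfun a b) :
  polymx F1 -> polymx F2 -> polymx (fun K g => F1 K g + F2 K g).
Proof.
move=> P1 P2 i j; apply: eq_polymap (polymapD (P1 i j) (P2 i j)) => K g.
by rewrite mxE.
Qed.

Lemma polymxN a b (F : mxfun a b) :
  polymx F -> polymx (fun K g => - F K g).
Proof. by move=> P i j; apply: eq_polymap (polymapN (P i j)) => K g; rewrite mxE. Qed.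

Lemma polymxM a b c (F1 : mxfun a b)
    (F2 : mxfun b c) :
  polymx F1 -> polymx F2 -> polymx (fun K g => F1 K g *m F2 K g).
Proof.
move=> P1 P2 i j.
apply: eq_polymap (polymap_sum (fun k => polymapM (P1 i k) (P2 k j))) => K g.
by rewrite mxE.
Qed.

Lemma polymxZ a b f (F : mxfun a b) :
  polymap f -> polymx F -> polymx (fun K g => f K g *: F K g).
Proof. by move=> pf P i j; apply: eq_polymap (polymapM pf (P i j)) => K g; rewrite mxE. Qed.

Lemma polymxX a (F : mxfun a a) k :
  polymx F -> polymx (fun K g => F K g ^+ k).
Proof.
move=> P; elim: k => [|k IHk].
  move=> i j; apply: eq_polymap (polymx_const (1%:M : 'M[rat]_a) i j) => K g.
  by rewrite map_mx1 expr0.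
by move=> i j; apply: eq_polymap (polymxM P IHk i j) => K g; rewrite exprS.
Qed.

Lemma closed_cond_mx a b (F : mxfun a b) :
  polymx F -> closed_cond (fun K g => F K g = 0).
Proof.
move=> P; have [p Dp] := fin_all_exists (fun ij : 'I_a * 'I_b => P ij.1 ij.2).
exists [seq p ij | ij : 'I_a * 'I_b] => K g; split=> [p0|F0 _ /imageP[ij _ ->]].
  by apply/matrixP => i j; rewrite mxE -(Dp (i, j)) p0 ?image_f.
by rewrite Dp F0 mxE.
Qed.

Lemma closed_cond_map f : polymap f -> closed_cond (fun K g => f K g = 0).
Proof.
by case=> p Dp; exists [:: p] => K g; split=> [p0|f0 q /[!inE]/eqP->]; rewrite -?Dp ?p0 ?inE // Dp.
Qed.

Lemma closed_cond_and P1 P2 : closed_cond P1 -> closed_cond P2 ->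
  closed_cond (fun K g => P1 K g /\ P2 K g).
Proof.
move=> [G1 D1] [G2 D2]; exists (G1 ++ G2) => K g; split=> [p0|[/D1 p1 /D2 p2] p].
  by split; [apply/D1 | apply/D2] => p Gp; apply: p0; rewrite mem_cat Gp ?orbT.
by rewrite mem_cat => /orP[]; [apply: p1 | apply: p2].
Qed.

Lemma closed_cond_forall (I : finType) (P : I -> forall K : numFieldType, 'M[K]_N -> Prop) :
  (forall i, closed_cond (P i)) -> closed_cond (fun K g => forall i, P i K g).
Proof.
move=> /fin_all_exists[G DG]; exists (flatten [seq G i | i : I]) => K g; split=> [p0 i|Pg p].
  by apply/DG => p Gp; apply: p0; apply/flattenP; exists (G i); rewrite ?image_f.
by case/flattenP => _ /imageP[i _ ->]; apply: (proj2 (DG i K g) (Pg i)).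
Qed.

Lemma eq_closed_cond P1 P2 : (forall (K : numFieldType) (g : 'M[K]_N), P1 K g <-> P2 K g) ->
  closed_cond P1 -> closed_cond P2.
Proof. by move=> E [G D]; exists G => K g; apply: iff_trans (D K g) (E K g). Qed.

(** Membership of a rational point can be tested over the algebraic numbers, where the
    group law is known. *)
Lemma points_ratr (G : seq {mpoly rat[N * N]}) (K : numFieldType) (h : 'M[rat]_N) :
  points G h <-> points G (map_mx (ratr : rat -> K) h).
Proof.
rewrite /points map_unitmx.
have ev p : peval p (map_mx (ratr : rat -> K) h) = ratr (peval p h).
  rewrite /peval !meval_map_mmap; [|exact: fmorph_inj|exact: fmorph_inj].
  rewrite (rmorph_mmap (ratr : {rmorphism rat -> K})); apply: eq_bigr => m _; congr (_ * _).
    by rewrite /= fmorph_rat.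
  by apply: eq_bigr => k _; rewrite /= -map_mxvec mxE.
split=> -[uh p0]; split=> // p Gp.
  exact: etrans (ev p) (etrans (congr1 ratr (p0 p Gp)) (rmorph0 _)).
apply: (fmorph_inj (ratr : {rmorphism rat -> K})); rewrite rmorph0.
exact: etrans (esym (ev p)) (p0 p Gp).
Qed.

End PolyMaps.

(** * The norm one torus of a real quadratic order *)

Section Torus.
Variables (R : comPzRingType) (t : R).

(* Multiplication by [a + b e] on the basis [1, e], where [e ^+ 2 = t * e - 1]. *)
Definition quad_mx (a b : R) : 'M[R]_2 :=
  \matrix_(i, j) (if i == 0 then (if j == 0 then a else - b)
                  else (if j == 0 then b else a + t * b)).

Definition quad_norm (a b : R) := a ^+ 2 + t * a * b + b ^+ 2.

Lemma quad_mxM a b a' b' :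
  quad_mx a b *m quad_mx a' b' = quad_mx (a * a' - b * b') (a * b' + b * a' + t * b * b').
Proof.
apply/matrixP => i j; rewrite !mxE !big_ord_recl big_ord0 !mxE /=.
by case: i => -[|[|i]] // hi; case: j => -[|[|j]] // hj; rewrite /= -?[lift _ _]/(lift 0 0) /=; ring.
Qed.

Lemma quad_normM a b a' b' :
  quad_norm (a * a' - b * b') (a * b' + b * a' + t * b * b') = quad_norm a b * quad_norm a' b'.
Proof. by rewrite /quad_norm; ring. Qed.

Lemma quad_mx1 : quad_mx 1 0 = 1%:M.
Proof.
apply/matrixP => i j; rewrite !mxE.
by case: i => -[|[|i]] // hi; case: j => -[|[|j]] // hj; rewrite /= ?oppr0 ?mulr0 ?addr0.
Qed.

Lemma quad_mxV a b : quad_norm a b = 1 -> quad_mx a b *m quad_mx (a + t * b) (- b) = 1%:M.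
Proof.
move=> Nab; rewrite quad_mxM -quad_mx1; congr (quad_mx _ _); last by ring.
by rewrite -Nab /quad_norm; ring.
Qed.

Lemma quad_normV a b : quad_norm (a + t * b) (- b) = quad_norm a b.
Proof. by rewrite /quad_norm; ring. Qed.

End Torus.

Lemma map_quad_mx (R S : comPzRingType) (f : {rmorphism R -> S}) t a b :
  map_mx f (quad_mx t a b) = quad_mx (f t) (f a) (f b).
Proof.
apply/matrixP => i j; rewrite !mxE.
by case: ifP => _; case: ifP => _; rewrite ?rmorphN ?rmorphD ?rmorphM.
Qed.

Section TorusInt.
Variable t : int.
Hypothesis t_ge3 : 3 <= t.
Local Notation E := (quad_mx t 0 1).

Lemma quad_gen_unit : E \in unitmx.
Proof.
have N1 : quad_norm t 0 1 = 1 by rewrite /quad_norm; ring.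
by case/mulmx1_unit: (quad_mxV N1).
Qed.

Lemma quad_step a b : E *m quad_mx t a b = quad_mx t (- b) (a + t * b).
Proof. by rewrite quad_mxM; congr (quad_mx _ _ _); ring. Qed.

(** Descent: if both coordinates are nonzero they have opposite signs, and
    multiplication by [e] or by its inverse decreases [|a| + |b|], since the norm
    equation bounds the new coordinate by the old ones. *)
Lemma torus_cyclic a b : quad_norm t a b = 1 ->
  exists (e j : int), (e = 1 \/ e = -1) /\ quad_mx t a b = e *: mxexpz E j.
Proof.
have [k] := ubnP (`|a| + `|b|)%N; elim: k a b => // k IHk a b le_k Nab.
have uE := quad_gen_unit.
have quad_mx_scal c : quad_mx t c 0 = c%:M.
  by rewrite -[LHS]mulmx1 -(quad_mx1 t) quad_mxM -[RHS]scalemx1 -(quad_mx1 t);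
    apply/matrixP => i j; rewrite !mxE; case: ifP => _; case: ifP => _; ring.
have up : (`|(- b)%R| + `|(a + t * b)%R| < k)%N -> exists (e j : int),
    (e = 1 \/ e = -1) /\ quad_mx t a b = e *: mxexpz E j.
  move=> lt_k; have [|e [j [e1 Dj]]] := IHk (- b) (a + t * b) lt_k.
    by rewrite -Nab /quad_norm; ring.
  exists e, (-1 + j); split=> //; rewrite mxexpzD // scalemxAr -Dj -quad_step mulmxA.
  by rewrite -[X in _ *m X *m _]expr1 -[X in _ *m X *m _]/(mxexpz E 1) -mxexpzD // mul1mx.
have down : (`|(t * a + b)%R| + `|(- a)%R| < k)%N -> exists (e j : int),
    (e = 1 \/ e = -1) /\ quad_mx t a b = e *: mxexpz E j.
  move=> lt_k; have [|e [j [e1 Dj]]] := IHk (t * a + b) (- a) lt_k.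
    by rewrite -Nab /quad_norm; ring.
  exists e, (1 + j); split=> //; rewrite mxexpzD // scalemxAr -Dj [mxexpz E 1]expr1 quad_step.
  by congr (quad_mx _ _ _); ring.
have [b0|nz_b] := eqVneq b 0.
  exists a, 0; rewrite b0 quad_mx_scal [mxexpz _ 0]expr0 scalemx1; split=> //.
  have : a * a = 1 by rewrite -Nab b0 /quad_norm; ring.
  by clear; nia.
have [a0|nz_a] := eqVneq a 0.
  exists b, 1; rewrite [mxexpz _ 1]expr1 a0; split.
    have : b * b = 1 by rewrite -Nab a0 /quad_norm; ring.
    by clear; nia.
  apply/matrixP => i j; rewrite !mxE; case: ifP => _; case: ifP => _; ring.
have {}Nab : a * a + t * a * b + b * b = 1 by rewrite -Nab /quad_norm; ring.
have ab_lt0 : a * b < 0 by clear -Nab nz_b nz_a t_ge3; nia.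
(* if [x z = 1 - y^2] and [|y| < |x|] then [|z| < |x|] *)
have shrink (x y z : int) : y != 0 -> (`|y| < `|x|)%N -> x * z = 1 - y * y -> (`|z| < `|x|)%N.
  move=> nz_y lt_yx Dz; rewrite ltnNge; apply/negP => le_xz.
  have : (`|x| * `|z|)%N = (`|y| * `|y|).-1%N.
    rewrite -!abszM Dz; have : 0 < y * y by clear -nz_y; nia.
    by move: (y * y) => w; clear; lia.
  by have := leq_mul lt_yx lt_yx; have := leq_mul (leqnn `|x|%N) le_xz; clear; nia.
case: (ltngtP `|a|%N `|b|%N) => [lt_ab|lt_ba|eq_ab].
- apply: down; rewrite abszN addnC (leq_trans _ (le_k : `|a| + `|b| <= k)%N) // ltn_add2l.
  by apply: (shrink b a _ nz_a lt_ab); rewrite -Nab; ring.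
- apply: up; rewrite abszN addnC (leq_trans _ (le_k : `|a| + `|b| <= k)%N) // ltn_add2r.
  by apply: (shrink a b _ nz_b lt_ba); rewrite -Nab; ring.
have ba : b = - a by clear -eq_ab ab_lt0; nia.
by move: Nab; rewrite ba; clear -t_ge3; nia.
Qed.

End TorusInt.

Lemma map_mx_ratr_rat a b (M : 'M[rat]_(a, b)) : map_mx (ratr : rat -> rat) M = M.
Proof.
by apply/matrixP => i j; rewrite mxE -(fmorph_eq_rat (idfun : {rmorphism rat -> rat})).
Qed.

(** * The double centralizer of a semisimple matrix *)

Section DoubleCentralizer.
Variables (n : nat) (A : 'M[rat]_n).

(** The matrices that commute with every matrix commuting with [A].  For a semisimple
    [A] these are the polynomials in [A], but unlike that description this one is
    visibly given by linear equations with rational coefficients. *)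
Definition dcent (K : numFieldType) (B : 'M[K]_n) :=
  (B \in 'C('C(mxvec (map_mx (ratr : rat -> K) A))))%MS.

Lemma centP (K : fieldType) (C M : 'M[K]_n) :
  reflect (M *m C = C *m M) (C \in 'C(mxvec M))%MS.
Proof.
apply: (iffP cent_rowP) => [/(_ 0)|E i]; first by rewrite row_id mxvecK.
by rewrite ord1 row_id mxvecK.
Qed.

Lemma dcentP (K : numFieldType) (B : 'M[K]_n) :
  reflect (forall C, map_mx ratr A *m C = C *m map_mx ratr A -> C *m B = B *m C) (dcent B).
Proof.
by apply: (iffP cent_mxP) => H C /centP AC; apply: H.
Qed.

Lemma dcent_ratr (K : numFieldType) (B : 'M[rat]_n) : dcent (map_mx (ratr : rat -> K) B) = dcent B.
Proof.
rewrite /dcent [map_mx _ A in RHS]map_mx_ratr_rat -[mxvec (map_mx _ A)]map_mxvec -!map_cent_mx.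
exact: memmx_map.
Qed.

Lemma dcentM (K : numFieldType) (B1 B2 : 'M[K]_n) : dcent B1 -> dcent B2 -> dcent (B1 *m B2).
Proof.
move=> /dcentP d1 /dcentP d2; apply/dcentP => C AC.
by rewrite mulmxA d1 // -[LHS]mulmxA d2 // mulmxA.
Qed.

Lemma dcentV (K : numFieldType) (B : 'M[K]_n) : B \in unitmx -> dcent B -> dcent (invmx B).
Proof.
move=> uB /dcentP dB; apply/dcentP => C AC.
by apply: (can_inj (mulKmx uB)); rewrite mulKVmx // mulmxA -dB // mulmxK.
Qed.

Lemma dcent1 (K : numFieldType) : dcent (1%:M : 'M[K]_n).
Proof. by apply/dcentP => C _; rewrite mulmx1 mul1mx. Qed.

Lemma dcentD (K : numFieldType) (B1 B2 : 'M[K]_n) : dcent B1 -> dcent B2 -> dcent (B1 + B2).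
Proof.
move=> /dcentP d1 /dcentP d2; apply/dcentP => C AC.
by rewrite mulmxDr mulmxDl d1 ?d2.
Qed.

Lemma dcentZ (K : numFieldType) a (B : 'M[K]_n) : dcent B -> dcent (a *: B).
Proof.
by move=> /dcentP dB; apply/dcentP => C AC; rewrite -scalemxAr dB // scalemxAl.
Qed.

Lemma dcentX (K : numFieldType) k (B : 'M[K]_n) : dcent B -> dcent (B ^+ k).
Proof.
move=> dB; elim: k => [|k IHk]; first by rewrite expr0 dcent1.
by rewrite exprS dcentM.
Qed.

Lemma dcent_self : dcent A.
Proof.
by apply/dcentP => C; rewrite map_mx_ratr_rat.
Qed.

(** It is enough to commute with a rational basis of the centralizer of [A]. *)
Lemma closed_dcent N (F : forall K : numFieldType, 'M[K]_N -> 'M[K]_n) :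
  polymx F -> closed_cond (fun K g => dcent (F K g)).
Proof.
move=> PF; pose Z i := vec_mx (row i 'C(mxvec A)%MS).
have cZ i : closed_cond (fun (K : numFieldType) (g : 'M[K]_N) =>
    map_mx ratr (Z i) *m F K g + - (F K g *m map_mx ratr (Z i)) = 0).
  apply: closed_cond_mx; apply: polymxD; last apply: polymxN.
    by apply: polymxM => //; apply: polymx_const.
  by apply: polymxM => //; apply: polymx_const.
apply: eq_closed_cond (closed_cond_forall cZ) => K g; split=> [Zg|/cent_rowP Zg i].
  apply/cent_rowP => i; rewrite -map_mxvec -map_cent_mx -map_row -map_vec_mx.
  by apply/eqP; rewrite -subr_eq0; apply/eqP/Zg.
apply/eqP; rewrite subr_eq0; apply/eqP.
by have := Zg i; rewrite -map_mxvec -map_cent_mx -map_row -map_vec_mx.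
Qed.

Hypothesis ssA : diagonalizable (map_mx (ratr : rat -> algC) A).

(** In a basis that diagonalizes [A] the elementary diagonal matrices commute with
    [A], so that [B] commutes with them. *)
Lemma dcent_diag : exists2 P : 'M[algC]_n, P \in unitmx &
  forall B, dcent B -> is_diag_mx (P *m B *m invmx P).
Proof.
have [P uP /= /diagonalizable_forPex[D /(simmxRL uP) DA]] := ssA; exists P => // B /dcentP dB.
apply/is_diag_mxP => i j neq_ij; pose C := invmx P *m delta_mx i i *m P.
have AC : map_mx ratr A *m C = C *m map_mx ratr A.
  have -> : map_mx ratr A = invmx P *m diag_mx D *m P.
    by rewrite DA !mulmxA mulVmx // mul1mx mulmxKV.
  rewrite /C !mulmxA mulmxK // mulmxK // -(mulmxA (invmx P) (diag_mx D)) -(mulmxA (invmx P) (delta_mx i i)); congr (_ *m _ *m _).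
  by apply/matrixP => a b; rewrite mul_diag_mx mul_mx_diag !mxE; case: (a =P i) => [->|]; case: (b =P i) => [->|]; rewrite ?mulr0 ?mul0r ?mulr1 ?mul1r.
have := congr1 (fun M => (P *m M *m invmx P) i j) (dB C AC).
have conjM M1 M2 : P *m (M1 *m M2) *m invmx P = (P *m M1 *m invmx P) *m (P *m M2 *m invmx P).
  by rewrite !mulmxA mulmxKV.
have DC : P *m C *m invmx P = delta_mx i i by rewrite /C !mulmxA mulmxV // mul1mx mulmxK.
clearbody C; rewrite /= !conjM DC; set M := P *m B *m invmx P.
rewrite !mxE (bigD1 i) //= big1 => [|k neq_ki]; last by rewrite mxE (negPf neq_ki) andbF mul0r.
rewrite big1 => [|k _]; last first.
  have ne : (j == i) = false by apply/negbTE; rewrite eq_sym -val_eqE.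
  by rewrite [delta_mx _ _ _ _]mxE ne andbF mulr0.
by rewrite mxE !eqxx mul1r addr0 => M0; rewrite -[RHS]M0 [RHS]mxE.
Qed.

Lemma dcent_comm (B1 B2 : 'M[algC]_n) : dcent B1 -> dcent B2 -> B1 *m B2 = B2 *m B1.
Proof.
have [P uP diagP] := dcent_diag => /diagP/diag_mxP[D1 E1] /diagP/diag_mxP[D2 E2].
have E (B : 'M[algC]_n) D : P *m B *m invmx P = diag_mx D -> B = invmx P *m diag_mx D *m P.
  by move=> <-; rewrite !mulmxA mulVmx // mul1mx mulmxKV.
rewrite (E _ _ E1) (E _ _ E2) !mulmxA !mulmxK // -!(mulmxA (invmx P)).
by rewrite diag_mxC.
Qed.

End DoubleCentralizer.

(** * The algebraic group *)

Section Blocks.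
Variables (R : comPzRingType) (n : nat).

(** An affine map of the space of [A], next to an element of the torus. *)
Definition affine_quad (B : 'M[R]_n) (v : 'cV[R]_n) (S : 'M[R]_2) : 'M[R]_(n + 1 + 2) :=
  block_mx (block_mx B v 0 1%:M) 0 0 S.

Lemma affine_quadM B v S B' v' S' :
  affine_quad B v S *m affine_quad B' v' S' = affine_quad (B *m B') (B *m v' + v) (S *m S').
Proof.
rewrite /affine_quad !mulmx_block !mul0mx !mulmx0 !addr0 !add0r.
by rewrite mulmx1 mul1mx.
Qed.

Lemma affine_quad1 : affine_quad 1%:M 0 1%:M = 1%:M.
Proof. by rewrite /affine_quad -!scalar_mx_block. Qed.

Lemma affine_quad_inj B v S B' v' S' : affine_quad B v S = affine_quad B' v' S' ->
  [/\ B = B', v = v' & S = S'].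
Proof. by case/eq_block_mx => /eq_block_mx[-> -> _ _] _ _ ->. Qed.

End Blocks.

Lemma map_affine_quad (R S : comPzRingType) (f : {rmorphism R -> S}) n (B : 'M[R]_n) v T :
  map_mx f (affine_quad B v T) = affine_quad (map_mx f B) (map_mx f v) (map_mx f T).
Proof. by rewrite /affine_quad !map_block_mx !map_mx0 map_mx1. Qed.

Section Group.
Variables (n : nat) (A : 'M[int]_n) (k : nat) (t : int) (m : nat).
Variables (q M : 'I_m -> 'M[rat]_n) (z : 'I_m -> nat).
Local Notation AQ := (map_mx intr A : 'M[rat]_n).
Hypothesis ssA : diagonalizable (map_mx (ratr : rat -> algC) AQ).
Hypotheses (dcent_q : forall i, dcent AQ (q i)) (dcent_M : forall i, dcent AQ (M i)).
Hypothesis M_quad : forall i, q i *m (M i *m M i) = q i *m (t%:~R *: M i - 1%:M).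
Local Notation N := (n + 1 + 2)%N.

(** On the part of the space singled out by [q i], [M i] is a root of
    [X^2 - t X + 1]; this is the image of [a + b e] there. *)
Definition torus_rep (K : numFieldType) i (a b : K) : 'M[K]_n :=
  a%:M + b *: map_mx ratr (M i).

(** The relation [B ^+ k = (a + b M) ^+ z], imposed after multiplication by each
    [q i], is satisfied by [A] and the generator [e]; it is a closed condition that
    determines [B] from the torus element up to finitely many choices. *)
Definition torus_compat (K : numFieldType) (B : 'M[K]_n) (a b : K) :=
  [/\ quad_norm t%:~R a b = 1, dcent AQ B
    & forall i, map_mx ratr (q i) *m B ^+ k = map_mx ratr (q i) *m torus_rep i a b ^+ z i].

Definition group_elt (K : numFieldType) (g : 'M[K]_N) :=
  exists B v a b, g = affine_quad B v (quad_mx t%:~R a b) /\ torus_compat B a b.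

Lemma closed_group : closed_cond group_elt.
Proof.
pose S (K : numFieldType) (g : 'M[K]_N) := drsubmx g.
pose B (K : numFieldType) (g : 'M[K]_N) : 'M[K]_n := ulsubmx (ulsubmx g).
pose a (K : numFieldType) (g : 'M[K]_N) := S K g 0 0.
pose b (K : numFieldType) (g : 'M[K]_N) := S K g 1 0.
have polyS : polymx S.
  by move=> i j; apply: eq_polymap (@polymx_id N (rshift (n + 1) i) (rshift (n + 1) j)) => K g; rewrite !mxE.
have polyUL : polymx (fun K (g : 'M[K]_N) => ulsubmx g).
  by move=> i j; apply: eq_polymap (@polymx_id N (lshift 2 i) (lshift 2 j)) => K g; rewrite !mxE.
have polyB : polymx B.
  by move=> i j; apply: eq_polymap (polyUL (lshift 1 i) (lshift 1 j)) => K g; rewrite !mxE.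
have polya : polymap a := polyS 0 0.
have polyb : polymap b := polyS 1 0.
have polyt : polymap (fun K (g : 'M[K]_N) => t%:~R).
  by apply: eq_polymap (polymap_const N t%:~R) => K g; rewrite ratr_int.
have polyScal f : polymap f -> polymx (fun K (g : 'M[K]_N) => (f K g)%:M : 'M[K]_n).
  move=> pf i j; apply: eq_polymap (polymxZ pf (polymx_const N (1%:M : 'M[rat]_n)) i j) => K g.
  by rewrite map_mx1 scalemx1.
have polyRep i : polymx (fun K (g : 'M[K]_N) => torus_rep i (a K g) (b K g)).
  by apply: polymxD; [apply: polyScal | apply: polymxZ => //; apply: polymx_const].
have polyQ : polymx (fun K (g : 'M[K]_N) => quad_mx t%:~R (a K g) (b K g)).
  have polyN := polymapN polyb; have polyAB := polymapD polya (polymapM polyt polyb).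
  move=> i j; have [i0|i1] := boolP (i == 0); have [j0|j1] := boolP (j == 0).
  - by apply: eq_polymap polya => K g; rewrite mxE i0 j0.
  - by apply: eq_polymap polyN => K g; rewrite mxE i0 (negPf j1).
  - by apply: eq_polymap polyb => K g; rewrite mxE (negPf i1) j0.
  - by apply: eq_polymap polyAB => K g; rewrite mxE (negPf i1) (negPf j1).
have c1 : closed_cond (fun K (g : 'M[K]_N) => ursubmx g = 0).
  apply: closed_cond_mx => i j.
  by apply: eq_polymap (@polymx_id N (lshift 2 i) (rshift (n + 1) j)) => K g; rewrite !mxE.
have c2 : closed_cond (fun K (g : 'M[K]_N) => dlsubmx g = 0).
  apply: closed_cond_mx => i j.
  by apply: eq_polymap (@polymx_id N (rshift (n + 1) i) (lshift 2 j)) => K g; rewrite !mxE.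
have c3 : closed_cond (fun K (g : 'M[K]_N) => dlsubmx (ulsubmx g) = 0 :> 'M_(1, n)).
  apply: closed_cond_mx => i j.
  by apply: eq_polymap (polyUL (rshift n i) (lshift 1 j)) => K g; rewrite !mxE.
have c4 : closed_cond (fun K (g : 'M[K]_N) =>
    drsubmx (ulsubmx g) + - map_mx ratr (1%:M : 'M[rat]_1) = 0 :> 'M_1).
  apply: closed_cond_mx; apply: polymxD; last by apply: polymxN; apply: polymx_const.
  by move=> i j; apply: eq_polymap (polyUL (rshift n i) (rshift n j)) => K g; rewrite !mxE.
have c5 : closed_cond (fun K (g : 'M[K]_N) => S K g + - quad_mx t%:~R (a K g) (b K g) = 0).
  by apply: closed_cond_mx; apply: polymxD => //; apply: polymxN.
have c6 : closed_cond (fun K (g : 'M[K]_N) =>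
    a K g * a K g + t%:~R * a K g * b K g + b K g * b K g + - ratr 1 = 0).
  apply: closed_cond_map; apply: polymapD; last by apply: polymapN; apply: polymap_const.
  by apply: polymapD; [apply: polymapD|]; [apply: polymapM|apply: polymapM => //; apply: polymapM|apply: polymapM].
have c7 := closed_dcent AQ polyB.
have c8 : closed_cond (fun K (g : 'M[K]_N) => forall i : 'I_m,
    map_mx ratr (q i) *m B K g ^+ k + - (map_mx ratr (q i) *m torus_rep i (a K g) (b K g) ^+ z i) = 0).
  apply: closed_cond_forall => i; apply: closed_cond_mx; apply: polymxD; last apply: polymxN.
    by apply: polymxM; [apply: polymx_const | apply: polymxX].
  by apply: polymxM; [apply: polymx_const | apply: polymxX].
apply: eq_closed_cond (closed_cond_and (closed_cond_and (closed_cond_and c1 c2) (closed_cond_and c3 c4))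
  (closed_cond_and (closed_cond_and c5 c6) (closed_cond_and c7 c8))) => K g.
split=> [[[[g1 g2] [g3 g4]] [[g5 g6] [g7 g8]]]|[B' [v' [a' [b' [-> [N1 dB pB]]]]]]].
  exists (B K g), (ursubmx (ulsubmx g)), (a K g), (b K g); split; last split=> //.
  - rewrite /affine_quad -[LHS]submxK g1 g2; congr (block_mx _ 0 0 _); last first.
      by apply/eqP; rewrite -subr_eq0; apply/eqP.
    rewrite -[LHS]submxK g3; congr (block_mx _ _ 0 _).
    by apply/eqP; rewrite -subr_eq0 -(map_mx1 (ratr : {rmorphism rat -> K})); apply/eqP.
  - by apply/eqP; rewrite -subr_eq0; apply/eqP; rewrite -[RHS]g6 rmorph1 /quad_norm; ring.
  by move=> i; apply/eqP; rewrite -subr_eq0; apply/eqP/g8.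
have Ea : a K (affine_quad B' v' (quad_mx t%:~R a' b')) = a'.
  by rewrite /a /S /affine_quad block_mxKdr mxE.
have Eb : b K (affine_quad B' v' (quad_mx t%:~R a' b')) = b'.
  by rewrite /b /S /affine_quad block_mxKdr mxE.
have EB : B K (affine_quad B' v' (quad_mx t%:~R a' b')) = B'.
  by rewrite /B /affine_quad !block_mxKul.
rewrite Ea Eb EB /S /affine_quad !(block_mxKul, block_mxKur, block_mxKdl, block_mxKdr) map_mx1 !subrr.
do !split=> //.
  by rewrite rmorph1 -[X in _ - X]N1 /quad_norm; ring.
by move=> i; rewrite pB subrr.
Qed.

Lemma dcent_torus_rep (K : numFieldType) i (a b : K) : dcent AQ (torus_rep i a b).
Proof.
apply: dcentD; first by rewrite -scalemx1; apply/dcentZ/dcent1.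
by apply: dcentZ; rewrite dcent_ratr.
Qed.

Lemma map_M_quad (K : numFieldType) i : let f := @map_mx _ _ (ratr : rat -> K) n n in
  f (q i) *m (f (M i) *m f (M i)) = f (q i) *m (t%:~R *: f (M i) - 1%:M).
Proof.
by rewrite /= -!map_mxM M_quad map_mxM map_mxB map_mxZ map_mx1 rmorph_int.
Qed.

(** [q i * (M i) ^ 2] can be reduced by the quadratic equation, as for [e]. *)
Lemma torus_repM (K : numFieldType) i (a b a' b' : K) :
  map_mx ratr (q i) *m (torus_rep i a b *m torus_rep i a' b') =
  map_mx ratr (q i) *m torus_rep i (a * a' - b * b') (a * b' + b * a' + t%:~R * b * b').
Proof.
rewrite /torus_rep; set Q := map_mx _ (q i); set X := map_mx _ (M i).
have -> : (a%:M + b *: X) *m (a'%:M + b' *: X) =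
    (a * a')%:M + (a * b' + b * a') *: X + (b * b') *: (X *m X).
  rewrite mulmxDl !mulmxDr -scalar_mxM -!scalemxAl -!scalemxAr mul_scalar_mx mul_mx_scalar.
  by rewrite !scalerA scalerDl [b' * a]mulrC -!addrA.
rewrite mulmxDr -scalemxAr map_M_quad scalemxAr -mulmxDr; congr (_ *m _).
by apply/matrixP => c d; rewrite !mxE; case: (c == d); rewrite ?mulr1n ?mulr0n; ring.
Qed.

Lemma eq_mulmx_pow (R : pzRingType) (Q X Y : 'M[R]_n) e :
  Q *m X = Q *m Y -> Q *m Y = Y *m Q -> Q *m X ^+ e = Q *m Y ^+ e.
Proof.
move=> QX QY; elim: e => [|e IHe]; first by rewrite !expr0.
by rewrite !exprS -[X * _]/(X *m _) -[Y * _]/(Y *m _) !mulmxA QX QY -!mulmxA IHe.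
Qed.

Section Closure.
Local Notation qC i := (map_mx (ratr : rat -> algC) (q i)).

Let comm (B1 B2 : 'M[algC]_n) : dcent AQ B1 -> dcent AQ B2 -> B1 *m B2 = B2 *m B1.
Proof. exact: dcent_comm. Qed.

Let dq i : dcent AQ (qC i). Proof. by rewrite dcent_ratr. Qed.

Lemma mulmx_pow (B1 B2 : 'M[algC]_n) e : B1 *m B2 = B2 *m B1 ->
  (B1 *m B2) ^+ e = B1 ^+ e *m B2 ^+ e.
Proof. by move=> c; rewrite -[B1 *m B2]/(B1 * B2) exprMn_comm. Qed.

Lemma torus_compatM (B B' : 'M[algC]_n) a b a' b' :
  torus_compat B a b -> torus_compat B' a' b' ->
  torus_compat (B *m B') (a * a' - b * b') (a * b' + b * a' + t%:~R * b * b').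
Proof.
move=> [N1 d1 p1] [N2 d2 p2]; split; first by rewrite quad_normM N1 N2 mulr1.
  exact: dcentM.
have dr i c d := dcent_torus_rep i (c : algC) d.
move=> i; have drz c d := dcentX (z i) (dr i c d).
rewrite (mulmx_pow _ (comm d1 d2)) mulmxA p1 -mulmxA (comm (drz _ _) (dcentX k d2)).
rewrite mulmxA p2 -mulmxA (comm (drz _ _) (drz _ _)) -(mulmx_pow _ (comm (dr _ _ _) (dr _ _ _))).
by apply: eq_mulmx_pow; [exact: torus_repM | exact: comm].
Qed.

Lemma torus_compatV (B : 'M[algC]_n) a b : B \in unitmx ->
  torus_compat B a b -> torus_compat (invmx B) (a + t%:~R * b) (- b).
Proof.
move=> uB [N1 d1 p1]; split; [by rewrite quad_normV|exact: dcentV|].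
have dr i c d := dcent_torus_rep i (c : algC) d.
have dV := dcentV uB d1.
move=> i; set r := torus_rep i a b; set r' := torus_rep i _ _.
have rr' : qC i *m (r *m r') = qC i *m 1%:M.
  rewrite torus_repM; congr (_ *m _); rewrite /torus_rep.
  have -> : a * (a + t%:~R * b) - b * - b = 1 by rewrite -[RHS]N1 /quad_norm; ring.
  have -> : a * - b + b * (a + t%:~R * b) + t%:~R * b * - b = 0 by ring.
  by rewrite scale0r addr0.
have rrz : qC i *m (r ^+ z i *m r' ^+ z i) = qC i.
  rewrite -(mulmx_pow _ (comm (dr _ _ _) (dr _ _ _))) (eq_mulmx_pow _ rr').
    by rewrite expr1n mulmx1.
  by rewrite mulmx1 mul1mx.
have BV : B ^+ k *m invmx B ^+ k = 1%:M.
  by rewrite -(mulmx_pow _ (comm d1 dV)) mulmxV // expr1n.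
rewrite -[in LHS]rrz mulmxA -p1 -!mulmxA; congr (_ *m _).
by rewrite (comm (dcentX (z i) (dr i _ _)) (dcentX k dV)) mulmxA BV mul1mx.
Qed.

(** Closure under products and inverses comes down to [torus_compatM] and
    [torus_compatV], where the commutation needed to multiply powers is that of the
    double centralizer. *)
Lemma group_elt_subgroup : mx_subgroup (fun g : 'M[algC]_N => g \in unitmx /\ group_elt g).
Proof.
split.
- split; first exact: unitmx1.
  exists 1%:M, 0, 1, 0; rewrite quad_mx1 affine_quad1; split=> //.
  split; [by rewrite /quad_norm; ring|exact: dcent1|move=> i].
  by rewrite /torus_rep scale0r addr0 !expr1n.
- move=> g h [ug [B [v [a [b [Dg cB]]]]]] [uh [B' [v' [a' [b' [Dh cB']]]]]].
  split; first by rewrite unitmx_mul ug uh.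
  rewrite Dg Dh affine_quadM quad_mxM; do 4!eexists; split; first reflexivity.
  exact: torus_compatM.
move=> g [ug [B [v [a [b [Dg cB]]]]]]; split; first by rewrite unitmx_inv.
have uB : B \in unitmx.
  move: ug; rewrite Dg unitmxE /affine_quad det_ublock det_ublock det1 mulr1 unitrM.
  by case/andP.
have [N1 _ _] := cB.
exists (invmx B), (- (invmx B *m v)), (a + t%:~R * b), (- b); split; last exact: torus_compatV.
rewrite -[LHS]mulmx1 -affine_quad1.
have <- : affine_quad B v (quad_mx t%:~R a b) *m
   affine_quad (invmx B) (- (invmx B *m v)) (quad_mx t%:~R (a + t%:~R * b) (- b)) = affine_quad 1%:M 0 1%:M.
  rewrite affine_quadM quad_mxV // mulmxV // mulmxN mulKVmx // addNr.
  by [].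
by rewrite -Dg mulKmx.
Qed.

End Closure.

End Group.

Lemma mxexpz_unit n (A : 'M[int]_n) (j : int) : A \in unitmx -> mxexpz A j \in unitmx.
Proof.
move=> uA; have E : mxexpz A (- j) *m mxexpz A j = 1%:M.
  by rewrite -mxexpzD // addNr [mxexpz A 0]expr0.
by case/mulmx1_unit: E.
Qed.

(** The powers [a + b e] have [b > 0] and [- b < a <= 0]. *)
Lemma quad_gen_order (t : int) (i : nat) : 3 <= t -> mxexpz (quad_mx t 0 1) i.+1 <> 1%:M.
Proof.
move=> t_ge3; suff [a [b [-> [b_gt0 _]]]] : exists a b : int,
    mxexpz (quad_mx t 0 1) i.+1 = quad_mx t a b /\ (0 < b /\ (- b < a <= 0)).
  by rewrite -(quad_mx1 t) => /matrixP/(_ 1 0); rewrite !mxE /= => b0; rewrite b0 ltxx in b_gt0.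
elim: i => [|i [a [b [IHi [b_gt0 /andP[lo hi]]]]]].
  by exists 0, 1; rewrite [mxexpz _ 1]expr1.
exists (- b), (a + t * b); rewrite [mxexpz _ _]exprS -[_ * _]/(quad_mx t 0 1 *m mxexpz _ i.+1) IHi quad_step.
by split=> //; clear -b_gt0 lo hi t_ge3; nia.
Qed.

Lemma quad_gen_inj (t i j : int) : 3 <= t ->
  mxexpz (quad_mx t 0 1) i = mxexpz (quad_mx t 0 1) j -> i = j.
Proof.
move=> t_ge3; have uE := quad_gen_unit t.
wlog le_ij : i j / i <= j.
  by move=> IH Eij; case/orP: (le_total i j) => h; [|symmetry]; apply: IH.
move=> Eij; have : mxexpz (quad_mx t 0 1) (j - i) = 1%:M.
  by rewrite mxexpzD // -Eij -mxexpzD // subrr [mxexpz _ 0]expr0.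
have : 0 <= j - i by rewrite subr_ge0.
case Dji: (j - i) => [[|d]|] // _; first by move=> _; apply/esym/eqP; rewrite -subr_eq0 Dji.
by move/quad_gen_order => /(_ t_ge3).
Qed.

(** A subset of a finite set is finite; the list needs classical logic as the
    predicate is not decidable. *)
Lemma finite_sub (T T' : eqType) (f : T -> T') (L : seq T') (Q : T -> Prop) : injective f ->
  (forall c, Q c -> f c \in L) -> exists s : seq T, (forall c, c \in s -> Q c) /\ forall c, Q c -> c \in s.
Proof.
move=> inj_f; elim: L Q => [|x L IHL] Q QL; first by exists [::]; split=> // c /QL.
have [|s [sQ Qs]] := IHL (fun c => Q c /\ f c != x).
  by move=> c [/QL]; rewrite in_cons => /predU1P[->|//]; rewrite eqxx.
have [[c0 [Qc0 f0]]|no_c] := classic (exists c0, Q c0 /\ f c0 = x).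
  exists (c0 :: s); split=> [c|c Qc]; rewrite in_cons; first by move=> /predU1P[->|/sQ[]].
  have [/eqP|neq] := boolP (f c == x); first by rewrite -f0 => /inj_f ->; rewrite eqxx.
  by rewrite Qs ?orbT.
exists s; split=> [c /sQ[]|c Qc] //; apply: Qs; split=> //; apply/negP => /eqP fc.
by apply: no_c; exists c.
Qed.

Section Arithmetic.
Variables (n : nat) (A : 'M[int]_n) (uA : A \in unitmx) (k : nat) (t : int) (m : nat).
Variables (q M : 'I_m -> 'M[rat]_n) (z : 'I_m -> nat).
Local Notation AQ := (map_mx intr A : 'M[rat]_n).
Hypothesis ssA : diagonalizable (map_mx (ratr : rat -> algC) AQ).
Hypotheses (k_gt0 : (0 < k)%N) (t_ge3 : 3 <= t).
Hypotheses (dcent_q : forall i, dcent AQ (q i)) (dcent_M : forall i, dcent AQ (M i)).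
Hypothesis M_quad : forall i, q i *m (M i *m M i) = q i *m (t%:~R *: M i - 1%:M).
Hypothesis M_pow : forall i, q i *m AQ ^+ k = q i *m M i ^+ z i.
Hypothesis q_sep : forall X : 'M[rat]_n, (forall i, q i *m X = 0) -> X = 0.
Local Notation N := (n + 1 + 2)%N.
Local Notation E := (quad_mx t 0 1).

Definition sd (v : 'cV[int]_n) (i : int) : semidirect uA := (v, i).

Definition torus_embed (x : semidirect uA) : 'M[int]_N :=
  affine_quad (mxexpz A x.2) x.1 (mxexpz E x.2).

Definition rat_embed x : 'M[rat]_N := map_mx intr (torus_embed x).

Lemma torus_embedM (x y : semidirect uA) :
  torus_embed (x * y)%g = torus_embed x *m torus_embed y.
Proof.
have uE := quad_gen_unit t.
rewrite /torus_embed affine_quadM -!mxexpzD //.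
by congr (affine_quad _ _ _); rewrite [RHS]addrC.
Qed.

Lemma torus_embed1 : torus_embed 1%g = 1%:M.
Proof. by rewrite -affine_quad1. Qed.

Lemma torus_embed_unit x : torus_embed x \in unitmx.
Proof.
have E1 : torus_embed x *m torus_embed x^-1%g = 1%:M by rewrite -torus_embedM mulgV torus_embed1.
by case/mulmx1_unit: E1.
Qed.

Lemma rat_embedM x y : rat_embed (x * y)%g = rat_embed x *m rat_embed y.
Proof. by rewrite -map_mxM -torus_embedM. Qed.

Lemma rat_embed1 : rat_embed 1%g = 1%:M.
Proof. by rewrite /rat_embed torus_embed1 map_mx1. Qed.

Lemma rat_embed_unit x : rat_embed x \in unitmx.
Proof. exact: intr_unitmx (torus_embed_unit x). Qed.

Lemma rat_embedV x : rat_embed x^-1%g = invmx (rat_embed x).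
Proof.
by rewrite -[LHS](mulmxK (rat_embed_unit x)) -rat_embedM mulVg rat_embed1 mul1mx.
Qed.

Lemma rat_embed_inj : injective rat_embed.
Proof.
move=> [x i] [y j] Exy; have : torus_embed (x, i) = torus_embed (y, j).
  apply/matrixP => a b; apply: (@intr_inj rat).
  by move/matrixP/(_ a b): Exy; rewrite !mxE.
by case/affine_quad_inj => _ /= -> /(quad_gen_inj t_ge3) ->.
Qed.

Variable G : seq {mpoly rat[N * N]}.
Hypothesis DG : forall (K : numFieldType) (g : 'M[K]_N),
  (forall p, p \in G -> peval p g = 0) <-> group_elt A k t q M z g.

Lemma alg_groupG : alg_group G.
Proof.
have [H1 HM HV] := group_elt_subgroup k z ssA dcent_q dcent_M M_quad.
have pG (g : 'M[algC]_N) : points G g <-> g \in unitmx /\ group_elt A k t q M z g.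
  by split=> -[ug /DG].
split; first exact/pG.
  by move=> g h /pG Pg /pG Ph; apply/pG/HM.
by move=> g /pG Pg; apply/pG/HV.
Qed.

Lemma ratpoints_mul (g h : 'M[rat]_N) : points G g -> points G h -> points G (g *m h).
Proof.
have [_ HM _] := alg_groupG.
by move=> /(points_ratr _ algC) Pg /(points_ratr _ algC) Ph; apply/(points_ratr _ algC); rewrite map_mxM; apply: HM.
Qed.

Lemma ratpoints_inv (g : 'M[rat]_N) : points G g -> points G (invmx g).
Proof.
have [_ _ HV] := alg_groupG.
by move=> /(points_ratr _ algC) Pg; apply/(points_ratr _ algC); rewrite map_invmx; apply: HV.
Qed.

(** It suffices to consider the translations and the generator [(0, 1)], since the
    group is generated by them. *)
Lemma rat_embed_points x : points G (rat_embed x).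
Proof.
have gen1 v : points G (rat_embed (sd v 0)).
  split; first exact: rat_embed_unit.
  apply/DG; exists 1%:M, (map_mx intr v), 1, 0; split.
    by rewrite /rat_embed map_affine_quad quad_mx1 [mxexpz A 0]expr0 [mxexpz E 0]expr0 !map_mx1.
  split; [by rewrite /quad_norm; ring | exact: dcent1 | move=> i].
  by rewrite /torus_rep scale0r addr0 !expr1n.
have gen2 : points G (rat_embed (sd 0 1)).
  split; first exact: rat_embed_unit.
  apply/DG; exists AQ, 0, 0, 1; split.
    rewrite /rat_embed map_affine_quad [mxexpz A 1]expr1 [mxexpz E 1]expr1 map_mx0.
    by rewrite map_quad_mx rmorph0 rmorph1.
  split; [by rewrite /quad_norm; ring | exact: dcent_self | move=> i].
  rewrite /torus_rep !map_mx_ratr_rat scale1r M_pow; congr (_ *m _ ^+ _).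
  by apply/matrixP => a b; rewrite !mxE mul0rn add0r.
have genN (i : nat) : points G (rat_embed (sd 0 i%:Z)).
  elim: i => [|i IHi]; first exact: gen1.
  have -> : sd 0 i.+1 = (sd 0 i * sd 0 1%:Z)%g.
    by congr (_, _); rewrite ?mulmx0 ?addr0 //= intS addrC.
  by rewrite rat_embedM; apply: ratpoints_mul.
have genZ (i : int) : points G (rat_embed (sd 0 i)).
  case: i => i; first exact: genN.
  have -> : sd 0 (Negz i) = (sd 0 i.+1)^-1%g.
    by congr (_, _); rewrite /= ?mulmx0 ?oppr0.
  by rewrite rat_embedV; apply: ratpoints_inv.
case: x => v i; rewrite -[(v, i)]/(sd v i).
have -> : sd v i = (sd v 0%R * sd 0%R i)%g.
  by congr (_, _); rewrite /= ?mulmx0 ?addr0 ?add0r.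
by rewrite rat_embedM; apply: ratpoints_mul.
Qed.

Lemma rat_embed_integral x : integral_points G (rat_embed x).
Proof.
split; first exact: rat_embed_points.
by exists (torus_embed x); first exact: torus_embed_unit.
Qed.

(** The representatives of the cosets of the embedded group in the integral points. *)
Definition torsion_part (c : 'M[rat]_N) :=
  integral_points G c /\ exists (B : 'M[rat]_n) (e : rat),
    [/\ c = affine_quad B 0 e%:M, e = 1 \/ e = -1, dcent AQ B & B ^+ (2 * k) = 1%:M].

(** By [torus_cyclic] the torus part of an integral point is [e * x ^ j] with
    [e = +- 1].  Dividing by [(w, j)], with [w] chosen to remove the translation,
    leaves [S = e] and [v = 0]; the relation in [torus_compat] then reads
    [q i * B ^+ k = e ^ z i * q i], hence [B ^+ (2 k) = 1]. *)
Lemma integral_split h : integral_points G h ->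
  exists c x, torsion_part c /\ h = c *m rat_embed x.
Proof.
move=> [Gh [H uH Dh]]; have [uh /DG[B [v [a [b [Eh [Nab _ _]]]]]]] := Gh.
pose B0 := ulsubmx (ulsubmx H); pose v0 := ursubmx (ulsubmx H); pose S0 := drsubmx H.
have EB : map_mx intr B0 = B by rewrite /B0 !map_ulsubmx -Dh Eh /affine_quad !block_mxKul.
have Ev : map_mx intr v0 = v.
  by rewrite /v0 map_ursubmx map_ulsubmx -Dh Eh /affine_quad block_mxKul block_mxKur.
have ES : map_mx intr S0 = quad_mx t%:~R a b.
  by rewrite /S0 map_drsubmx -Dh Eh /affine_quad block_mxKdr.
have Ea : a = (S0 0 0)%:~R by have /matrixP/(_ 0 0) := ES; rewrite !mxE.
have Eb : b = (S0 1 0)%:~R by have /matrixP/(_ 1 0) := ES; rewrite !mxE.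
have inj_map p r (X Y : 'M[int]_(p, r)) : map_mx (intr : int -> rat) X = map_mx intr Y -> X = Y.
  by move=> /matrixP XY; apply/matrixP => i j; have := XY i j; rewrite !mxE => /intr_inj.
have DH : H = affine_quad B0 v0 (quad_mx t (S0 0 0) (S0 1 0)).
  by apply: inj_map; rewrite map_affine_quad map_quad_mx EB Ev /= -Ea -Eb -Dh Eh.
have N0 : quad_norm t (S0 0 0) (S0 1 0) = 1.
  apply: (@intr_inj rat); rewrite -[RHS]Nab Ea Eb /quad_norm.
  by rewrite !rmorphD /= !rmorphM.
have [e [j [e1 DS]]] := torus_cyclic t_ge3 N0.
have uB0 : B0 \in unitmx.
  move: uH; rewrite DH unitmxE /affine_quad det_ublock det_ublock det1 mulr1 unitrM.
  by case/andP.
pose B1 := B0 *m mxexpz A (- j).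
have uB1 : B1 \in unitmx by rewrite unitmx_mul uB0 mxexpz_unit.
pose x := sd (invmx B1 *m v0) j; pose C := affine_quad B1 0 e%:M.
have HC : H = C *m torus_embed x.
  rewrite affine_quadM addr0 mulKVmx // mul_scalar_mx -DS DH; congr (affine_quad _ _ _).
  by rewrite /B1 /= -mulmxA -mxexpzD // addNr [mxexpz A 0]expr0 mulmx1.
have uC : C \in unitmx.
  by move: uH; rewrite HC unitmx_mul => /andP[].
have hC : h = map_mx intr C *m rat_embed x by rewrite Dh HC map_mxM.
exists (map_mx intr C), x; split=> //.
have GC : points G (map_mx intr C : 'M[rat]_N).
  rewrite -[map_mx intr C](mulmxK (rat_embed_unit x)) -hC -rat_embedV.
  by apply: ratpoints_mul => //; apply: rat_embed_points.
split; first by split=> //; exists C.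
have [_ /DG[B2 [v2 [a2 [b2 [EC [N2 d2 p2]]]]]]] := GC.
have EC' : map_mx intr C = affine_quad (map_mx intr B1) 0 (e%:~R%:M) :> 'M[rat]_N.
  by rewrite map_affine_quad map_mx0 map_scalar_mx.
have [B12 v20 S2] : [/\ map_mx intr B1 = B2, 0 = v2 & (e%:~R)%:M = quad_mx t%:~R a2 b2].
  by apply: affine_quad_inj; rewrite -EC'.
exists B2, e%:~R; split=> //; first by rewrite EC' B12.
  by case: e1 => ->; [left | right; rewrite rmorphN].
have Ea2 : a2 = e%:~R by have /matrixP/(_ 0 0) := S2; rewrite !mxE /= mulr1n.
have Eb2 : b2 = 0 by have /matrixP/(_ 1 0) := S2; rewrite !mxE /=.
have ee : e%:~R * e%:~R = 1 :> rat by case: e1 => ->; rewrite ?rmorphN ?mulrNN mulr1.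
have torus0 i : q i *m B2 ^+ k = e%:~R ^+ z i *: q i.
  have := p2 i; rewrite !map_mx_ratr_rat /torus_rep Eb2 scale0r addr0 Ea2 => ->.
  elim: (z i) => [|d IHd]; first by rewrite !expr0 mulmx1 scale1r.
  by rewrite exprSr -[_ ^+ d * _]/(_ ^+ d *m _) mulmxA IHd mul_mx_scalar scalerA -exprS.
apply/eqP; rewrite -subr_eq0; apply/eqP/q_sep => i.
rewrite mulmxBr mulmx1 mul2n -addnn exprD -[_ * _]/(_ *m _) mulmxA torus0 -scalemxAl torus0.
by rewrite scalerA -exprMn ee expr1n scale1r subrr.
Qed.

(** Over the algebraic numbers these matrices are simultaneously diagonal, with roots
    of unity of order dividing [2 k] on the diagonal. *)
Lemma torsion_part_finite : exists s : seq 'M[rat]_N,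
  (forall c, c \in s -> torsion_part c) /\ forall c, torsion_part c -> c \in s.
Proof.
have [P uP diagP] := dcent_diag ssA.
have k2 : (0 < 2 * k)%N by rewrite muln_gt0.
have [w prim_w] := C_prim_root_exists k2.
pose D (d : {ffun 'I_n -> 'I_(2 * k)}) : 'M[algC]_n :=
  invmx P *m diag_mx (\row_i w ^+ d i) *m P.
pose L := [seq affine_quad (D d) 0 e%:M | d <- enum {ffun 'I_n -> 'I_(2 * k)}, e <- [:: 1; -1]].
apply: (@finite_sub _ _ (map_mx (ratr : rat -> algC)) L).
  by move=> X Y /matrixP XY; apply/matrixP => i j; have := XY i j; rewrite !mxE => /fmorph_inj.
move=> c [_ [B [e [-> e1 dB B2k]]]].
have [|Delta ED] := @diag_mxP _ _ _ (diagP (map_mx ratr B) _); first by rewrite dcent_ratr.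
have EB : map_mx ratr B = invmx P *m diag_mx Delta *m P.
  by rewrite -ED !mulmxA mulVmx // mul1mx mulmxKV.
have powB d : map_mx ratr B ^+ d = invmx P *m diag_mx (\row_i (Delta 0 i) ^+ d) *m P.
  elim: d => [|d IHd].
    rewrite expr0 (_ : diag_mx _ = 1%:M) ?mulmx1 ?mulVmx //.
    by apply/matrixP => i j; rewrite !mxE expr0.
  rewrite exprSr -[_ * _]/(_ *m _) IHd EB !mulmxA mulmxK // -(mulmxA (invmx P)) mulmx_diag.
  by congr (_ *m diag_mx _ *m _); apply/rowP => i; rewrite !mxE exprSr.
have root1 i : (Delta 0 i) ^+ (2 * k) = 1.
  have := powB (2 * k)%N.
  have -> : map_mx ratr B ^+ (2 * k) = 1%:M :> 'M[algC]_n.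
    by rewrite -map_mxX B2k map_mx1.
  move/(congr1 (fun X => P *m X *m invmx P)); rewrite mulmx1 mulmxV // !mulmxA mulmxK // mulmxV // mul1mx.
  by move/matrixP/(_ i i); rewrite !mxE eqxx !mulr1n.
have dlog i : exists j : 'I_(2 * k), Delta 0 i = w ^+ j.
  by have [j ->] := prim_rootP prim_w (root1 i); exists j.
have {dlog}[d Dd] : exists d : {ffun 'I_n -> 'I_(2 * k)}, forall i, Delta 0 i = w ^+ d i.
  by have [d Dd] := fin_all_exists dlog; exists [ffun i => d i] => i; rewrite ffunE.
rewrite map_affine_quad map_mx0 map_scalar_mx /= EB.
have -> : invmx P *m diag_mx Delta *m P = D d.
  by rewrite /D; congr (_ *m diag_mx _ *m _); apply/rowP => i; rewrite mxE.
apply/allpairsP; exists (d, ratr e); rewrite mem_enum; split=> //=.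
by case: e1 => ->; rewrite ?rmorphN rmorph1 !inE eqxx ?orbT.
Qed.

(** The embedded group consists of integral points, so one of the two indices is 1. *)
Lemma rat_embed_commensurable :
  commensurable (fun g => exists x, g = rat_embed x) (integral_points G).
Proof.
split; split; try by move=> g [].
  exists [:: 1%:M]; split=> [g|h [x ->]].
    by rewrite inE => /eqP ->; exists 1%g; rewrite rat_embed1.
  exists 1%:M; rewrite ?inE // invmx1 mul1mx; split; first by exists x.
  exact: rat_embed_integral.
have [s [sQ Qs]] := torsion_part_finite.
exists s; split=> [g /sQ[]|h /integral_split[c [x [Qc ->]]]] //.
exists c; first exact: Qs.
have [[[uc _] _] _] := Qc.
by rewrite mulKmx //; split; [exists x | apply: rat_embed_integral].
Qed.

End Arithmetic.

Section ArithmeticGroup.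
Variables (n : nat) (A : 'M[int]_n) (uA : A \in unitmx) (k : nat) (t : int) (m : nat).
Variables (q M : 'I_m -> 'M[rat]_n) (z : 'I_m -> nat).
Local Notation AQ := (map_mx intr A : 'M[rat]_n).

(** The data [q], [M], [z] express that a power of [A] is, part by part, the image of
    the generator of the torus; the parts are jointly faithful by the last
    hypothesis. *)
Lemma semidirect_arithmetic :
  diagonalizable (map_mx (ratr : rat -> algC) AQ) -> (0 < k)%N -> 3 <= t ->
  (forall i, dcent AQ (q i)) -> (forall i, dcent AQ (M i)) ->
  (forall i, q i *m (M i *m M i) = q i *m (t%:~R *: M i - 1%:M)) ->
  (forall i, q i *m AQ ^+ k = q i *m M i ^+ z i) ->
  (forall X : 'M[rat]_n, (forall i, q i *m X = 0) -> X = 0) ->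
  arithmetic (semidirect uA : groupType).
Proof.
move=> ssA k_gt0 t_ge3 dq dM Mq Mp sep.
have [G DG] := closed_group A k t q M z.
exists (n + 1 + 2)%N, G, (rat_embed (uA := uA) t); split.
- exact: (alg_groupG ssA dq dM Mq DG).
- exact: rat_embed_inj.
- exact: rat_embedM.
- by move=> x; apply: (rat_embed_points ssA dq dM Mq Mp DG).
exact: (rat_embed_commensurable uA ssA k_gt0 t_ge3 dq dM Mq Mp sep DG).
Qed.

End ArithmeticGroup.

(** * Units of real quadratic fields *)

Section QuadraticUnit.
Variables (L : fieldExtType rat) (iota : {rmorphism L -> algC}).
Hypothesis quadL : real_quadratic iota.

Lemma integral_Aint (x : L) : integralOver (intr : int -> L) x -> iota x \in Aint.
Proof.
move=> [p mon_p root_p]; apply: (@root_monic_Aint (map_poly intr p)).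
- have := rmorph_root iota root_p; rewrite -map_poly_comp.
  by rewrite (eq_map_poly (g := intr)) // => a /=; rewrite rmorph_int.
- by rewrite monicE lead_coef_map_inj ?rmorph0 ?(monicP mon_p) //; apply: intr_inj.
by apply/polyOverP => i; rewrite coef_map intr_int.
Qed.

(** The minimal polynomial has degree at most 2 because [L] has dimension 2, and its
    coefficients are integers. *)
Lemma quadratic_root (x : L) : iota x \in Aint -> iota x \notin Num.int ->
  exists b c : int, iota x ^+ 2 + b%:~R * iota x + c%:~R = 0.
Proof.
move=> Ax notZ; have [p [Dp mon_p] min_p] := minCpolyP (iota x).
have [dimL _] := quadL.
have [q Dq] := polyOver1P (minPolyOver 1%VS x).
have root_q : root (map_poly ratr q) (iota x).
  have := rmorph_root iota (root_minPoly 1%AS x); rewrite Dq -map_poly_comp.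
  by rewrite (eq_map_poly (g := ratr)) // => a /=; rewrite alg_num_field fmorph_rat.
have nz_q : q != 0.
  apply: contraTneq (monic_minPoly 1%AS x) => q0.
  by rewrite Dq q0 map_poly0 monicE lead_coef0 eq_sym oner_eq0.
have le_p : (size p <= 3)%N.
  have := min_p q; rewrite root_q => /esym/dvdp_leq-/(_ nz_q)/leq_trans; apply.
  rewrite -(size_map_poly (in_alg L) q) -Dq size_minPoly ltnS.
  by have := dim_Fadjoin 1%AS x; rewrite dimv1 muln1 => <-; apply: leq_trans (dimvS (subvf _)) _; rewrite dimL.
have Z_p i : exists a : int, (minCpoly (iota x))`_i = a%:~R.
  by apply/intrP; move/polyOverP: Ax; apply.
have sz : size (minCpoly (iota x)) = size p by rewrite Dp size_map_poly.
have lead1 : (minCpoly (iota x))`_(size p).-1 = 1.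
  by have /monicP := minCpoly_monic (iota x); rewrite lead_coefE sz.
have sz_gt1 := size_minCpoly (iota x).
have := root_minCpoly (iota x); rewrite /root horner_coef sz.
have [a0 Da0] := Z_p 0; have [a1 Da1] := Z_p 1.
have [p2|p3] : size p = 2 \/ size p = 3.
- by move: le_p sz_gt1; rewrite sz; case: (size p) => [|[|[|[|]]]] // _ _; [left|right].
- move: lead1; rewrite p2 !big_ord_recl big_ord0 /= => ->; rewrite Da0 => /eqP Dx.
  by case/negP: notZ; rewrite (_ : iota x = (- a0)%:~R) ?intr_int // rmorphN /= -[RHS]addr0 -Dx; ring.
move: lead1; rewrite p3 !big_ord_recl big_ord0 /= /bump /= => ->; rewrite Da0 Da1 => /eqP Dx.
by exists a1, a0; rewrite -[RHS]Dx; ring.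
Qed.

(** Eliminating between integral quadratic equations of the unit and of its inverse
    shows that the norm is [+- 1], unless the unit is rational; squaring makes it 1. *)
Lemma quad_unit_square (e : L) : integer_unit e ->
  exists t : int, (iota e ^+ 2) ^+ 2 = t%:~R * iota e ^+ 2 - 1.
Proof.
move=> [nz_e /integral_Aint Ae /integral_Aint AVe].
have nz_x : iota e != 0 by rewrite fmorph_eq0.
have [/intrP[a Da]|notZ] := boolP (iota e \in Num.int).
  have /intrP[b Db] : iota e^-1 \in Num.int.
    by apply: Cint_rat_Aint => //; rewrite fmorphV rpredV Da -ratr_int Crat_rat.
  have ab : a * b = 1.
    by apply: (@intr_inj algC); rewrite rmorphM /= -Da -Db fmorphV divff.
  exists 2; rewrite Da; have a2 := int_unit_square ab.
  have -> : a%:~R ^+ 2 = 1 :> algC by rewrite -rmorphXn /= expr2 a2.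
  by ring.
have notZV : iota e^-1 \notin Num.int.
  apply: contra notZ => /intrP[b Db]; apply: Cint_rat_Aint => //.
  by rewrite -[e]invrK fmorphV rpredV Db -ratr_int Crat_rat.
have [b [c Dx]] := quadratic_root Ae notZ.
have [b' [c' Dy]] := quadratic_root AVe notZV.
move: Dx Dy; rewrite fmorphV; set x := iota e in notZ nz_x * => Dx Dy.
have {}Dy : c'%:~R * x ^+ 2 + b'%:~R * x + 1 = 0.
  by rewrite -(mulr0 (x ^+ 2)) -Dy; field.
(* eliminating [x ^+ 2]; both sides vanish since [x] is irrational *)
have lin : (b' - c' * b)%:~R * x = (c' * c - 1)%:~R.
  rewrite !rmorphB /= !rmorphM /= rmorph1; apply/eqP; rewrite -subr_eq0; apply/eqP.
  have -> : (b'%:~R - c'%:~R * b%:~R) * x - (c'%:~R * c%:~R - 1) =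
    (c'%:~R * x ^+ 2 + b'%:~R * x + 1) - c'%:~R * (x ^+ 2 + b%:~R * x + c%:~R) by ring.
  by rewrite Dx Dy mulr0 subrr.
have [bc0|nz] := eqVneq (b' - c' * b) 0; last first.
  case/negP: notZ; apply: Cint_rat_Aint => //.
  have -> : x = (c' * c - 1)%:~R / (b' - c' * b)%:~R.
    by rewrite -lin mulrC mulKf // intr_eq0.
  by rewrite rpred_div // -ratr_int Crat_rat.
have cc : c * c = 1.
  apply: (int_unit_square (b := c')); move: lin; rewrite bc0 mul0r => /esym/eqP.
  by rewrite intr_eq0 subr_eq0 mulrC => /eqP.
exists (b * b - 2 * c).
have Dx' : x ^+ 2 = - b%:~R * x - c%:~R by rewrite -[LHS]subr0 -Dx; ring.
have ccC : c%:~R * c%:~R = 1 :> algC by rewrite -rmorphM cc.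
have -> : (b * b - 2 * c)%:~R = b%:~R * b%:~R - 2 * c%:~R :> algC by rewrite rmorphB /= !rmorphM.
rewrite -[X in _ - X]ccC; apply/eqP; rewrite -subr_eq0; apply/eqP.
have -> : (x ^+ 2) ^+ 2 - ((b%:~R * b%:~R - 2 * c%:~R) * x ^+ 2 - c%:~R * c%:~R) =
  (x ^+ 2 + b%:~R * x + c%:~R) * (x ^+ 2 - b%:~R * x + c%:~R) by ring.
by rewrite Dx mul0r.
Qed.

End QuadraticUnit.

Lemma quad_power (R : comPzRingType) (t : int) (x : R) (z : nat) : x ^+ 2 = t%:~R * x - 1 ->
  exists a b : int, quad_norm t a b = 1 /\ x ^+ z = a%:~R + b%:~R * x.
Proof.
move=> x2; elim: z => [|z [a [b [Nab IHz]]]].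
  by exists 1, 0; split; [rewrite /quad_norm; ring | rewrite expr0 mul0r addr0].
exists (- b), (a + t * b); split; first by rewrite -Nab /quad_norm; ring.
rewrite exprS IHz mulrDr mulrCA -expr2 x2 rmorphN rmorphD /= rmorphM /=.
by ring.
Qed.

(** * The eigenvalue conditions as matrix identities *)

Lemma irreducible_coprime (F : fieldType) (p q : {poly F}) : irreducible_poly p ->
  p %| q \/ coprimep p q.
Proof.
move=> [_ irr_p]; have [g1|g1] := eqVneq (size (gcdp p q)) 1%N.
  by right; rewrite /coprimep g1.
by left; rewrite -(eqp_dvdl _ (irr_p _ g1 (dvdp_gcdl _ _))) dvdp_gcdr.
Qed.

(** Over the rationals a Bezout relation would exclude the common root. *)
Lemma irreducible_root (p q : {poly rat}) (x : algC) : irreducible_poly p ->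
  root (map_poly ratr p) x -> root (map_poly ratr q) x -> p %| q.
Proof.
move=> /irreducible_coprime-/(_ q)[//|/Bezout_eq1_coprimepP[[u v] /= uv]] px qx.
have := congr1 (fun r => (map_poly (ratr : rat -> algC) r).[x]) uv.
rewrite rmorphD !rmorphM rmorph1 /= !hornerE (eqP px) (eqP qx) !mulr0 addr0 => /eqP.
by rewrite eq_sym oner_eq0.
Qed.

Section Spectrum.
Variables (n' : nat).
Local Notation n := n'.+1.
Variables (A : 'M[rat]_n) (m : nat) (mu : 'I_m -> {poly rat}) (e : 'I_m -> nat).
Hypothesis ssA : diagonalizable (map_mx (ratr : rat -> algC) A).
Hypotheses (mu_monic : forall i, mu i \is monic) (mu_irr : forall i, irreducible_poly (mu i)).
Hypothesis mu_inj : injective mu.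
Hypothesis chiA : char_poly A = \prod_(i < m) mu i ^+ e i.

Definition cofactor_poly i := \prod_(j < m | j != i) mu j.
Definition cofactor_mx i := horner_mx A (cofactor_poly i).

(** The identities between polynomials in [A] are checked on the diagonal over the
    algebraic numbers; each diagonal entry is a root of one of the [mu i]. *)
Lemma diag_spectrum : exists (P : 'M[algC]_n) (D : 'rV[algC]_n),
  [/\ P \in unitmx,
      forall p, map_mx ratr (horner_mx A p) = invmx P *m diag_mx (map_mx (horner (map_poly ratr p)) D) *m P
    & forall l, exists i, root (map_poly ratr (mu i)) (D 0 l)].
Proof.
have [P uP /= /diagonalizable_forPex[D /(simmxRL uP) DA]] := ssA.
have EA : map_mx ratr A = invmx P *m diag_mx D *m P.
  by rewrite DA !mulmxA mulVmx // mul1mx mulmxKV.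
exists P, D; split=> // [p|l].
  by rewrite map_horner_mx EA horner_mx_uconjC // horner_mx_diag.
have : eigenvalue (map_mx ratr A) (D 0 l).
  apply/eigenvalueP; exists (delta_mx 0 l *m P).
    rewrite EA !mulmxA mulmxK // scalemxAl; congr (_ *m _).
    by apply/rowP => j; rewrite mul_mx_diag !mxE eqxx /=; case: eqP => [->|_]; rewrite ?mul1r ?mulr1 // mul0r mulr0.
  apply: contraTneq isT => /(congr1 (mulmx^~ (invmx P))); rewrite mulmxK // mul0mx.
  by move/rowP/(_ l)/eqP; rewrite !mxE !eqxx oner_eq0.
rewrite eigenvalue_root_char -map_char_poly chiA rmorph_prod /root horner_prod.
case/prodf_eq0 => i _; rewrite rmorphXn horner_exp expf_eq0 => /andP[_ root_i].
by exists i.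
Qed.

(** The cofactor vanishes at the roots of the other factors, and [p] at those of
    [mu i] because it has a root in common with it. *)
Lemma cofactor_kill i p (x : algC) : root (map_poly ratr (mu i)) x ->
  root (map_poly ratr p) x -> cofactor_mx i *m horner_mx A p = 0.
Proof.
move=> mu_x p_x; have [P [D [uP hornerA rootD]]] := diag_spectrum.
apply/eqP; rewrite -(map_mx_eq0 (ratr : {rmorphism rat -> algC})); apply/eqP.
rewrite -[_ *m _]/(_ * _) -rmorphM hornerA (_ : map_mx _ D = 0) ?raddf0 ?mulmx0 ?mul0mx //.
apply/rowP => l; rewrite !mxE rmorphM hornerM rmorph_prod horner_prod.
have [j root_j] := rootD l; have [Dj|neq_ji] := eqVneq j i.
  have [r ->] := dvdpP _ _ (irreducible_root (mu_irr i) mu_x p_x).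
  by rewrite rmorphM hornerM -[in X in _ * (_ * X)]Dj (eqP root_j) !mulr0.
by rewrite (bigD1 j) //= (eqP root_j) !mul0r.
Qed.

(** At each diagonal entry one cofactor does not vanish, since distinct irreducible
    monic polynomials have no common root. *)
Lemma cofactor_separate (X : 'M[rat]_n) : (forall i, cofactor_mx i *m X = 0) -> X = 0.
Proof.
move=> qX; have [P [D [uP hornerA rootD]]] := diag_spectrum.
apply/eqP; rewrite -(map_mx_eq0 (ratr : {rmorphism rat -> algC})); apply/eqP.
set Y := map_mx _ X; suff PY : P *m Y = 0 by rewrite -(mulKmx uP Y) PY mulmx0.
apply/matrixP => l c; have [i root_i] := rootD l.
have : diag_mx (map_mx (horner (map_poly ratr (cofactor_poly i))) D) *m (P *m Y) = 0.
  apply: (can_inj (mulKVmx uP)); rewrite mulmx0 !mulmxA -hornerA.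
  by rewrite -map_mxM qX raddf0.
move/matrixP/(_ l c); rewrite mul_diag_mx !mxE => /eqP; rewrite mulf_eq0 => /orP[|/eqP //].
rewrite rmorph_prod horner_prod => /prodf_eq0[j neq_ji root_j].
case/negP: neq_ji; apply/eqP/mu_inj/eqP; rewrite -eqp_monic //.
by rewrite /eqp !(irreducible_root (mu_irr _) (x := D 0 l)).
Qed.

Lemma dcent_horner p : dcent A (horner_mx A p).
Proof.
apply/dcentP => C; rewrite map_mx_ratr_rat => AC.
exact/esym/comm_horner_mx.
Qed.

End Spectrum.

Section Data.
Variables (n' : nat) (A : 'M[rat]_n'.+1) (m : nat) (mu : 'I_m -> {poly rat}) (e : 'I_m -> nat).
Hypothesis ssA : diagonalizable (map_mx (ratr : rat -> algC) A).
Hypotheses (mu_irr : forall i, irreducible_poly (mu i)).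
Hypothesis chiA : char_poly A = \prod_(i < m) mu i ^+ e i.

(** Write [x ^+ z = a + b x].  Here [b] is nonzero, since otherwise the norm equation
    would give [a = +- 1], and [l ^+ (k * 2) = 1].  So [x = (l ^+ k - a) / b] is a rational polynomial in [l],
    and [M] is the value of this polynomial at [A]: each identity satisfied by [x]
    and [l] holds for [M] and [A] after multiplication by the cofactor. *)
Lemma unit_matrix k (t : int) (x l : algC) i (z : nat) :
    root (map_poly ratr (mu i)) l -> x ^+ 2 = t%:~R * x - 1 -> l ^+ k = x ^+ z ->
    l ^+ (k * 2) != 1 ->
  exists M : 'M[rat]_n'.+1, [/\ dcent A M,
    cofactor_mx A mu i *m (M *m M) = cofactor_mx A mu i *m (t%:~R *: M - 1%:M)
  & cofactor_mx A mu i *m A ^+ k = cofactor_mx A mu i *m M ^+ z].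
Proof.
move=> mu_l x2 lk l2k; have [a [b [Nab xz]]] := quad_power z x2.
have nz_b : b != 0.
  apply: contraNneq l2k => b0; rewrite exprM lk xz b0 mul0r addr0 -rmorphXn.
  by rewrite (_ : a ^+ 2 = 1) // -Nab b0 /quad_norm; ring.
have [p px] : exists p, (map_poly ratr p).[l] = x.
  exists (b%:~R^-1 *: ('X^k - (a%:~R)%:P)).
  rewrite map_polyZ rmorphB /= map_polyXn map_polyC /= !hornerE lk xz fmorphV !ratr_int.
  by field; rewrite intr_eq0.
pose M := horner_mx A p.
have kill r : (map_poly ratr r).[l] = 0 -> cofactor_mx A mu i *m horner_mx A r = 0.
  by move=> rl; apply: (cofactor_kill ssA mu_irr chiA mu_l); apply/eqP.
exists M; split; first exact: dcent_horner.
  have := kill (p ^+ 2 - (t%:~R *: p - 1)).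
  rewrite !(rmorphB, rmorphXn, rmorph1) /= !map_polyZ !hornerE px /= ratr_int.
  rewrite x2 subrr => /(_ erefl) /eqP.
  by rewrite linearZ -/M expr2 mulmxBr subr_eq0 => /eqP.
have := kill ('X^k - p ^+ z).
rewrite !(rmorphB, rmorphXn, rmorph1) /= map_polyX !hornerE px lk subrr => /(_ erefl) /eqP.
by rewrite horner_mx_X -/M mulmxBr subr_eq0 => /eqP.
Qed.

End Data.

(** [(x ^+ 2 - 1) ^+ 2 = (t - 2) * x ^+ 2] is positive. *)
Lemma quad_trace_ge3 (t : int) (x : algC) : x \is Num.real -> x ^+ 2 != 1 ->
  (x ^+ 2) ^+ 2 = t%:~R * x ^+ 2 - 1 -> 3 <= t.
Proof.
move=> real_x x2_neq1 x4.
have nz_x : x ^+ 2 != 0.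
  apply/negP => /eqP x0; have := x4; rewrite x0 mulr0 expr0n sub0r => /eqP.
  by rewrite eq_sym oppr_eq0 oner_eq0.
have x2_gt0 : 0 < x ^+ 2 by rewrite lt_def nz_x real_exprn_even_ge0.
have real1 : x ^+ 2 - 1 \is Num.real by rewrite rpredB ?rpredX ?rpred1.
have : 0 < (x ^+ 2 - 1) ^+ 2.
  by rewrite lt_def expf_eq0 subr_eq0 (negPf x2_neq1) real_exprn_even_ge0.
have -> : (x ^+ 2 - 1) ^+ 2 = (t - 2)%:~R * x ^+ 2.
  by rewrite sqrrB1 x4 rmorphB /= mulrBl -[2%:~R]/(2 : algC); ring.
by rewrite (pmulr_lgt0 _ x2_gt0) ltr0z; clear; lia.
Qed.

Lemma map_ratr_intr n (A : 'M[int]_n) :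
  map_mx (ratr : rat -> algC) (map_mx intr A) = map_mx intr A.
Proof. by apply/matrixP => i j; rewrite !mxE ratr_int. Qed.

(** The square [x ^+ 2] of the unit has norm 1 and trace at least 3.  For each factor
    [mu i] the power of [lambda i] is a natural power of [x ^+ 2] or of its inverse,
    which satisfies the same quadratic equation, so [unit_matrix] applies. *)
Lemma quadratic_arithmetic n (A : 'M[int]_n) (uA : A \in unitmx)
    (m : nat) (mu : 'I_m -> {poly rat}) (e : 'I_m -> nat) (lambda : 'I_m -> algC)
    (k : nat) (L : fieldExtType rat) (iota : {rmorphism L -> algC}) (eps : L) :
  hyperbolic A -> semisimple A ->
  (forall i, mu i \is monic) -> (forall i, irreducible_poly (mu i)) -> injective mu ->
  char_poly (map_mx intr A : 'M[rat]_n) = \prod_(i < m) mu i ^+ e i ->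
  (forall i, root (map_poly ratr (mu i)) (lambda i)) ->
  (forall i, eigenvalue (map_mx intr A) (lambda i)) ->
  (0 < k)%N -> real_quadratic iota -> integer_unit eps ->
  (forall i, exists z : int, lambda i ^+ k = iota eps ^ z) ->
  arithmetic (semidirect uA : groupType).
Proof.
move=> hypA ssA mu_monic mu_irr mu_inj chiA lambda_root lambda_eig k_gt0 quadL unit_eps lambda_pow.
have ssQ : diagonalizable (map_mx (ratr : rat -> algC) (map_mx intr A)).
  by rewrite map_ratr_intr.
case: n => [|n'] in A uA hypA ssA chiA lambda_eig ssQ *.
  apply: (@semidirect_arithmetic 0 A uA 1 3 0 (fun=> 0) (fun=> 0) (fun=> 0%N)) => //; try by case.
  by move=> X _; exact: flatmx0.
have [t eps4] := quad_unit_square quadL unit_eps.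
set x := iota eps in lambda_pow eps4.
have no_root_of_unity i d : (0 < d)%N -> lambda i ^+ d != 1.
  move=> d_gt0; apply: contra (hypA _ (lambda_eig i)) => /eqP l1.
  by rewrite -(pexpr_eq1 d_gt0) // -normrX l1 normr1.
have lambda_pow2 i : exists z : int, lambda i ^+ (k * 2) = (x ^+ 2) ^ z.
  by have [z lz] := lambda_pow i; exists z; rewrite exprM lz; exact: (exprzAC x z 2).
have m_gt0 : exists i : 'I_m, true.
  have [m0|m_gt0] := posnP m; last by exists (Ordinal m_gt0).
  have := size_char_poly (map_mx intr A : 'M[rat]_n'.+1).
  rewrite chiA big1 ?size_poly1 // => i _.
  by have := ltn_ord i; rewrite [in X in (_ < X)%N]m0.
have k2_gt0 : (0 < k * 2)%N by rewrite muln_gt0 k_gt0.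
have x2_neq1 : x ^+ 2 != 1.
  have [i _] := m_gt0; apply: contraNneq (no_root_of_unity i _ k2_gt0) => x1.
  by have [z ->] := lambda_pow2 i; rewrite x1 exp1rz.
have nz_x2 : x ^+ 2 != 0.
  by rewrite expf_eq0 fmorph_eq0; case: unit_eps.
have t_ge3 : 3 <= t by apply: quad_trace_ge3 eps4 => //; have [_ realL] := quadL; apply: realL.
have data i : exists Mz : 'M[rat]_n'.+1 * nat,
  let q := cofactor_mx (map_mx intr A) mu i in
  [/\ dcent (map_mx intr A) Mz.1, q *m (Mz.1 *m Mz.1) = q *m (t%:~R *: Mz.1 - 1%:M)
    & q *m map_mx intr A ^+ (k * 2) = q *m Mz.1 ^+ Mz.2].
  have [y [zn [y2 ly]]] : exists (y : algC) (zn : nat),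
      y ^+ 2 = t%:~R * y - 1 /\ lambda i ^+ (k * 2) = y ^+ zn.
    have [[z|z] lz] := lambda_pow2 i; first by exists (x ^+ 2), z.
    exists (x ^+ 2)^-1, z.+1; split; last by rewrite lz NegzE -exprnN exprVn.
    rewrite exprVn.
    apply: (mulfI (expf_neq0 2 nz_x2)); rewrite (divff (expf_neq0 2 nz_x2)).
    by rewrite mulrBr mulr1 mulrCA expr2 mulfK // -expr2 eps4; ring.
  have no_root : lambda i ^+ (k * 2 * 2) != 1 by rewrite no_root_of_unity // muln_gt0 k2_gt0.
  have [M [dM Mq Mp]] := unit_matrix ssQ mu_irr chiA (lambda_root i) y2 ly no_root.
  by exists (M, zn).
have [Mz Mz_data] := fin_all_exists data.
apply: (@semidirect_arithmetic _ A uA (k * 2) t m (cofactor_mx (map_mx intr A) mu)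
  (fun i => (Mz i).1) (fun i => (Mz i).2)) => //.
- by move=> i; apply: dcent_horner.
- by move=> i; have [] := Mz_data i.
- by move=> i; have [] := Mz_data i.
- by move=> i; have [] := Mz_data i.
exact: (cofactor_separate ssQ mu_monic mu_irr mu_inj chiA).
Qed.

Theorem theorem2 (n : nat) (A : 'M[int]_n) (uA : A \in unitmx)
    (hypA : hyperbolic A) (ssA : semisimple A)
    (m : nat) (mu : 'I_m -> {poly rat}) (e : 'I_m -> nat)
    (mu_monic : forall i, mu i \is monic)
    (mu_irr : forall i, irreducible_poly (mu i))
    (mu_inj : injective mu)
    (e_gt0 : forall i, (0 < e i)%N)
    (chiA : char_poly (map_mx intr A : 'M[rat]_n) = \prod_(i < m) mu i ^+ e i)
    (lambda : 'I_m -> algC)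
    (lambda_root : forall i, root (map_poly ratr (mu i)) (lambda i))
    (realA : real_eigenvalues A) :
  arithmetic (semidirect uA : groupType) <->
  exists2 k : nat, (0 < k)%N &
    exists (L : fieldExtType rat) (iota : {rmorphism L -> algC}) (eps : L),
      [/\ real_quadratic iota, integer_unit eps
        & forall i, exists z : int, lambda i ^+ k = iota eps ^ z].
Proof.
have lambda_eig i : eigenvalue (map_mx intr A) (lambda i).
  rewrite -map_ratr_intr eigenvalue_root_char -map_char_poly chiA rmorph_prod /root horner_prod.
  apply/prodf_eq0; exists i => //; rewrite rmorphXn horner_exp.
  by rewrite expf_eq0 e_gt0; apply: lambda_root.
split=> [|[k k_gt0 [L [iota [eps [quadL unit_eps lambda_pow]]]]]]; last first.
  exact: (quadratic_arithmetic uA hypA ssA mu_monic mu_irr mu_inj chiA lambda_root lambda_eig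
    k_gt0 quadL unit_eps lambda_pow).
have [m0|m_gt0] := posnP m; last exact: (arithmetic_unit hypA realA lambda_eig m_gt0).
(* Only for the empty matrix; any real quadratic unit will do. *)
move=> _; exists 1%N => //.
have [|||L [iota [eps [quadL unit_eps _]]]] := @quadratic_field 3 ((3 + sqrtC 5) / 2).
- by rewrite realM ?realV ?realD ?realn // ger0_real // sqrtC_ge0.
- have s2 : sqrtC 5 ^+ 2 = 5 :> algC by rewrite sqrtCK.
  by rewrite exprMn sqrrD s2; field.
- rewrite -subr_eq0; have s2 : sqrtC 5 ^+ 2 = 5 :> algC by rewrite sqrtCK.
  have -> : ((3 + sqrtC 5) / 2) ^+ 2 - 1 = (5 + 3 * sqrtC 5) / 2 :> algC.
    by rewrite exprMn sqrrD s2; field.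
  have s0 : 0 <= sqrtC (5 : algC) by rewrite sqrtC_ge0.
  by rewrite gt_eqF // divr_gt0 // ltr_wpDr // mulr_ge0.
exists L, iota, eps; split=> // i.
by have := ltn_ord i; rewrite [in X in (_ < X)%N]m0.
Qed.
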